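(* Let $\Omega$ and the data $a_{ij},b_i,c,f,g,\lambda,\Lambda$ be as in the context, so that (A1)--(A3) hold, and let $\alpha\in\mathbb{R}$, $\beta>0$. Let $\mathcal{D},\mathfrak{n}_{\mathcal{D}},n_i\in\mathbb{N}^+$, $n_{\mathcal{D}}=1$, $B_\theta\ge1$, and let $\rho$ be a function such that $\rho,\rho'$ are bounded by $B_\rho,B_{\rho'}\le1$ and have Lipschitz constants $L_\rho,L_{\rho'}\le1$, respectively. Assume that the parameterized function class satisfies $\mathcal{P}\subset\mathcal{N}_\rho(\mathcal{D},\mathfrak{n}_{\mathcal{D}},B_\theta)$. Let $$\mathcal{E}_{sta}:=2\sup_{u\in\mathcal{P}}\Big|\sup_{v\in\mathcal{P}}\mathcal{L}(u,v)-\sup_{v\in\mathcal{P}}\widehat{\mathcal{L}}(u,v)\Big|.$$ Then, if $N=M$, $$\mathbb{E}_{\{X_i\}_{i=1}^N,\{Y_j\}_{j=1}^M}\mathcal{E}_{sta}\le\frac{C(\Omega,coe,\alpha)}{\beta}\cdot\frac{d^3\,\mathcal{D}^{\frac12}\,\mathfrak{n}_{\mathcal{D}}^{\frac72\mathcal{D}-\frac32}\,B_\theta^{\frac72\mathcal{D}+\frac12}}{N^{\frac14}}.$$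
   Context: Domain. $\Omega\subset[0,1]^d$ is a bounded domain whose boundary is regular enough for the zero-order trace operator $T_0:H^1(\Omega)\to L^2(\partial\Omega)$ to be defined. $(\cdot,\cdot)$ is the $L^2(\Omega)$ inner product and $(\cdot,\cdot)|_{\partial\Omega}$ the $L^2(\partial\Omega)$ inner product. Assumptions. (A1) $f\in L^2(\Omega)$, $g\in L^2(\partial\Omega)$, $a_{ij}\in C(\bar\Omega)$, $b_i,c\in L^\infty(\Omega)$, $c>0$. (A2) There exist $\lambda,\Lambda>0$ such that $\lambda|\xi|^2\le\sum_{i,j=1}^d a_{ij}(x)\xi_i\xi_j\le\Lambda|\xi|^2$ for all $x\in\Omega$, $\xi\in\mathbb{R}^d$. (A3) $4\lambda c>d\max_{1\le i\le d}\|b_i\|_{L^\infty(\Omega)}^2$. Constants. $C(coe)$ abbreviates $C(\|f\|_{L^2(\Omega)},\|g\|_{L^2(\partial\Omega)},\|a_{ij}\|_{C(\bar\Omega)},\|b_i\|_{L^\infty(\Omega)},\|c\|_{L^\infty(\Omega)},\lambda)$, i.e. constants depending on the known terms in the equation; $C(\Omega,coe,\alpha)$ may also depend on $\Omega,\alpha$. Losses. For $u,v\in H^1(\Omega)$, $$\mathcal{L}(u,v)=\sum_{i,j=1}^d(a_{ij}\partial_iu,\partial_jv)+\sum_{i=1}^d(b_i\partial_iu,v)+(cu,v)+\frac{\alpha}{\beta}(T_0u,T_0v)|_{\partial\Omega}-(f,v)-\frac1\beta(g,T_0v)|_{\partial\Omega}.$$ With $X_1,\dots,X_N$ i.i.d.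 uniform on $\Omega$ and $Y_1,\dots,Y_M$ i.i.d. uniform on $\partial\Omega$, for $C^1$ functions $u,v$, $$\widehat{\mathcal{L}}(u,v)=\frac{|\Omega|}{N}\sum_{k=1}^N\Big(\sum_{i,j=1}^d(a_{ij}\partial_iu\,\partial_jv)(X_k)+\sum_{i=1}^d(b_i\,\partial_iu\,v)(X_k)+(cuv)(X_k)-(fv)(X_k)\Big)+\frac{|\partial\Omega|}{\beta M}\sum_{k=1}^M\big(\alpha\,(T_0u\,T_0v)(Y_k)-(g\,T_0v)(Y_k)\big).$$ Neural networks. A network with activation $\rho$ (acting componentwise), depth $\mathcal{D}$ and layer sizes $n_0=d,n_1,\dots,n_{\mathcal{D}}$ is $\mathbf{f}_0(x)=x$, $\mathbf{f}_\ell(x)=\rho(A_\ell\mathbf{f}_{\ell-1}(x)+\mathbf{b}_\ell)$ for $1\le\ell\le\mathcal{D}-1$, $\mathbf{f}(x)=A_{\mathcal{D}}\mathbf{f}_{\mathcal{D}-1}(x)+\mathbf{b}_{\mathcal{D}}$, with $A_\ell\in\mathbb{R}^{n_\ell\times n_{\ell-1}}$, $\mathbf{b}_\ell\in\mathbb{R}^{n_\ell}$. $\mathcal{N}_\rho(\mathcal{D},\mathfrak{n}_{\mathcal{D}},B_\theta)$ is the collection of functions implemented by such networks with depth $\mathcal{D}$, total number of nonzero weights (entries of all $A_\ell,\mathbf{b}_\ell$) $\mathfrak{n}_{\mathcal{D}}$, and every weight bounded in absolute value by $B_\theta$. A parameterized class is indexed by the vector $\theta\in\mathbb{R}^{\mathfrak{n}_{\mathcal{D}}}$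 of these weights for a fixed architecture (fixed layer sizes $n_i$ and fixed positions of the weights).
   Formalization: The constant C(Ω,coe,α) may also depend on an arbitrary upper bound β0 of β, and the bound holds for all 0<β≤β0; with C independent of β for every β>0 the claim fails as β→∞, since the interior part of the error carries no factor 1/β. *)

(* Defs.v *)
From HB Require Import structures.
From mathcomp Require Import all_boot all_order all_algebra.
From mathcomp Require Import all_classical all_reals all_analysis.
From mathcomp Require Import measurable_realfun lra.
Set Implicit Arguments.
Unset Strict Implicit.
Unset Printing Implicit Defensive.
Import Order.TTheory GRing.Theory Num.Theory.
Import numFieldNormedType.Exports.
Local Open Scope classical_set_scope.
Local Open Scope ring_scope.
(* The Borel sigma-algebra of R^n. *)
HB.instance Definition _ (R : realType) (n : nat) :=
  @isMeasurable.Build (sigma_display (@open 'rV[R]_n)) 'rV[R]_n <<s open >>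
    (@sigma_algebra0 _ setT _) (@sigma_algebraC _ _)
    (@sigma_algebra_bigcup _ setT _).

Lemma measurable_fun_rV d (T : measurableType d) (R : realType) (n : nat)
    (f : T -> 'rV[R]_n) :
  (forall i, measurable_fun setT (fun t => f t 0 i)) -> measurable_fun setT f.
Proof.
move=> mf; apply: (@measurability _ _ _ _ _ _ (@open 'rV[R]_n)) => //.
move=> _ [A oA <-]; rewrite setTI.
pose J : countType := {ffun 'I_n -> rat * rat}.
pose B (q : J) : set T := \bigcap_(i in [set: 'I_n])
  ((fun t => f t 0 i) @^-1` [set` `]ratr (q i).1, ratr (q i).2]%R]).
pose F (q : J) := if `[< B q `<=` f @^-1` A >] then B q else set0.
have -> : f @^-1` A = \bigcup_q F q.
  apply/seteqP; split => [t At|t [q _]]; last first.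
    by rewrite /F; case: asboolP => // BA /BA.
  have /nbhs_ballP[e /= e0 Be] : nbhs (f t) A by exact: open_nbhs_nbhs.
  have e20 : 0 < e / 2 by rewrite divr_gt0.
  have lo (i : 'I_n) : {q : rat * rat | [/\ f t 0 i - e / 2 < ratr q.1 < f t 0 i &
     f t 0 i < ratr q.2 < f t 0 i + e / 2]}.
    have h1 : f t 0 i - e / 2 < f t 0 i by rewrite ltrBlDr ltrDl.
    have h2 : f t 0 i < f t 0 i + e / 2 by rewrite ltrDl.
    have [q1] := cid (rat_in_itvoo h1); rewrite in_itv /= => hq1.
    have [q2] := cid (rat_in_itvoo h2); rewrite in_itv /= => hq2.
    by exists (q1, q2).
  pose q : J := [ffun i => sval (lo i)].
  have Bt : B q t.
    move=> i _ /=; rewrite in_itv /= /q ffunE; case: (lo i) => -[a b] /=.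
    by move=> [/andP[_ ->] /andP[/ltW-> _]].
  exists q => //; rewrite /F; case: asboolP => // -[] s Bs /=.
  apply: Be; split=> // j i; rewrite ord1.
  have := Bs i Logic.I; rewrite /= in_itv /= /q ffunE.
  case: (lo i) => -[a b] /= [/andP[h1 h2] /andP[h3 h4]] /andP[h5 h6].
  by rewrite /ball /= ltr_norml; apply/andP; split; lra.
apply: countable_bigcupT_measurable => [|q]; first exact: countableP.
rewrite /F; case: ifPn => // _.
apply: fin_bigcap_measurable => // i _.
by rewrite -[X in measurable X]setTI; apply: mf.
Qed.

Lemma measurable_coord (R : realType) (n : nat) (i : 'I_n) :
  measurable_fun setT (fun x : 'rV[R]_n => x 0 i).
Proof.
apply: (measurability _ (RGenInftyO.measurableE R)).
move=> _ [_ [a ->] <-]; rewrite setTI; apply: sub_sigma_algebra.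
by apply: open_comp => [x _|]; [exact: coord_continuous|exact: interval_open].
Qed.

Section lebesgue_rV.
Context {R : realType}.

Definition cons_rV n (p : R * 'rV[R]_n) : 'rV[R]_n.+1 := row_mx p.1%:M p.2.

Lemma measurable_cons_rV n : measurable_fun setT (@cons_rV n).
Proof.
apply: measurable_fun_rV => i; rewrite /cons_rV.
under eq_fun => p do rewrite mxE.
case: splitP => j _.
  rewrite (_ : (fun p : R * 'rV[R]_n => _) = fst); first exact: measurable_fst.
  by apply/funext => p; rewrite mxE !ord1 eqxx mulr1n.
exact: measurableT_comp (measurable_coord j) measurable_snd.
Qed.

Section step.
Context {n : nat} (mu : {sigma_finite_measure set 'rV[R]_n -> \bar R}).

Definition lebesgue_rVS : set 'rV[R]_n.+1 -> \bar R :=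
  pushforward (lebesgue_measure \x mu)%E (@cons_rV n).

Let lebesgue_rVS0 : lebesgue_rVS set0 = 0%E.
Proof. by rewrite /lebesgue_rVS /pushforward preimage_set0 measure0. Qed.

Let lebesgue_rVS_ge0 A : (0 <= lebesgue_rVS A)%E.
Proof. by rewrite /lebesgue_rVS /pushforward measure_ge0. Qed.

Let lebesgue_rVS_sigma_additive : semi_sigma_additive lebesgue_rVS.
Proof.
have mc A : measurable A -> measurable (@cons_rV n @^-1` A).
  by move=> mA; rewrite -[X in measurable X]setTI; exact: measurable_cons_rV.
move=> F mF tF mUF. rewrite /lebesgue_rVS /pushforward preimage_bigcup.
apply: measure_semi_sigma_additive.
- by move=> k; exact: mc.
- by apply/trivIsetP => i j _ _ ij; rewrite -preimage_setI;
    move/trivIsetP : tF => /(_ _ _ _ _ ij) ->//; rewrite preimage_set0.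
- by rewrite -preimage_bigcup; exact: mc.
Qed.

HB.instance Definition _ := isMeasure.Build _ _ _ lebesgue_rVS
  lebesgue_rVS0 lebesgue_rVS_ge0 lebesgue_rVS_sigma_additive.

Let lebesgue_rVS_sigma_finite : sigma_finite setT lebesgue_rVS.
Proof.
pose g (x : 'rV[R]_n.+1) : R * 'rV[R]_n := (x 0 0, @rsubmx R 1 1 n x).
have gK : cancel g (@cons_rV n).
  move=> x; rewrite /cons_rV /g /=.
  rewrite (_ : (x 0 0)%:M = @lsubmx R 1 1 n x) ?(@hsubmxK R 1 1 n)//.
  apply/rowP => i; rewrite !mxE !ord1 eqxx mulr1n.
  by congr (x _ _); apply/val_inj.
have Kg : cancel (@cons_rV n) g.
  move=> [a x]; rewrite /cons_rV /g /= row_mxKr; congr pair.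
  by rewrite mxE; case: splitP => // j _; rewrite mxE !ord1 eqxx mulr1n.
have mg : measurable_fun setT g.
  apply: measurable_fun_pair; first exact: measurable_coord.
  apply: measurable_fun_rV => i.
  by under eq_fun => x do rewrite mxE; exact: measurable_coord.
have [F FT mF] : sigma_finite setT (@lebesgue_measure R \x mu)%E.
  have /sigma_finiteP[F [TF ndF Foo]] := sigma_finiteT (@lebesgue_measure R).
  have /sigma_finiteP[G [TG ndG Goo]] := sigma_finiteT mu.
  exists (fun k => F k `*` G k).
    rewrite -setXTT TF TG; apply/seteqP; split => -[x y].
      move=> [/= [k _ Fx] [l _ Gy]]; exists (maxn k l) => //; split.
      - by move: x Fx; exact/subsetPset/ndF/leq_maxl.
      - by move: y Gy; exact/subsetPset/ndG/leq_maxr.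
    by move=> [k _ []/= ? ?]; split; exists k.
  move=> k; have [? ?] := Foo k; have [? ?] := Goo k.
  split; first exact: measurableX.
  by rewrite product_measure1E// lte_mul_pinfty// ge0_fin_numE.
exists (fun k => g @^-1` F k).
  by rewrite -preimage_bigcup -FT preimage_setT.
move=> k; have [mFk Fk] := mF k; split.
  by rewrite -[X in measurable X]setTI; exact: mg.
rewrite /lebesgue_rVS /pushforward -comp_preimage.
by rewrite (_ : g \o _ = id)//; apply/funext => x; exact: Kg.
Qed.

HB.instance Definition _ := Measure_isSigmaFinite.Build _ _ _ lebesgue_rVS
  lebesgue_rVS_sigma_finite.

End step.

(* Lebesgue measure on the Borel sets of R^n, as an iterated product measure. *)
Fixpoint lebesgue_rV (n : nat) : {sigma_finite_measure set 'rV[R]_n -> \bar R} :=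
  match n with
  | 0 => \d_(0 : 'rV[R]_0)
  | m.+1 => lebesgue_rVS (lebesgue_rV m)
  end.

End lebesgue_rV.

Section hausdorff.
Context {R : realType} {n : nat}.
Implicit Types (x y : 'rV[R]_n) (A B U : set 'rV[R]_n) (s : nat) (e : R).
Local Open Scope ereal_scope.

(* The norm that the library puts on 'rV is the sup norm. *)
Definition enorm x : R := Num.sqrt (\sum_i x 0 i ^+ 2)%R.

Definition ediam U : R := sup [set r | exists x y, [/\ U x, U y & r = enorm (x - y)]].

Definition unit_ball_volume s : R :=
  fine (lebesgue_rV s [set x : 'rV[R]_s | \sum_i x 0 i ^+ 2 <= 1]%R).

(* The factor unit_ball_volume s / 2 ^ s is the normalization for which the
   s-dimensional Hausdorff measure is the usual s-dimensional area. The case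
   of set0 only matters for s = 0, where (ediam U / 2) ^+ 0 = 1. *)
Definition hausdorff_gauge s U : \bar R :=
  if `[< U = set0 >] then 0 else (unit_ball_volume s * (ediam U / 2) ^+ s)%:E.

Definition mesh_le e U := forall x y, U x -> U y -> (enorm (x - y) <= e)%R.

Definition hausdorff_pre s e A : \bar R :=
  ereal_inf [set \sum_(k <oo) hausdorff_gauge s (F k) | F in
    [set F : (set 'rV[R]_n)^nat | (forall k, mesh_le e (F k)) /\ A `<=` \bigcup_k F k]].

Definition hausdorff s A : \bar R :=
  ereal_sup [set hausdorff_pre s e A | e in [set e : R | (0 < e)%R]].

Lemma enorm_ge0 x : (0 <= enorm x)%R. Proof. exact: sqrtr_ge0. Qed.

Lemma le_coord_enorm x i : (`|x 0%R i| <= enorm x)%R.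
Proof.
rewrite -sqrtr_sqr ler_wsqrtr// (bigD1 i)//= lerDl sumr_ge0// => j _.
exact: sqr_ge0.
Qed.

Lemma ediam_ge0 U : (0 <= ediam U)%R.
Proof.
rewrite /ediam; set D := [set r | _].
have [sD|nsD] := pselect (has_sup D); last by rewrite sup_out.
have [[r Dr] _] := sD; apply: (le_trans _ (sup_upper_bound sD Dr)).
by have [x [y [_ _ ->]]] := Dr; exact: enorm_ge0.
Qed.

Lemma hausdorff_gauge0 s : hausdorff_gauge s set0 = 0.
Proof. by rewrite /hausdorff_gauge; case: asboolP. Qed.

Lemma hausdorff_gauge_ge0 s U : 0 <= hausdorff_gauge s U.
Proof.
rewrite /hausdorff_gauge; case: asboolP => // _.
rewrite lee_fin mulr_ge0 ?fine_ge0// exprn_ge0// divr_ge0//.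
exact: ediam_ge0.
Qed.

Let gauge_mesh s e U := if `[< mesh_le e U >] then hausdorff_gauge s U else +oo.

Let gauge_mesh_ge0 s e U : 0 <= gauge_mesh s e U.
Proof.
by rewrite /gauge_mesh; case: asboolP => // _; exact: hausdorff_gauge_ge0.
Qed.

Let gauge_mesh0 s e : gauge_mesh s e set0 = 0.
Proof.
by rewrite /gauge_mesh; case: asboolP => [_|[]//]; exact: hausdorff_gauge0.
Qed.

Let discrete := g_sigma_algebraType [set: set 'rV[R]_n].

Let hausdorff_preE s e :
  hausdorff_pre s e = mu_ext (gauge_mesh s e : set discrete -> \bar R).
Proof.
apply/funext => A; apply/eqP; rewrite eq_le; apply/andP; split.
- apply: le_ereal_inf_tmp => _ [F [_ AF] <-].
  have [mF|] := pselect (forall k, mesh_le e (F k)).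
    apply: ereal_inf_lbound; exists F => //.
    by apply: eq_eseriesr => k _; rewrite /gauge_mesh asboolT.
  move/existsNP => [k mFk].
  rewrite (eseries_pinfty _ _ (_ : gauge_mesh s e (F k) = +oo)) ?leey//.
    by move=> m _; rewrite -ltNye (lt_le_trans _ (gauge_mesh_ge0 _ _ _)).
  by rewrite /gauge_mesh asboolF.
- apply: le_ereal_inf_tmp => _ [F [mF AF] <-].
  apply: ereal_inf_lbound; exists F.
    by split => // k; exact: sub_sigma_algebra.
  by apply: eq_eseriesr => k _; rewrite /gauge_mesh asboolT.
Qed.

Lemma hausdorff_pre_ge0 s e A : 0 <= hausdorff_pre s e A.
Proof. by rewrite hausdorff_preE; apply: mu_ext_ge0. Qed.

Lemma le_hausdorff_pre s e e' A : (e <= e')%R ->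
  hausdorff_pre s e' A <= hausdorff_pre s e A.
Proof.
move=> ee'; apply: ereal_inf_le_tmp => _ [F [mF AF] <-]; exists F => //.
by split => // k x y Fx Fy; exact: le_trans (mF k x y Fx Fy) ee'.
Qed.

Lemma hausdorff_pre_le s e A : (0 < e)%R -> hausdorff_pre s e A <= hausdorff s A.
Proof. by move=> e0; apply: ereal_sup_ubound; exists e. Qed.

Lemma hausdorff0 s : hausdorff s set0 = 0.
Proof.
apply/eqP; rewrite eq_le; apply/andP; split.
  apply: ge_ereal_sup => _ [e e0 <-].
  by rewrite hausdorff_preE mu_ext0.
by apply: le_trans (hausdorff_pre_le s _ (ltr01)); exact: hausdorff_pre_ge0.
Qed.

Lemma hausdorff_ge0 s A : 0 <= hausdorff s A.
Proof.
by apply: le_trans (hausdorff_pre_le s _ (ltr01)); exact: hausdorff_pre_ge0.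
Qed.

Lemma le_hausdorff s : {homo hausdorff s : A B / A `<=` B >-> A <= B}.
Proof.
move=> A B AB; apply: ge_ereal_sup => _ [e e0 <-].
by apply: le_trans (hausdorff_pre_le s _ e0); rewrite hausdorff_preE le_mu_ext.
Qed.

Lemma hausdorff_sigma_subadditive s : sigma_subadditive (hausdorff s).
Proof.
move=> F; apply: ge_ereal_sup => _ [e e0 <-].
apply: (@le_trans _ _ (\sum_(i <oo) hausdorff_pre s e (F i))).
  by rewrite hausdorff_preE; apply: mu_ext_sigma_subadditive.
apply: lee_nneseries => [k _ _|k _]; first exact: hausdorff_pre_ge0.
exact: hausdorff_pre_le.
Qed.

HB.instance Definition _ s := isOuterMeasure.Build R 'rV[R]_n (hausdorff s)
  (hausdorff0 s) (hausdorff_ge0 s) (@le_hausdorff s)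
  (@hausdorff_sigma_subadditive s).

Lemma hausdorff_sep s e A B : (0 < e)%R ->
  (forall x y, A x -> B y -> (e <= enorm (x - y))%R) ->
  hausdorff s A + hausdorff s B <= hausdorff s (A `|` B).
Proof.
move=> e0 sepAB.
have step d1 d2 : (0 < d1)%R -> (0 < d2)%R ->
    hausdorff_pre s d1 A + hausdorff_pre s d2 B <= hausdorff s (A `|` B).
  move=> d10 d20; pose d := Num.min (Num.min d1 d2) (e / 2)%R.
  have d0 : (0 < d)%R by rewrite !lt_min d10 d20 divr_gt0.
  have dd1 : (d <= d1)%R by rewrite !ge_min lexx.
  have dd2 : (d <= d2)%R by rewrite !ge_min lexx orbT.
  have de : (d < e)%R.
    by rewrite gt_min; apply/orP; right; rewrite ltr_pdivrMr// ltr_pMr// ltr1n.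
  apply: le_trans (hausdorff_pre_le s _ d0).
  apply: (le_trans (leeD (le_hausdorff_pre s _ dd1) (le_hausdorff_pre s _ dd2))).
  apply: le_ereal_inf_tmp => _ [F [mF ABF] <-].
  pose P X k := `[< F k `&` X !=set0 >].
  pose G X k := if P X k then F k else set0.
  have Gle X : X `<=` A `|` B ->
      hausdorff_pre s d X <= \sum_(k <oo) hausdorff_gauge s (G X k).
    move=> XAB; apply: ereal_inf_lbound; exists (G X) => //; split.
      by move=> k; rewrite /G; case: ifP => // _ x y [].
    move=> x Xx; have [k _ Fx] := ABF _ (XAB _ Xx); exists k => //.
    by rewrite /G /P asboolT//; exists x.
  apply: (le_trans (leeD (Gle A _) (Gle B _))); [by left|by right|].
  rewrite -nneseriesD; [|by move=> *; exact: hausdorff_gauge_ge0..].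
  apply: lee_nneseries => [k _ _|k _].
    by apply: adde_ge0; exact: hausdorff_gauge_ge0.
  rewrite /G; case: ifPn => PA; case: ifPn => PB;
    rewrite ?hausdorff_gauge0 ?adde0 ?add0e ?hausdorff_gauge_ge0//.
  move: PA PB => /asboolP[x [Fx Ax]] /asboolP[y [Fy By]].
  have := le_lt_trans (mF k x y Fx Fy) de.
  by rewrite ltNge sepAB.
have [AB|] := eqVneq (hausdorff s (A `|` B)) +oo; first by rewrite AB leey.
move=> ABoo.
have ABfin : hausdorff s (A `|` B) \is a fin_num.
  by rewrite ge0_fin_numE ?lt_neqAle ?ABoo ?leey// hausdorff_ge0.
have Hfin X : X `<=` A `|` B -> hausdorff s X \is a fin_num.
  move=> XAB; rewrite ge0_fin_numE ?hausdorff_ge0//.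
  by apply: le_lt_trans (le_hausdorff s XAB) _; rewrite -ge0_fin_numE ?hausdorff_ge0.
have Bfin := Hfin B (@subsetUr _ _ _).
rewrite -leeBrDr//; apply: ge_ereal_sup => _ [d1 d10 <-].
rewrite leeBrDr// addeC.
have Afin : hausdorff_pre s d1 A \is a fin_num.
  rewrite ge0_fin_numE ?hausdorff_pre_ge0//.
  apply: le_lt_trans (hausdorff_pre_le s _ d10) _.
  by rewrite -ge0_fin_numE ?hausdorff_ge0// Hfin//; exact: subsetUl.
rewrite -leeBrDr//; apply: ge_ereal_sup => _ [d2 d20 <-].
by rewrite leeBrDr// addeC step.
Qed.


Lemma hausdorff_halfspace s (i : 'I_n) (r : R) :
  (hausdorff s).-cara.-measurable [set x : 'rV[R]_n | (r < x 0 i)%R].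
Proof.
apply: le_caratheodory_measurable => X.
pose H := [set x : 'rV[R]_n | (r < x 0 i)%R].
change (hausdorff s (X `&` H) + hausdorff s (X `&` ~` H) <= hausdorff s X).
have [->|Xoo] := eqVneq (hausdorff s X) +oo; first by rewrite leey.
pose a k : R := (r + k.+1%:R^-1)%R.
have a_lt j k : (j < k)%N -> (a k < a j)%R.
  by move=> jk; rewrite ltrD2l ltf_pV2 ?posrE// ltr_nat.
pose T k := X `&` [set x | (a k < x 0 i)%R].
pose D k := X `&` [set x | (a k.+1 < x 0 i <= a k)%R].
have sep A B (c d : R) : (c < d)%R -> (forall x, A x -> x 0 i <= c)%R ->
    (forall x, B x -> d < x 0 i)%R ->
    hausdorff s A + hausdorff s B <= hausdorff s (A `|` B).
  move=> cd Ac Bd; apply: (@hausdorff_sep s (d - c)); first by rewrite subr_gt0.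
  move=> x y Ax By; apply: le_trans (le_coord_enorm (x - y) i).
  rewrite !mxE distrC; apply: le_trans (ler_norm _).
  by have := Ac _ Ax; have := Bd _ By; lra.
have TX k : hausdorff s (T k) <= hausdorff s X by apply: le_hausdorff => x [].
have step k : hausdorff s (D k.+1) + hausdorff s (T k) <= hausdorff s (T k.+2).
  apply: (le_trans (@sep _ _ (a k.+1) (a k) _ _ _)).
  - exact: a_lt.
  - by move=> x [_ /andP[]].
  - by move=> x [].
  - apply: le_hausdorff => x [[Xx /andP[? _]]|[Xx ?]]; split => //=.
    by apply: (lt_trans (a_lt k k.+2 _)).
have sumD m : \sum_(0 <= k < m) hausdorff s (D k.+1) <=
    hausdorff s (T m) + hausdorff s (T m.+1).
  elim: m => [|m IH]; first by rewrite big_geq// adde_ge0 ?hausdorff_ge0.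
  rewrite big_nat_recr//=; apply: (le_trans (leeD IH (lexx _))).
  rewrite addeAC addeC; apply: leeD => //.
  by rewrite addeC.
have sumDoo : \sum_(k <oo) hausdorff s (D k.+1) < +oo.
  apply: (@le_lt_trans _ _ (hausdorff s X + hausdorff s X)); last first.
    by rewrite lte_add_pinfty// lt_neqAle Xoo leey.
  apply: lime_le; first by apply: is_cvg_nneseries => *; exact: hausdorff_ge0.
  by apply: nearW => m; apply: (le_trans (sumD m)); exact: leeD.
have tail := nneseries_tail_cvg sumDoo (fun k _ => hausdorff_ge0 s (D k.+1)).
have cover m : hausdorff s (X `&` H) <=
    hausdorff s (T m.+1) + \sum_(m <= k <oo) hausdorff s (D k.+1).
  have sub : X `&` H `<=` T m.+1 `|` \bigcup_(k in ~` `I_m) D k.+1.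
    move=> x [Xx rx].
    have ex : exists k, (a k < x 0 i)%R.
      have d0 : (0 < x 0 i - r)%R by rewrite subr_gt0.
      exists (Num.truncn (x 0 i - r)^-1)%R.
      rewrite /a addrC -ltrBrDr invf_plt ?posrE//.
      by rewrite truncnS_gt.
    case: (ex_minnP ex) => k akx kmin.
    have [km|mk] := leqP k m.+1.
      left; split => //=; apply: le_lt_trans akx.
      by rewrite lerD2l lef_pV2 ?posrE// ler_nat.
    case: k akx kmin mk => // -[//|k] akx kmin mk.
    right; exists k; first by apply/negP; rewrite -leqNgt.
    split => //=; rewrite akx /= leNgt; apply/negP => /kmin.
    by rewrite ltnn.
  apply: (le_trans (le_hausdorff s sub)).
  apply: (le_trans (outer_measureU2 _ _ _)).
  by rewrite leeD2l// outer_measure_sigma_subadditive_tail.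
have bound m : hausdorff s (X `&` H) + hausdorff s (X `&` ~` H) <=
    hausdorff s X + \sum_(m <= k <oo) hausdorff s (D k.+1).
  apply: (le_trans (leeD (cover m) (lexx _))).
  rewrite addeAC leeD2r//.
  rewrite addeC; apply: (le_trans (@sep _ _ r (a m.+1) _ _ _)).
  - by rewrite ltrDl invr_gt0.
  - by move=> x [_ /negP]; rewrite -leNgt.
  - by move=> x [].
  - by apply: le_hausdorff => x [] [].
apply/lee_addgt0Pr => e e0.
have [m _ /(_ m (leqnn m)) /= tm] :
    \forall m \near \oo, \sum_(m <= k <oo) hausdorff s (D k.+1) < e%:E.
  have lt0e : nbhs (0 : \bar R) [set x | x < e%:E].
    by apply: open_nbhs_nbhs; split; [exact: open_ereal_lt_ereal|rewrite /= lte_fin].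
  exact: tail lt0e.
by apply: le_trans (bound m) _; rewrite leeD2l// ltW.
Qed.

(* (n-1)-dimensional Hausdorff measure, on the Borel sets of R^n. *)
Definition surface_measure : set 'rV[R]_n -> \bar R := hausdorff n.-1.

Let mcara A : measurable A -> (hausdorff n.-1).-cara.-measurable A.
Proof.
pose C := caratheodory_type (hausdorff n.-1).
have mid : measurable_fun [set: C] (idfun : C -> 'rV[R]_n).
  apply: measurable_fun_rV => i.
  apply: (measurability _ (RGenOInfty.measurableE R)).
  move=> _ [_ [r ->] <-]; rewrite setTI.
  rewrite (_ : _ @^-1` _ = [set x : 'rV[R]_n | (r < x 0 i)%R]).
    exact: hausdorff_halfspace.
  by apply/seteqP; split => x; rewrite /= in_itv /= andbT.
by move=> mA; have := mid measurableT A mA; rewrite setTI.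
Qed.

Let surface_measure_sigma_additive : semi_sigma_additive surface_measure.
Proof.
move=> F mF tF mUF.
apply: (@caratheodory_measure_sigma_additive _ _ (hausdorff n.-1)) => //.
- by move=> k; exact: mcara.
- exact: mcara.
Qed.

HB.instance Definition _ := isMeasure.Build _ _ _ surface_measure
  (hausdorff0 _) (hausdorff_ge0 _) surface_measure_sigma_additive.

End hausdorff.
Arguments surface_measure {R} n.

Section function_spaces.
Context {R : realType} {d : nat}.
Local Notation E := 'rV[R]_d.
Implicit Types (mu : {measure set E -> \bar R}) (D Omega : set E) (u v g phi : E -> R).

Definition boundary Omega : set E := closure Omega `\` interior Omega.

(* L^p(D, mu), for functions defined on the whole space of which only the
   values on D matter. *)
Definition Lp_on mu (p : \bar R) D u :=
  measurable_fun D u /\ ('N[mu]_p[EFin \o (u \_ D)] < +oo)%E.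

Definition Lp_norm mu (p : \bar R) D u : R := fine 'N[mu]_p[EFin \o (u \_ D)].

Definition L2 Omega := Lp_on (lebesgue_rV d) 2%:E Omega.
Definition L2_norm Omega := Lp_norm (lebesgue_rV d) 2%:E Omega.
Definition L2_bd Omega := Lp_on (surface_measure d) 2%:E (boundary Omega).
Definition L2_bd_norm Omega :=
  Lp_norm (surface_measure d) 2%:E (boundary Omega).
Definition Loo Omega := Lp_on (lebesgue_rV d) +oo%E Omega.
Definition Loo_norm Omega := Lp_norm (lebesgue_rV d) +oo%E Omega.

Definition sup_norm Omega u : R := sup [set `|u x| | x in closure Omega].

Definition inner Omega u v : R :=
  \int[lebesgue_rV d]_(x in Omega) (u x * v x).
Definition inner_bd Omega u v : R :=
  \int[surface_measure d]_(x in boundary Omega) (u x * v x).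

Definition partial (i : 'I_d) u : E -> R := fun x => 'D_(delta_mx 0 i) u x.

(* C^infinity: differentiability of all the iterated partial derivatives makes
   each of them continuous. *)
Definition smooth u :=
  forall (s : seq 'I_d) (x : E), differentiable (foldr partial u s) x.

Definition test_function Omega phi := smooth phi /\
  exists K, [/\ compact K, K `<=` Omega & forall x, ~ K x -> phi x = 0].

Definition is_weak_partial Omega i u g := L2 Omega g /\
  forall phi, test_function Omega phi ->
    inner Omega u (partial i phi) = - inner Omega g phi.

Definition H1 Omega u :=
  L2 Omega u /\ forall i, exists g, is_weak_partial Omega i u g.

(* A representative of the a.e. class of the weak derivative. *)
Definition weak_partial Omega i u : E -> R :=
  xget (fun=> 0) [set g | is_weak_partial Omega i u g].

Definition H1_norm Omega u : R := Num.sqrt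
  (L2_norm Omega u ^+ 2 + \sum_i L2_norm Omega (weak_partial Omega i u) ^+ 2).

(* T0 : H^1(Omega) -> L^2(boundary) bounded and linear, and equal to the
   restriction on H^1(Omega) `&` C(closure Omega). Functions stand for their
   a.e. classes: linearity and boundedness make T0 compatible with a.e.
   equality. *)
Definition trace_operator Omega (T0 : (E -> R) -> E -> R) := [/\
  forall u, H1 Omega u -> L2_bd Omega (T0 u),
  forall (k : R) u v, H1 Omega u -> H1 Omega v ->
    {ae surface_measure d, forall x, boundary Omega x ->
      T0 (fun y => k * u y + v y) x = k * T0 u x + T0 v x},
  exists K : R, forall u, H1 Omega u ->
    L2_bd_norm Omega (T0 u) <= K * H1_norm Omega u &
  forall u, H1 Omega u -> {within closure Omega, continuous u} ->
    {ae surface_measure d, forall x, boundary Omega x -> T0 u x = u x}].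

End function_spaces.

Section losses.
Context {R : realType} {d : nat}.
Local Notation E := 'rV[R]_d.

Record equation := Equation {
  coef_a : 'I_d -> 'I_d -> E -> R;
  coef_b : 'I_d -> E -> R;
  coef_c : E -> R;
  rhs_f : E -> R;
  rhs_g : E -> R }.

Variables (Omega : set E) (q : equation).
Local Notation a := (coef_a q).
Local Notation b := (coef_b q).
Local Notation c := (coef_c q).
Local Notation f := (rhs_f q).
Local Notation g := (rhs_g q).

(* (A1), (A2) and (A3) are the standing assumptions on the data; the conditions
   on the L^oo coefficient c hold a.e. *)
Definition A1 := [/\ L2 Omega f, L2_bd Omega g,
  forall i j, {within closure Omega, continuous (a i j)},
  forall i, Loo Omega (b i) &
  Loo Omega c /\ {ae lebesgue_rV d, forall x, Omega x -> 0 < c x}].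

Definition A2 (lambda Lambda : R) := [/\ 0 < lambda, 0 < Lambda &
  forall (x xi : E), Omega x ->
    lambda * enorm xi ^+ 2 <= \sum_i \sum_j a i j x * xi 0 i * xi 0 j
      <= Lambda * enorm xi ^+ 2].

Definition A3 (lambda : R) := {ae lebesgue_rV d, forall x, Omega x ->
  d%:R * \big[Num.max/0]_i Loo_norm Omega (b i) ^+ 2 < 4 * lambda * c x}.

Definition loss (T0 : (E -> R) -> E -> R) (alpha beta : R) (u v : E -> R) : R :=
  \sum_i \sum_j
    inner Omega (fun x => a i j x * weak_partial Omega i u x)
                (weak_partial Omega j v)
  + \sum_i inner Omega (fun x => b i x * weak_partial Omega i u x) v
  + inner Omega (fun x => c x * u x) v
  + alpha / beta * inner_bd Omega (T0 u) (T0 v)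
  - inner Omega f v
  - beta^-1 * inner_bd Omega g (T0 v).

Definition volume : R := fine (lebesgue_rV d Omega).
Definition area : R := fine (surface_measure d (boundary Omega)).

(* For u, v of class C^1: the partial derivatives are the classical ones, and
   the traces at Y k are the values u (Y k) and v (Y k). *)
Definition empirical_loss (alpha beta : R) (N M : nat) (X : 'I_N -> E)
    (Y : 'I_M -> E) (u v : E -> R) : R :=
  volume / N%:R * (\sum_k
    (\sum_i \sum_j a i j (X k) * partial i u (X k) * partial j v (X k)
     + \sum_i b i (X k) * partial i u (X k) * v (X k)
     + c (X k) * u (X k) * v (X k)
     - f (X k) * v (X k)))
  + area / (beta * M%:R) * (\sum_k
    (alpha * (u (Y k) * v (Y k)) - g (Y k) * v (Y k))).

(* The suprema are taken in the extended reals. *)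
Definition sta_error (T0 : (E -> R) -> E -> R) (P : set (E -> R))
    (alpha beta : R) (N M : nat) (X : 'I_N -> E) (Y : 'I_M -> E) : \bar R :=
  (2%:E * ereal_sup [set
     `| ereal_sup [set (loss T0 alpha beta u v)%:E | v in P]
        - ereal_sup [set (empirical_loss alpha beta X Y u v)%:E | v in P] |
   | u in P])%E.

End losses.
Arguments equation : clear implicits.

Section networks.
Context {R : realType} (d : nat) (n : nat -> nat).

Definition width (l : nat) : nat := if l is 0 then d else n l.

(* With A_(l+1), b_(l+1) the affine map from layer l to layer l+1, the slot
   (l, (i, Some j)) is the (i, j) entry of A_(l+1) and (l, (i, None)) is the
   i-th entry of b_(l+1). *)
Definition weight_slot : Type :=
  {l : nat & ('I_(width l.+1) * option 'I_(width l))%type}.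

Context (m : nat) (pos : 'I_m -> weight_slot) (theta : 'rV[R]_m).

(* For injective pos, theta 0 k is put in the slot pos k, and the slots outside
   the image of pos hold 0. *)
Definition weight (s : weight_slot) : R := \sum_(k < m | pos k == s) theta 0 k.

Definition weight_mx l : 'M[R]_(width l.+1, width l) :=
  \matrix_(i, j) weight (existT _ l (i, Some j)).

Definition bias l : 'cV[R]_(width l.+1) := \col_i weight (existT _ l (i, None)).

Fixpoint layer (rho : R -> R) (x : 'rV[R]_d) (l : nat) : 'cV[R]_(width l) :=
  match l with
  | 0 => x^T
  | k.+1 => map_mx rho (weight_mx k *m layer rho x k + bias k)
  end.

(* Meant for n D = 1, where the sum over the output components has one term. *)
Definition network (rho : R -> R) (D : nat) (x : 'rV[R]_d) : R :=
  \sum_i (weight_mx D.-1 *m layer rho x D.-1 + bias D.-1) i 0.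

End networks.

Definition network_class (R : realType) (d : nat) (n : nat -> nat) (m : nat)
    (pos : 'I_m -> weight_slot d n) (rho : R -> R) (D : nat) (B : R) :
    set ('rV[R]_d -> R) :=
  [set network pos theta rho D | theta in
    [set theta : 'rV[R]_m | forall k, `|theta 0 k| <= B]].

Section sampling.
Context dT (T : measurableType dT) (R : realType) (P : probability T R) (d : nat).

(* For a finite family, the product rule for all the A k (some of them possibly
   setT) contains the product rule for every subfamily. *)
Definition mutually_independent (N : nat) (X : 'I_N -> {RV P >-> 'rV[R]_d}) :=
  forall A : 'I_N -> set 'rV[R]_d, (forall k, measurable (A k)) ->
    P (\bigcap_k (X k @^-1` A k)) = (\prod_k P (X k @^-1` A k))%E.

(* If mu D is 0 or +oo, the right-hand side is 0 by the conventions for fine and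
   division, so that no X satisfies this. *)
Definition uniform_on (mu : {measure set 'rV[R]_d -> \bar R})
    (D : set 'rV[R]_d) (X : {RV P >-> 'rV[R]_d}) :=
  forall A, measurable A ->
    P (X @^-1` A) = (fine (mu (A `&` D)) / fine (mu D))%:E.

Definition iid_uniform (mu : {measure set 'rV[R]_d -> \bar R})
    (D : set 'rV[R]_d) (N : nat) (X : 'I_N -> {RV P >-> 'rV[R]_d}) :=
  mutually_independent X /\ forall k, uniform_on mu D (X k).

End sampling.

(* Main.v *)
Require Import Defs.
From mathcomp Require Import all_boot all_order all_algebra.
From mathcomp Require Import all_classical all_reals all_analysis.
From mathcomp Require Import measurable_realfun ess_sup_inf ring lra.
Set Implicit Arguments.
Unset Strict Implicit.
Unset Printing Implicit Defensive.
Import Order.TTheory GRing.Theory Num.Theory.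
Import numFieldNormedType.Exports.
Local Open Scope classical_set_scope.
Local Open Scope ring_scope.

(* The statistical error is at most twice the supremum over pairs (u, v) of
   networks of |L(u, v) - L^(u, v)|, and this difference is, up to the factors
   |Omega| and |boundary| / beta, the deviation of an empirical mean from its
   expectation, for an integrand h dominated by K^(2D) F, where K = m B and the
   envelope F (the sum of the absolute values of the data) is only square
   integrable.
   The integrand is Lipschitz in the weights, with a constant polynomial in K^D,
   so a grid of q^(2m) weights with log q = O(D K sqrt N) is a fine enough net.
   On the net, h is truncated at height sqrt(N / log(net)): the discarded part
   costs E[F^2] / height, and e^x <= 1 + x + 2 x^2 bounds the Laplace transform
   of the truncated part by its second moment, so the maximum over the net is
   O(K^(2D) sqrt(log(net) / N)), without symmetrization.  The powers of N, m, B
   in the theorem leave room for log q = O(D K sqrt N).  For D = 1 this bound has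
   one power of m too many, but then there are at most d + 1 weights.
   The population loss uses weak derivatives and traces. For a network these
   agree a.e. with the classical ones: integration by parts shows that the
   classical derivative is a weak one, and weak derivatives are unique because
   products of the flat functions exp(-1 / (k t)) increase to the indicators of
   boxes, which generate the Borel sets. *)

(** * Empirical processes with a square-integrable envelope *)

Import HBNNSimple.

(** The error is built from suprema over an arbitrary set of networks, so it need not be a
    measurable function of the sample. Every probabilistic bound therefore produces one measurable
    majorant [H], valid simultaneously for all indices, whose expectation is bounded; the error
    enters only through a monotonicity of the integral that asks no measurability of the smaller
    function. The samples lie in the domain and on its boundary only almost surely, and the data are
    controlled only there, so the majorant is made infinite on the null event that some sample falls
    outside. The bounds on [b] and [c] hold almost everywhere, and [f] and [g] may be unbounded;
    hence the envelope is kept as a pointwise function, and only its second moment is compared with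
    the norms of the data. The volume part of the loss carries no factor 1 / beta: the bound beta <=
    [beta0] supplies it, which is how [beta0] enters the constant. *)

Lemma ge0_le_integralT d (T : measurableType d) (R : realType)
    (mu : {measure set T -> \bar R}) (f g : T -> \bar R) :
  (forall x, 0 <= f x)%E -> (forall x, f x <= g x)%E ->
  (\int[mu]_x f x <= \int[mu]_x g x)%E.
Proof.
move=> f0 fg; have g0 x : (0 <= g x)%E := le_trans (f0 x) (fg x).
rewrite !ge0_integralTE//; apply: ereal_sup_le => _ [h /= hf <-].
by exists h => //= x; exact: le_trans (hf x) (fg x).
Qed.

(** Nothing is asked of [f]: its integral is at most that of its positive part, and the integral of
    a nonnegative function, a supremum over the simple functions below it, is monotone without
    measurability. This covers the statistical error, which moreover equals -oo when the set of
    networks is empty. *)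
Lemma le_integral_ge0_bound d (T : measurableType d) (R : realType)
    (mu : {measure set T -> \bar R}) (f g : T -> \bar R) :
  (forall x, 0 <= g x)%E -> (forall x, f x <= g x)%E ->
  (\int[mu]_x f x <= \int[mu]_x g x)%E.
Proof.
move=> g0 fg; rewrite integralE.
apply: (@le_trans _ _ (\int[mu]_x (f^\+ x))%E).
  by rewrite geeDl// oppe_le0 integral_ge0.
by apply: ge0_le_integralT => // x; rewrite funeposE ge_max fg g0.
Qed.

(** * Expectations of products of independent factors *)

Section independent_products.
Context dT (T : measurableType dT) (R : realType) (P : probability T R) (d : nat).
Variables (N : nat) (X : 'I_N -> {RV P >-> 'rV[R]_d}).
Hypothesis indX : mutually_independent X.

(** A simple function is a combination of indicators of its level sets. The product expands over the
    maps [f] choosing a level for each sample; each term is the indicator of an intersection, whose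
    probability factors by independence. The same distributivity read backwards gives the product of
    the expectations. *)
Lemma expectation_prod_nnsfun (phi : {nnsfun 'rV[R]_d >-> R}) (a : R) :
  (forall k, \int[P]_w (phi (X k w))%:E <= a%:E)%E ->
  (\int[P]_w (\prod_k phi (X k w))%:E <= (a ^+ N)%:E)%E.
Proof.
move=> phia.
pose s := finmap.enum_fset (fset_set (range phi)).
have us : uniq s by exact: finmap.fset_uniq.
have phis y : phi y \in s.
  by rewrite /s (in_fset_set (fimfunP phi)) inE; exists y.
pose n := size s.
pose A (j : 'I_n) := phi @^-1` [set s`_j].
have mA j : measurable (A j).
  by rewrite /A -[X in measurable X]setTI; exact: measurable_funP.
have phiE y : phi y = \sum_(j < n) s`_j * (\1_(A j) y).
  have jlt : (index (phi y) s < n)%N by rewrite index_mem.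
  rewrite (bigD1 (Ordinal jlt))//= big1 ?addr0.
    rewrite nth_index// indicE mem_set ?mulr1// /A /=.
    by rewrite nth_index.
  move=> j jn; rewrite indicE memNset ?mulr0// /A /= => phij.
  case/eqP: jn; apply/val_inj => /=.
  by rewrite phij index_uniq.
have s0 (j : 'I_n) : 0 <= s`_j.
  have : s`_j \in s by rewrite mem_nth.
  by rewrite /s (in_fset_set (fimfunP phi)) inE => -[y _ <-].
pose p k j := fine (P (X k @^-1` A j)).
have mXA k j : measurable (X k @^-1` A j).
  by rewrite -[X in measurable X]setTI; exact: measurable_funP.
have pE k j : P (X k @^-1` A j) = (p k j)%:E.
  by rewrite /p fineK// fin_num_measure.
have p0 k j : 0 <= p k j by rewrite fine_ge0.
have Ephi k : (\int[P]_w (phi (X k w))%:E = (\sum_(j < n) s`_j * p k j)%:E)%E.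
  under eq_integral => w _ do rewrite phiE -sumEFin.
  rewrite ge0_integral_sum//; last 2 first.
  - move=> j; apply/measurable_EFinP; apply: measurable_funM => //.
    have -> : (fun x => \1_(A j) (X k x)) = \1_(X k @^-1` A j) :> (T -> R).
      by apply/funext => w; rewrite !indicE.
    exact: measurable_indic.
  - by move=> j w _; rewrite lee_fin mulr_ge0// indicE.
  rewrite -sumEFin; apply: eq_bigr => j _.
  under eq_integral => w _ do rewrite EFinM.
  rewrite ge0_integralZl//; last 2 first.
  - apply/measurable_EFinP.
    have -> : (fun x => \1_(A j) (X k x)) = \1_(X k @^-1` A j) :> (T -> R).
      by apply/funext => w; rewrite !indicE.
    exact: measurable_indic.
  - by rewrite lee_fin.
  rewrite (_ : (fun w => _) = (fun w => (\1_(X k @^-1` A j) w)%:E)); last first.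
    by apply/funext => w; rewrite !indicE.
  by rewrite integral_indic// setIT EFinM; congr (_ * _)%E; exact: pE.
pose B (f : {ffun 'I_N -> 'I_n}) : set T := \bigcap_k (X k @^-1` A (f k)).
have mB f : measurable (B f).
  by apply: fin_bigcap_measurable => //; exact: finite_finset.
have prodE w : \prod_k phi (X k w)
    = \sum_(f : {ffun 'I_N -> 'I_n}) (\prod_k s`_(f k)) * \1_(B f) w.
  under eq_bigr => k _ do rewrite phiE.
  rewrite bigA_distr_bigA /=; apply: eq_bigr => f _.
  rewrite big_split /=; congr (_ * _).
  rewrite indicE; case: (asboolP (B f w)) => Bw.
    rewrite mem_set// big1// => k _; rewrite indicE mem_set//.
    exact: Bw.
  rewrite memNset//.
  have /existsNP[k /not_implyP[_ kw]] := Bw.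
  by rewrite (bigD1 k)//= indicE memNset// mul0r.
under eq_integral => w _ do rewrite prodE -sumEFin.
rewrite ge0_integral_sum//; last 2 first.
- by move=> f; apply/measurable_EFinP; apply: measurable_funM.
- move=> f w _; rewrite lee_fin mulr_ge0// ?indicE//; exact: prodr_ge0.
have -> : (\sum_(f : {ffun 'I_N -> 'I_n}) \int[P]_x (\prod_k s`_(f k) * \1_(B f) x)%:E)%E
   = (\sum_(f : {ffun 'I_N -> 'I_n}) \prod_k (s`_(f k) * p k (f k)))%:E.
  rewrite -sumEFin; apply: eq_bigr => f _.
  under eq_integral => w _ do rewrite EFinM.
  rewrite ge0_integralZl//; last 2 first.
  - exact/measurable_EFinP.
  - by rewrite lee_fin; exact: prodr_ge0.
  rewrite integral_indic// setIT.
  have PB : P (B f) = (\prod_k P (X k @^-1` A (f k)))%E.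
    exact: (indX (A := fun k => A (f k)) (fun k => mA (f k))).
  rewrite [X in (_ * X)%E]PB.
  rewrite (eq_bigr (fun k => (p k (f k))%:E)); last by move=> k _; exact: pE.
  by rewrite prodEFin -EFinM big_split.
rewrite -(bigA_distr_bigA (fun (k : 'I_N) (j : 'I_n) => s`_j * p k j)) lee_fin.
rewrite -[N in a ^+ N]card_ord -prodr_const; apply: ler_prod => k _.
by rewrite sumr_ge0/= => [|j _]; rewrite ?mulr_ge0// -lee_fin -Ephi phia.
Qed.

(** Simple functions increasing to [phi] inherit the bound [a], and their products over the samples
    increase to the product of the limits, so monotone convergence concludes. *)
Lemma expectation_prod_le (phi : 'rV[R]_d -> R) (a : R) :
  measurable_fun setT phi -> (forall y, 0 <= phi y) ->
  (forall k, \int[P]_w (phi (X k w))%:E <= a%:E)%E ->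
  (\int[P]_w (\prod_k phi (X k w))%:E <= (a ^+ N)%:E)%E.
Proof.
move=> mphi phi0 phia.
have mE : measurable_fun setT (EFin \o phi) by exact/measurable_EFinP.
pose g := nnsfun_approx measurableT mE.
have gc y : (EFin \o g ^~ y) @ \oo --> (phi y)%:E.
  by apply: (@cvg_nnsfun_approx _ _ _ _ measurableT _ mE) => // x _ /=; rewrite lee_fin.
have nd y : nondecreasing_seq (g ^~ y).
  by move=> n p np; exact/lefP/nd_nnsfun_approx.
have gcR y : g ^~ y @ \oo --> phi y by have /fine_cvgP[_] := gc y.
have gphi n y : g n y <= phi y.
  by rewrite -(cvg_lim _ (gcR y))//; apply: nondecreasing_cvgn_le => //; apply: cvgP (gcR y).
have pc w : (\prod_k g n (X k w)) @[n --> \oo] --> \prod_k phi (X k w).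
  by apply: (@cvg_big R 'I_N *%R 1 xpredT mul_continuous) => k _; exact: gcR.
have -> : (\int[P]_w (\prod_k phi (X k w))%:E =
    limn (fun n => \int[P]_w (\prod_k g n (X k w))%:E))%E.
  rewrite -monotone_convergence//.
  - by apply: eq_integral => w _; apply/esym/cvg_lim => //; apply: cvg_EFin; [exact: nearW|exact: pc].
  - move=> n; apply/measurable_EFinP; apply: measurable_prod => k _.
    by apply: measurableT_comp.
  - by move=> n w _; rewrite lee_fin prodr_ge0.
  - move=> w _ n p np; rewrite lee_fin ler_prod// => k _.
    by rewrite fun_ge0/= nd.
apply: lime_le.
  apply: ereal_nondecreasing_is_cvgn => n p np; apply: ge0_le_integralT.
    by move=> w; rewrite lee_fin prodr_ge0.
  by move=> w; rewrite lee_fin ler_prod// => k _; rewrite fun_ge0/= nd.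
apply: nearW => n; apply: expectation_prod_nnsfun => k.
apply: le_trans (phia k); apply: ge0_le_integralT => w; rewrite lee_fin//.
Qed.
End independent_products.

Lemma expectation_cst dT (T : measurableType dT) (R : realType)
    (P : probability T R) (r : \bar R) : (\int[P]_w r = r)%E.
Proof. by rewrite integral_cst//= [X in (_ * X)%E]probability_setT mule1. Qed.

Lemma expectation_affine_le dT (T : measurableType dT) (R : realType)
    (P : probability T R) (f : T -> R) (a b e : R) :
  0 <= a -> 0 <= b -> measurable_fun setT f ->
  (forall w, 0 <= f w) -> (\int[P]_w (f w)%:E <= e%:E)%E ->
  (\int[P]_w (a * (b + f w))%:E <= (a * (b + e))%:E)%E.
Proof.
move=> a0 b0 mf f0 fe; under eq_integral do rewrite EFinM.
rewrite ge0_integralZl//=; last 2 first.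
- by apply/measurable_EFinP; apply: measurable_funD.
- by move=> w _; rewrite lee_fin addr_ge0.
rewrite EFinM lee_wpmul2l//; under eq_integral do rewrite EFinD.
rewrite ge0_integralD//=; last 2 first.
- by move=> w _; rewrite lee_fin.
- exact/measurable_EFinP.
by rewrite expectation_cst EFinD leeD2l.
Qed.

(** From exp(-x) >= 1 - x comes exp(x) <= 1 / (1 - x), and (1 + x + 2 x^2)(1 - x) = 1 + x^2 (1 - 2
    x) is at least 1 when x <= 1/2. *)
Lemma expR_le_quadratic (R : realType) (x : R) : x <= 2^-1 ->
  expR x <= 1 + x + 2 * x ^+ 2.
Proof.
move=> x2; have x1 : 0 < 1 - x by lra.
have h : expR x <= (1 - x)^-1.
  rewrite -[x in expR x]opprK expRN lef_pV2 ?posrE ?expR_gt0//.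
  exact: expR_ge1Dx.
apply: (le_trans h); rewrite -div1r ler_pdivrMr//.
have := sqr_ge0 x; nra.
Qed.

(** Summed over a finite family, the exponentials bound all members at once, and the expectation of
    that bound is computed by linearity, without integrating tail probabilities. *)
Lemma ler_norm_expR_sum (R : realType) (x c : R) :
  `|x| <= c + (expR (x - c) + expR (- x - c)).
Proof.
have h1 := expR_ge1Dx (x - c); have h2 := expR_ge1Dx (- x - c).
have p1 := expR_ge0 (x - c); have p2 := expR_ge0 (- x - c).
by rewrite ler_norml; apply/andP; split; lra.
Qed.

(** * Laplace transforms of centred sums *)

Section empirical.
Context dT (T : measurableType dT) (R : realType) (P : probability T R) (d : nat).
Variables (N : nat) (X : 'I_N -> {RV P >-> 'rV[R]_d}).
Variable nu : probability 'rV[R]_d R.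
Hypothesis indX : mutually_independent X.
Hypothesis lawX : forall k A, measurable A -> P (X k @^-1` A) = nu A.

Lemma ge0_integral_law (k : 'I_N) (f : 'rV[R]_d -> \bar R) :
  measurable_fun setT f -> (forall y, 0 <= f y)%E ->
  (\int[P]_w f (X k w) = \int[nu]_y f y)%E.
Proof.
move=> mf f0; rewrite -(ge0_integral_distribution (X k))//.
by apply: eq_measure_integral => A mA _; exact: lawX.
Qed.

(** With e the mean of [h], the quadratic bound gives E exp(h) <= 1 + e + 2 V <= exp(e + 2 V).
    Independence raises this to the power N, and the centring removes e. *)
Lemma laplace_transform_bound (h : 'rV[R]_d -> R) (V : R) :
  measurable_fun setT h -> (forall y, `|h y| <= 2^-1) ->
  (\int[nu]_y (h y ^+ 2)%:E <= V%:E)%E ->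
  (\int[P]_w (expR (\sum_k h (X k w) - N%:R * \int[nu]_y h y))%:E
    <= (expR (2 * N%:R * V))%:E)%E.
Proof.
move=> mh hb hV.
set e := \int[nu]_y h y.
have ih : nu.-integrable setT (EFin \o h).
  apply: (@le_integrable _ _ _ nu _ measurableT _ (EFin \o cst 1)).
  - exact/measurable_EFinP.
  - move=> y _ /=; rewrite lee_fin normr1 (le_trans (hb y))//; lra.
  - exact: finite_measure_integrable_cst.
have ih2 : nu.-integrable setT (EFin \o (fun y => h y ^+ 2)).
  apply: (@le_integrable _ _ _ nu _ measurableT _ (EFin \o cst 1)).
  - by apply/measurable_EFinP; exact: measurable_funX.
  - move=> y _ /=; rewrite lee_fin normr1 normrX.
    have := hb y; have := normr_ge0 (h y); nra.
  - exact: finite_measure_integrable_cst.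
have eE : (\int[nu]_y (h y)%:E = e%:E)%E.
  by rewrite /e /Rintegral fineK// integrable_fin_num.
have mexp : measurable_fun setT (fun y => expR (h y)) by exact: measurableT_comp.
have phia k : (\int[P]_w (expR (h (X k w)))%:E <= (1 + e + 2 * V)%:E)%E.
  have mexpE : measurable_fun setT (fun y => (expR (h y))%:E) by exact/measurable_EFinP.
  have exp0 y : (0 <= (expR (h y))%:E)%E by rewrite lee_fin expR_ge0.
  rewrite (ge0_integral_law k mexpE exp0).
  apply: (@le_trans _ _ (\int[nu]_y ((1 + h y)%:E + (2 * h y ^+ 2)%:E))%E).
    apply: ge0_le_integralT => y; rewrite ?lee_fin ?expR_ge0//.
    apply: expR_le_quadratic; apply: le_trans (hb y); exact: ler_norm.
  have i1 : nu.-integrable setT (fun y => (1 + h y)%:E).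
    apply: (@integrableD _ _ _ nu setT measurableT (EFin \o cst 1) (EFin \o h)) => //.
    exact: finite_measure_integrable_cst.
  have i2 : nu.-integrable setT (fun y => (2 * h y ^+ 2)%:E).
    exact: (@integrableZl _ _ _ nu setT measurableT 2 _ ih2).
  rewrite integralD//= EFinD; apply: leeD.
    under eq_integral do rewrite EFinD.
    rewrite integralD//=; last exact: finite_measure_integrable_cst.
    by rewrite eE expectation_cst.
  under eq_integral do rewrite EFinM.
  rewrite integralZl//= EFinM lee_pmul2l//.
have := expectation_prod_le indX mexp (fun y => expR_ge0 (h y)) phia.
move=> H.
have -> : (\int[P]_w (expR (\sum_k h (X k w) - N%:R * e))%:E =
   (expR (- (N%:R * e)))%:E * \int[P]_w (\prod_k expR (h (X k w)))%:E)%E.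
  have mp : measurable_fun setT (fun w => (\prod_k expR (h (X k w)))%:E).
    apply/measurable_EFinP; apply: measurable_prod => k _.
    exact: (measurableT_comp mexp).
  have p0 w : (0 <= (\prod_k expR (h (X k w)))%:E)%E.
    by rewrite lee_fin prodr_ge0// => k _; exact: expR_ge0.
  rewrite -(ge0_integralZl _ measurableT mp (fun w _ => p0 w)) ?lee_fin ?expR_ge0//.
  apply: eq_integral => w _; rewrite -EFinM expRD mulrC; congr (_ * _)%:E.
  by rewrite expR_sum.
apply: (@le_trans _ _ ((expR (- (N%:R * e)))%:E * ((1 + e + 2 * V) ^+ N)%:E)%E).
  by rewrite lee_pmul2l// lte_fin expR_gt0.
rewrite -EFinM lee_fin.
have V0 : 0 <= V.
  by rewrite -lee_fin; apply: le_trans hV; apply: integral_ge0 => y _; rewrite lee_fin sqr_ge0.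
(* Ensures 0 <= 1 + e + 2 V, so that the N-th power is monotone. *)
have e1 : -1 <= e.
  rewrite -lee_fin -eE.
  have -> : ((- 1)%:E = \int[nu]_y (cst (- 1)%:E y))%E.
    by rewrite expectation_cst.
  apply: le_integral => //; first exact: finite_measure_integrable_cst.
  move=> y _; rewrite lee_fin; have := hb y; rewrite ler_norml => /andP[]; lra.
apply: (@le_trans _ _ (expR (- (N%:R * e)) * expR (e + 2 * V) ^+ N)).
  rewrite ler_pM2l ?expR_gt0// lerXn2r// ?nnegrE ?expR_ge0//.
    by rewrite -addrA; lra.
  by rewrite -addrA expR_ge1Dx.
by rewrite -expRM_natl -expRD ler_expR; rewrite mulrDr; lra.
Qed.

End empirical.

Section empirical_process.
Context dT (T : measurableType dT) (R : realType) (P : probability T R) (d : nat).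
Variables (N : nat) (X : 'I_N -> {RV P >-> 'rV[R]_d}).
Variable nu : probability 'rV[R]_d R.
Hypothesis indX : mutually_independent X.
Hypothesis lawX : forall k A, measurable A -> P (X k @^-1` A) = nu A.
Hypothesis N0 : (0 < N)%N.
Variables (F : 'rV[R]_d -> R) (S2 : R).
Hypothesis mF : measurable_fun setT F.
Hypothesis F0 : forall y, 0 <= F y.
Hypothesis F2 : (\int[nu]_y (F y ^+ 2)%:E <= S2%:E)%E.

Let mF2 : measurable_fun setT (fun y => (F y ^+ 2)%:E).
Proof. by apply/measurable_EFinP; exact: measurable_funX. Qed.

Let F2_ge0 y : (0 <= (F y ^+ 2)%:E)%E. Proof. by rewrite lee_fin sqr_ge0. Qed.

Lemma envelope_sqr_bound_ge0 : 0 <= S2.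
Proof. by rewrite -lee_fin; apply: le_trans F2; exact: integral_ge0. Qed.

Let iF2 : nu.-integrable setT (EFin \o (fun y => F y ^+ 2)).
Proof.
apply/integrableP; split => //.
under eq_integral do rewrite /= ger0_norm ?sqr_ge0//.
exact: le_lt_trans F2 (ltry _).
Qed.

Let integrable_le_envelope (h : 'rV[R]_d -> R) (k : R) :
  measurable_fun setT h -> (forall y, `|h y| <= k * (1 + F y ^+ 2)) ->
  nu.-integrable setT (EFin \o h).
Proof.
move=> mh hk.
apply: (@le_integrable _ _ _ nu _ measurableT _ (fun y => (k * (1 + F y ^+ 2))%:E)).
- exact/measurable_EFinP.
- by move=> y _ /=; rewrite lee_fin (le_trans (hk y))// ler_norm.
apply: (@integrableZl _ _ _ nu setT measurableT k (fun y => (1 + F y ^+ 2)%:E)).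
apply: (@integrableD _ _ _ nu setT measurableT (EFin \o cst 1) (EFin \o (fun y => F y ^+ 2))) => //.
exact: finite_measure_integrable_cst.
Qed.

Let integrable_envelope_bound (h : 'rV[R]_d -> R) (k : R) :
  0 <= k -> measurable_fun setT h -> (forall y, `|h y| <= k * F y) ->
  nu.-integrable setT (EFin \o h).
Proof.
move=> k0 mh hk; apply: (integrable_le_envelope (k := k)) => // y.
apply: (le_trans (hk y)); rewrite ler_wpM2l//.
by have := F0 y; have := sqr_ge0 (F y - 1); nra.
Qed.

Let Rint_envelope (h : 'rV[R]_d -> R) (k : R) :
  0 <= k -> measurable_fun setT h -> (forall y, `|h y| <= k * F y ^+ 2) ->
  `|\int[nu]_y h y| <= k * S2.
Proof.
move=> k0 mh hk.
have ih : nu.-integrable setT (EFin \o h).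
  apply: (integrable_le_envelope (k := k)) => // y.
  by rewrite (le_trans (hk y))// ler_wpM2l// lerDr.
apply: (le_trans (le_normr_Rintegral measurableT ih)).
rewrite -lee_fin /Rintegral fineK; last first.
  by apply: integrable_fin_num => //; exact: (integrable_norm ih).
apply: (@le_trans _ _ (\int[nu]_y (k * F y ^+ 2)%:E)%E).
  by apply: ge0_le_integralT => y; rewrite lee_fin.
under eq_integral do rewrite EFinM.
by rewrite ge0_integralZl//= EFinM lee_wpmul2l.
Qed.

(* Functions are truncated where the envelope exceeds 1 / (2 r), so that the
   Laplace transforms of the truncations are controlled by second moments alone;
   the truncated part is at most 2 r kappa F^2. *)
Lemma empirical_finite_class (I : finType) (h : I -> 'rV[R]_d -> R) (kappa Lg r : R) :
  0 < kappa -> 0 < r -> 1 <= Lg -> N%:R * r ^+ 2 = Lg ->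
  (2 * #|I|)%:R <= expR Lg ->
  (forall i, measurable_fun setT (h i)) ->
  (forall i y, `|h i y| <= kappa * F y) ->
  exists H : T -> R, [/\ measurable_fun setT H, forall w, 0 <= H w,
    forall w i, `|N%:R^-1 * \sum_k h i (X k w) - \int[nu]_y h i y| <= H w &
    (\int[P]_w (H w)%:E <= (kappa * r * (2 + 6 * S2))%:E)%E].
Proof.
move=> k0 r0 L1 NrL cI mh hF.
have S20 := envelope_sqr_bound_ge0.
have NR0 : 0 < N%:R :> R by rewrite ltr0n.
pose S := [set y | F y <= (2 * r)^-1].
have mS : measurable S.
  by rewrite -[S]setTI; apply: measurable_fun_le => //.
(* On [S] the factor r / kappa turns the bound kappa F into r F <= 1/2, the range of the quadratic
   bound on the exponential. *)
pose g i y : R := r / kappa * (h i y * \1_S y).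
have mg i : measurable_fun setT (g i).
  apply: measurable_funM => //; apply: measurable_funM => //.
have rk : 0 < r / kappa by rewrite divr_gt0.
have gF i y : `|g i y| <= r * (F y * \1_S y).
  rewrite /g normrM (gtr0_norm rk) normrM indicE (ger0_norm (ler0n _ _)).
  have := hF i y; have := F0 y; case: (y \in S); rewrite ?mulr0 ?mulr1 => //.
  move=> _ hy; rewrite -mulrA ler_pM2l// mulrC ler_pdivrMr// mulrC//.
have gb i y : `|g i y| <= 2^-1.
  apply: (le_trans (gF i y)); rewrite indicE.
  case: (boolP (y \in S)); rewrite /= ?mulr1 ?mulr0 ?mulr0 ?invr_ge0//.
  rewrite inE /S /= => yS; rewrite -ler_pdivlMl//.
  by rewrite -invfM mulrC (le_trans yS)// invfM mulrC.
have g2 i : (\int[nu]_y (g i y ^+ 2)%:E <= (r ^+ 2 * S2)%:E)%E.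
  apply: (@le_trans _ _ (\int[nu]_y (r ^+ 2 * F y ^+ 2)%:E)%E).
    apply: ge0_le_integralT => y; rewrite lee_fin ?sqr_ge0//.
    rewrite -exprMn -[leLHS]real_normK ?num_real// lerXn2r ?nnegrE//.
      by rewrite mulr_ge0// ltW.
    apply: (le_trans (gF i y)); rewrite ler_pM2l// indicE.
    by case: (_ \in _); rewrite ?mulr1 ?mulr0.
  under eq_integral do rewrite EFinM.
  by rewrite ge0_integralZl//= ?EFinM ?lee_wpmul2l ?lee_fin ?sqr_ge0.
pose Z i w := \sum_k g i (X k w) - N%:R * \int[nu]_y g i y.
have mZ i : measurable_fun setT (Z i).
  apply: measurable_funB => //; apply: measurable_sum => k.
  exact: (measurableT_comp (mg i)).
have c2 : 2 * N%:R * (r ^+ 2 * S2) = 2 * Lg * S2 by rewrite -NrL; ring.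
have Zp i : (\int[P]_w (expR (Z i w))%:E <= (expR (2 * Lg * S2))%:E)%E.
  rewrite -c2; exact: (laplace_transform_bound indX lawX (mg i) (gb i) (g2 i)).
have Zn i : (\int[P]_w (expR (- Z i w))%:E <= (expR (2 * Lg * S2))%:E)%E.
  have mgN : measurable_fun setT (fun y => - g i y) by exact: measurableT_comp.
  have gbN y : `|- g i y| <= 2^-1 by rewrite normrN.
  have g2N : (\int[nu]_y ((- g i y) ^+ 2)%:E <= (r ^+ 2 * S2)%:E)%E.
    by under eq_integral do rewrite sqrrN.
  have := laplace_transform_bound indX lawX mgN gbN g2N.
  rewrite c2; congr (_ <= _)%E; apply: eq_integral => w _.
  congr (expR _)%:E; rewrite /Z opprB addrC sumrN; congr (_ + _).
  have -> : \int[nu]_y (- g i y) = - \int[nu]_y g i y; last by rewrite mulrN opprK.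
  have igi : nu.-integrable setT (EFin \o g i).
    apply: (integrable_le_envelope (k := 2^-1)) => // y.
    by rewrite (le_trans (gb i y))// ler_peMr// lerDl sqr_ge0.
  rewrite -[RHS]mulN1r -RintegralZl//.
  by apply: eq_Rintegral => y _; rewrite mulN1r.
(* The summand 2 Lg S2 compensates the Laplace transform. The summand Lg leaves each exponential
   with expectation at most exp(-Lg), so that all 2 #|I| of them together have expectation at most
   1. *)
pose c := Lg + 2 * Lg * S2.
pose Q w := \sum_i (expR (Z i w - c) + expR (- Z i w - c)).
have mQ : measurable_fun setT Q.
  apply: measurable_sum => i; apply: measurable_funD; apply: measurableT_comp => //; apply: measurable_funB => //.
  exact: measurableT_comp.
have Q0 w : 0 <= Q w by apply: sumr_ge0 => i _; rewrite addr_ge0// expR_ge0.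
have EQ : (\int[P]_w (Q w)%:E <= 1%:E)%E.
  rewrite /Q; under eq_integral do rewrite -sumEFin.
  rewrite ge0_integral_sum//; last first.
    move=> i; apply/measurable_EFinP.
    apply: measurable_funD; apply: measurableT_comp => //; apply: measurable_funB => //.
    exact: measurableT_comp.
  apply: (@le_trans _ _ (\sum_(i : I) (2 * expR (- Lg))%:E)%E).
    apply: lee_sum => i _.
    have half f : measurable_fun setT f ->
        (\int[P]_w (expR (f w))%:E <= (expR (2 * Lg * S2))%:E)%E ->
        (\int[P]_w (expR (f w - c))%:E <= (expR (- Lg))%:E)%E.
      move=> mf fb; under eq_integral do rewrite expRD mulrC EFinM.
      rewrite ge0_integralZl//=; last first.
        by apply/measurable_EFinP; exact: measurableT_comp.
      apply: (@le_trans _ _ ((expR (- c))%:E * (expR (2 * Lg * S2))%:E)%E).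
        by rewrite lee_wpmul2l// lee_fin expR_ge0.
      rewrite -EFinM -expRD lee_fin ler_expR /c; lra.
    under eq_integral do rewrite EFinD.
    rewrite ge0_integralD//; last 2 first.
    - apply/measurable_EFinP; apply: measurableT_comp => //; apply: measurable_funB => //.
    - apply/measurable_EFinP; apply: measurableT_comp => //; apply: measurable_funB => //.
      exact: measurableT_comp.
    rewrite (_ : 2 * expR (- Lg) = expR (- Lg) + expR (- Lg)); last by ring.
    rewrite EFinD; apply: leeD; apply: half => //.
    exact: measurableT_comp.
  rewrite sumEFin sumr_const lee_fin.
  rewrite expRN (_ : _ *+ _ = (expR Lg)^-1 * (2 * #|I|)%:R); last first.
    by rewrite -mulr_natr natrM (eq_card (B := I))//; ring.
  by rewrite ler_pdivrMl ?expR_gt0// mulr1.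
have Zb i w : `|Z i w| <= c + Q w.
  apply: (le_trans (ler_norm_expR_sum (Z i w) c)); rewrite lerD2l.
  rewrite /Q (bigD1 i)//= lerDl; apply: sumr_ge0 => j _.
  by rewrite addr_ge0// expR_ge0.
have c0 : 0 <= c by rewrite addr_ge0// ?mulr_ge0//; lra.
pose SF w := \sum_k F (X k w) ^+ 2.
(* The first summand bounds the discarded parts, empirical and expected; the second is the bound c +
   Q on the truncated fluctuation, with the scaling kappa / r undone and the sum divided by N. *)
pose H w := 2 * r * kappa * (N%:R^-1 * SF w + S2) + kappa / (r * N%:R) * (c + Q w).
have SF0 w : 0 <= SF w by apply: sumr_ge0 => k _; exact: sqr_ge0.
have mSF : measurable_fun setT SF.
  apply: measurable_sum => k; apply: measurable_funX.
  exact: (measurableT_comp mF).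
have ESF : (\int[P]_w (SF w)%:E <= (N%:R * S2)%:E)%E.
  rewrite /SF; under eq_integral do rewrite -sumEFin.
  rewrite ge0_integral_sum//; last first.
    by move=> k; apply: (measurableT_comp mF2).
  apply: (@le_trans _ _ (\sum_(k < N) S2%:E)%E).
    apply: lee_sum => k _.
    by rewrite (ge0_integral_law lawX k mF2).
  by rewrite sumEFin sumr_const card_ord mulr_natl.
have trunc i y : `|h i y - kappa / r * g i y| <= 2 * r * kappa * F y ^+ 2.
  rewrite /g mulrA (_ : kappa / r * (r / kappa) = 1); last first.
    by field; rewrite !gt_eqF.
  rewrite mul1r indicE; case: (boolP (y \in S)) => yS; rewrite ?mulr1 ?mulr0 ?subrr ?subr0 ?normr0.
    by rewrite !mulr_ge0// ltW.
  (* Off [S] one has 1 < 2 r F, hence kappa F <= 2 r kappa F^2. *)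
  apply: (le_trans (hF i y)); move: yS; rewrite notin_setE /S /= => /negP; rewrite -ltNge.
  rewrite -[X in X < _]mulr1 ltr_pdivrMl ?mulr_gt0// => yS.
  rewrite (_ : 2 * r * kappa * F y ^+ 2 = kappa * F y * (2 * r * F y)); last by ring.
  by rewrite ler_peMr ?mulr_ge0// ltW.
exists H; split.
- apply: measurable_funD.
    by apply: measurable_funM => //; apply: measurable_funD => //; apply: measurable_funM.
  by apply: measurable_funM => //; apply: measurable_funD.
- move=> w; have [r0' k0' NR0'] := And3 (ltW r0) (ltW k0) (ltW NR0).
  have Q0w := Q0 w; have SF0w := SF0 w.
  have N1 : 0 <= N%:R^-1 :> R by rewrite invr_ge0.
  have krN : 0 <= kappa / (r * N%:R) by rewrite divr_ge0 ?mulr_ge0.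
  have rk2 : 0 <= 2 * r * kappa by rewrite !mulr_ge0.
  apply: addr_ge0; apply: mulr_ge0 => //; apply: addr_ge0 => //; exact: mulr_ge0.
- move=> w i.
  have kr : 0 < kappa / r by rewrite divr_gt0.
  have ihi : nu.-integrable setT (EFin \o h i).
    by apply: (integrable_envelope_bound (k := kappa)) => //; exact: ltW.
  have igi : nu.-integrable setT (EFin \o g i).
    apply: (integrable_le_envelope (k := 2^-1)) => // y.
    by rewrite (le_trans (gb i y))// ler_peMr// lerDl sqr_ge0.
  have kgi : nu.-integrable setT (EFin \o (fun y => kappa / r * g i y)).
    exact: (@integrableZl _ _ _ nu setT measurableT (kappa / r) _ igi).
  have B1 : `|\int[nu]_y (h i y - kappa / r * g i y)| <= 2 * r * kappa * S2.
    apply: Rint_envelope => //; first by rewrite !mulr_ge0// ltW.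
    by apply: measurable_funB => //; apply: measurable_funM.
  have B2 : `|\sum_k (h i (X k w) - kappa / r * g i (X k w))| <= 2 * r * kappa * SF w.
    rewrite mulr_sumr; apply: (le_trans (ler_norm_sum _ _ _)).
    by apply: ler_sum => k _; exact: trunc.
  rewrite RintegralB// RintegralZl// in B1.
  rewrite sumrB -mulr_sumr in B2.
  have -> : N%:R^-1 * \sum_k h i (X k w) - \int[nu]_y h i y =
    N%:R^-1 * (\sum_k h i (X k w) - kappa / r * \sum_k g i (X k w))
    - (\int[nu]_y h i y - kappa / r * \int[nu]_y g i y)
    + kappa / (r * N%:R) * Z i w.
    by rewrite /Z; field; rewrite !gt_eqF.
  apply: (le_trans (ler_normD _ _)); rewrite /H lerD//.
    apply: (le_trans (ler_normB _ _)).
    rewrite (mulrDr (2 * r * kappa)); apply: lerD => //.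
    by rewrite normrM gtr0_norm ?invr_gt0// mulrCA ler_wpM2l// invr_ge0 ltW.
  have krN : 0 < kappa / (r * N%:R) by rewrite divr_gt0// mulr_gt0.
  by rewrite normrM (gtr0_norm krN) ler_pM2l.
- have mHE (f : T -> R) (a b : R) : measurable_fun setT f ->
      measurable_fun setT (fun w => (a * (b + f w))%:E).
    by move=> mf; apply/measurable_EFinP; apply: measurable_funM => //; apply: measurable_funD.
  have mSF' : measurable_fun setT (fun w => N%:R^-1 * (0 + SF w)).
    by apply: measurable_funM => //; apply: measurable_funD.
  have E1 : (\int[P]_w (2 * r * kappa * (S2 + N%:R^-1 * (0 + SF w)))%:E <=
      (2 * r * kappa * (S2 + N%:R^-1 * (0 + N%:R * S2)))%:E)%E.
    apply: expectation_affine_le => //; first by rewrite !mulr_ge0// ltW.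
      by move=> w; rewrite mulr_ge0 ?invr_ge0 ?add0r// ltW.
    by apply: expectation_affine_le => //; rewrite invr_ge0 ltW.
  have E2 : (\int[P]_w (kappa / (r * N%:R) * (c + Q w))%:E <=
      (kappa / (r * N%:R) * (c + 1))%:E)%E.
    by apply: expectation_affine_le => //; rewrite divr_ge0 ?mulr_ge0// ltW.
  have -> : (\int[P]_w (H w)%:E =
      \int[P]_w (2 * r * kappa * (S2 + N%:R^-1 * (0 + SF w)))%:E +
      \int[P]_w (kappa / (r * N%:R) * (c + Q w))%:E)%E.
    rewrite -ge0_integralD//=.
    - by apply: eq_integral => w _; rewrite -EFinD /H add0r (addrC S2).
    - move=> w _; have [r0' k0' NR0'] := And3 (ltW r0) (ltW k0) (ltW NR0).
      have N1 : 0 <= N%:R^-1 :> R by rewrite invr_ge0.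
      rewrite lee_fin; apply: mulr_ge0; first by rewrite !mulr_ge0.
      by apply: addr_ge0 => //; apply: mulr_ge0 => //; rewrite add0r.
    - exact: mHE.
    - move=> w _; have krN : 0 < kappa / (r * N%:R) by rewrite divr_gt0 ?mulr_gt0.
      by rewrite lee_fin mulr_ge0 ?(ltW krN)// addr_ge0.
    - exact: mHE.
  apply: (le_trans (leeD E1 E2)); rewrite -EFinD lee_fin.
  have L0 : Lg != 0 by rewrite gt_eqF// (lt_le_trans ltr01).
  rewrite (_ : kappa / (r * N%:R) = kappa * r / Lg); last first.
    by rewrite -NrL; field; rewrite !gt_eqF.
  rewrite add0r mulrA mulVf ?gt_eqF// mul1r.
  rewrite (_ : kappa * r / Lg * (c + 1) = kappa * r * ((c + 1) / Lg)); last by ring.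
  (* Here c / Lg = 1 + 2 S2 and 1 / Lg <= 1. Together with the 4 S2 of the discarded parts this
     gives 2 + 6 S2. *)
  have cL : (c + 1) / Lg <= 2 + 2 * S2.
    rewrite ler_pdivrMr ?(lt_le_trans ltr01)// /c; nra.
  have kr0 : 0 < kappa * r by rewrite mulr_gt0.
  apply: (le_trans (lerD (lexx _) (ler_wpM2l (ltW kr0) cL))).
  by rewrite le_eqVlt; apply/orP; left; apply/eqP; ring.
Qed.

End empirical_process.

(** The positive and negative parts scale separately; as c is strictly positive, an infinite part
    stays infinite, and then [fine] returns 0 on both sides. *)
Lemma Rintegral_mscale dT (T : measurableType dT) (R : realType)
    (mu : {measure set T -> \bar R}) (D : set T) (c : {nonneg R}) (f : T -> R) :
  measurable D -> measurable_fun D f -> 0 < c%:num ->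
  \int[mscale c mu]_(x in D) f x = c%:num * \int[mu]_(x in D) f x.
Proof.
move=> mD mf c0; rewrite /Rintegral integralE [in RHS]integralE.
have mfE : measurable_fun D (EFin \o f) by exact/measurable_EFinP.
rewrite !ge0_integral_mscale//; [|exact: measurable_funeneg|exact: measurable_funepos].
have : (0 <= \int[mu]_(x in D) (EFin \o f)^\+ x)%E by exact: integral_ge0.
have : (0 <= \int[mu]_(x in D) (EFin \o f)^\- x)%E by exact: integral_ge0.
case: (\int[mu]_(x in D) _ x)%E => [y| |] //; case: (\int[mu]_(x in D) _ x)%E => [x| |] // _ _;
  rewrite ?gt0_muley ?lte_fin//= ?mulr0// ; lra.
Qed.

(** * From finite classes to infinite ones, and to uniform samples *)

Section empirical_process_infinite.
Context dT (T : measurableType dT) (R : realType) (P : probability T R) (d : nat).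
Variables (N : nat) (X : 'I_N -> {RV P >-> 'rV[R]_d}).

(** Replacing [h j] by a member of the net costs at most kappa r F pointwise, once in the empirical
    mean and once in the expectation. The first moment of F is controlled through F <= 1 + F^2, so
    the two costs add 2 (1 + S2) to 2 + 6 S2. *)
Lemma empirical_process (nu : probability 'rV[R]_d R)
    (F : 'rV[R]_d -> R) (S2 : R) (J : Type) (I : finType) (rep : I -> J)
    (h : J -> 'rV[R]_d -> R) (kappa Lg r : R) :
  mutually_independent X ->
  (forall k A, measurable A -> P (X k @^-1` A) = nu A) ->
  (0 < N)%N ->
  measurable_fun setT F -> (forall y, 0 <= F y) ->
  (\int[nu]_y (F y ^+ 2)%:E <= S2%:E)%E ->
  0 < kappa -> 0 < r -> 1 <= Lg -> N%:R * r ^+ 2 = Lg ->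
  (2 * #|I|)%:R <= expR Lg ->
  (forall j, measurable_fun setT (h j)) ->
  (forall j y, `|h j y| <= kappa * F y) ->
  (forall j, exists i, forall y, `|h j y - h (rep i) y| <= kappa * r * F y) ->
  exists H : T -> R, [/\ measurable_fun setT H, forall w, 0 <= H w,
    forall w j, `|N%:R^-1 * \sum_k h j (X k w) - \int[nu]_y h j y| <= H w &
    (\int[P]_w (H w)%:E <= (kappa * r * (4 + 8 * S2))%:E)%E].
Proof.
move=> indX lawX N0 mF F0 F2 k0 r0 L1 NrL cI mh hF net.
have S20 := envelope_sqr_bound_ge0 F2.
have NR0 : 0 < N%:R :> R by rewrite ltr0n.
have [H [mH H0 Hh EH]] := empirical_finite_class indX lawX N0 mF F0 F2 k0 r0 L1 NrL
  cI (fun i => mh (rep i)) (fun i => hF (rep i)).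
have FF y : F y <= 1 + F y ^+ 2 by have := sqr_ge0 (F y - 1); have := sqr_ge0 (F y); nra.
pose G y := 1 + F y ^+ 2.
have mG : measurable_fun setT G by apply: measurable_funD => //; exact: measurable_funX.
have G0 y : 0 <= G y by rewrite addr_ge0// sqr_ge0.
have EG : (\int[nu]_y (G y)%:E <= (1 + S2)%:E)%E.
  rewrite /G; under eq_integral do rewrite EFinD.
  rewrite ge0_integralD//=; last 2 first.
  - by move=> w _; rewrite lee_fin sqr_ge0.
  - by apply/measurable_EFinP; exact: measurable_funX.
  by rewrite expectation_cst EFinD leeD2l.
have iG : nu.-integrable setT (EFin \o G).
  apply/integrableP; split; first exact/measurable_EFinP.
  under eq_integral do rewrite /= ger0_norm//.
  exact: le_lt_trans EG (ltry _).
have kr0 : 0 < kappa * r by rewrite mulr_gt0.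
pose SG w := \sum_k G (X k w).
have SG0 w : 0 <= SG w by apply: sumr_ge0.
have mSG : measurable_fun setT SG.
  by apply: measurable_sum => k; exact: (measurableT_comp mG).
have ESG : (\int[P]_w (SG w)%:E <= (N%:R * (1 + S2))%:E)%E.
  rewrite /SG; under eq_integral do rewrite -sumEFin.
  have mGE : measurable_fun setT (fun y => (G y)%:E) by exact/measurable_EFinP.
  have GE0 y : (0 <= (G y)%:E)%E by rewrite lee_fin.
  rewrite ge0_integral_sum//; last by move=> k; apply: (measurableT_comp mGE).
  apply: (@le_trans _ _ (\sum_(k < N) (1 + S2)%:E)%E).
    by apply: lee_sum => k _; rewrite (ge0_integral_law lawX k mGE).
  by rewrite sumEFin sumr_const card_ord mulr_natl.
have ih j : nu.-integrable setT (EFin \o h j).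
  apply: (@le_integrable _ _ _ nu _ measurableT _ (fun y => (kappa * G y)%:E)).
  - exact/measurable_EFinP.
  - move=> y _ /=; rewrite lee_fin [leRHS]ger0_norm ?mulr_ge0 ?(ltW k0)//.
    by apply: le_trans (hF j y) _; rewrite ler_pM2l.
  - exact: (@integrableZl _ _ _ nu setT measurableT kappa (EFin \o G)).
pose H' w := H w + kappa * r * (N%:R^-1 * SG w + (1 + S2)).
have N1 : 0 <= N%:R^-1 :> R by rewrite invr_ge0 ltW.
have aff0 w : 0 <= N%:R^-1 * SG w + (1 + S2).
  by apply: addr_ge0; [exact: mulr_ge0|lra].
have maff : measurable_fun setT (fun w => N%:R^-1 * SG w + (1 + S2)).
  by apply: measurable_funD => //; apply: measurable_funM.
exists H'; split.
- by apply: measurable_funD => //; apply: measurable_funM.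
- by move=> w; apply: addr_ge0 => //; apply: mulr_ge0 => //; exact: ltW.
- move=> w j; have [i ij] := net j.
  have ijG y : `|h j y - h (rep i) y| <= kappa * r * G y.
    by apply: le_trans (ij y) _; rewrite ler_pM2l.
  have -> : N%:R^-1 * \sum_k h j (X k w) - \int[nu]_y h j y =
    (N%:R^-1 * \sum_k h (rep i) (X k w) - \int[nu]_y h (rep i) y)
    + (N%:R^-1 * (\sum_k h j (X k w) - \sum_k h (rep i) (X k w))
      - (\int[nu]_y h j y - \int[nu]_y h (rep i) y)) by ring.
  apply: (le_trans (ler_normD _ _)); apply: lerD => //.
  apply: (le_trans (ler_normB _ _)); rewrite (mulrDr (kappa * r)); apply: lerD.
    rewrite normrM ger0_norm// mulrCA ler_wpM2l// -sumrB.
    apply: (le_trans (ler_norm_sum _ _ _)); rewrite mulr_sumr.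
    by apply: ler_sum => k _.
  rewrite -RintegralB//.
  have iB : nu.-integrable setT (EFin \o (fun y => h j y - h (rep i) y)).
    exact: (@integrableB _ _ _ nu setT measurableT (EFin \o h j) (EFin \o h (rep i))).
  apply: (le_trans (le_normr_Rintegral measurableT iB)).
  apply: (@le_trans _ _ (\int[nu]_y (kappa * r * G y))).
    apply: le_Rintegral => //; first exact: (integrable_norm iB).
    exact: (@integrableZl _ _ _ nu setT measurableT (kappa * r) (EFin \o G)).
  rewrite RintegralZl// ler_pM2l// -lee_fin /Rintegral fineK//.
  exact: integrable_fin_num.
- have E2 : (\int[P]_w (kappa * r * ((1 + S2) + N%:R^-1 * (0 + SG w)))%:E <=
      (kappa * r * ((1 + S2) + N%:R^-1 * (0 + N%:R * (1 + S2))))%:E)%E.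
    have m0 : measurable_fun setT (fun w => N%:R^-1 * (0 + SG w)).
      by apply: measurable_funM => //; apply: measurable_funD.
    apply: expectation_affine_le => //.
    - exact: ltW.
    - lra.
    - by move=> w; rewrite add0r mulr_ge0.
    - exact: expectation_affine_le.
  have -> : (\int[P]_w (H' w)%:E = \int[P]_w (H w)%:E +
      \int[P]_w (kappa * r * ((1 + S2) + N%:R^-1 * (0 + SG w)))%:E)%E.
    rewrite -ge0_integralD//=.
    - by apply: eq_integral => w _; rewrite -EFinD /H' add0r (addrC (1 + S2)).
    - by move=> w _; rewrite lee_fin.
    - exact/measurable_EFinP.
    - move=> w _; rewrite lee_fin mulr_ge0 ?(ltW kr0)//.
      by rewrite add0r addrC.
    - apply/measurable_EFinP; apply: measurable_funM => //.
      apply: measurable_funD => //; apply: measurable_funM => //.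
      exact: measurable_funD.
  apply: (le_trans (leeD EH E2)); rewrite -EFinD lee_fin.
  by rewrite le_eqVlt; apply/orP; left; apply/eqP; field; rewrite gt_eqF.
Qed.

(** The law of one sample has mass 1, whereas the quotient defining it is 0 as soon as
    [fine (mu Om)] is 0, which covers both measure 0 and measure +oo. *)
Lemma iid_uniform_measure (mu : {measure set 'rV[R]_d -> \bar R}) (Om : set 'rV[R]_d) :
  (0 < N)%N -> iid_uniform mu Om X ->
  0 < fine (mu Om) /\ mu Om = (fine (mu Om))%:E.
Proof.
move=> N0 [_ uX]; have := uX (Ordinal N0) setT measurableT.
rewrite preimage_setT [LHS]probability_setT setTI => /esym[] V1.
have V0 : fine (mu Om) != 0.
  by apply: contra_eq_neq V1 => ->; rewrite mul0r eq_sym oner_neq0.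
have m0 := measure_ge0 mu Om.
split; first by rewrite lt_neqAle eq_sym V0 fine_ge0.
by move: V0 m0; case: (mu Om) => //=; rewrite eqxx.
Qed.

(** The integrands matter only on [D], so they are extended by 0. The law [nu] of the first sample
    is mu / mu(D) on subsets of [D]; multiplying the deviation by mu(D) turns the empirical mean
    into the Monte Carlo sum of the loss. The bound on [H] holds only for samples lying in [D]. *)
Lemma uniform_deviation (mu : {measure set 'rV[R]_d -> \bar R})
    (D : set 'rV[R]_d) (F : 'rV[R]_d -> R) (S2 : R) (J : Type) (I : finType) (rep : I -> J)
    (h : J -> 'rV[R]_d -> R) (kappa Lg r : R) :
  measurable D -> (0 < N)%N -> iid_uniform mu D X ->
  measurable_fun D F -> (forall y, D y -> 0 <= F y) ->
  (\int[mu]_(y in D) (F y ^+ 2)%:E <= (fine (mu D) * S2)%:E)%E ->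
  0 < kappa -> 0 < r -> 1 <= Lg -> N%:R * r ^+ 2 = Lg ->
  (2 * #|I|)%:R <= expR Lg ->
  (forall j, measurable_fun D (h j)) ->
  (forall j y, D y -> `|h j y| <= kappa * F y) ->
  (forall j, exists i, forall y, D y -> `|h j y - h (rep i) y| <= kappa * r * F y) ->
  exists H : T -> R, [/\ measurable_fun setT H, forall w, 0 <= H w,
    forall w j, (forall k, D (X k w)) ->
      `|fine (mu D) / N%:R * \sum_k h j (X k w) - \int[mu]_(y in D) h j y| <= H w &
    (\int[P]_w (H w)%:E <= (fine (mu D) * (kappa * r * (4 + 8 * S2)))%:E)%E].
Proof.
move=> mD N0 iX mF F0 F2 k0 r0 L1 NrL cI mh hF net.
have [V0 VE] := iid_uniform_measure N0 iX.
case: iX => indX uX.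
set V := fine (mu D) in V0 VE F2 *.
pose nu : probability _ R := distribution P (X (Ordinal N0)).
have lawX k A : measurable A -> P (X k @^-1` A) = nu A.
  by move=> mA; rewrite [RHS]uX// uX.
have iV0 : 0 <= V^-1 by rewrite invr_ge0 ltW.
pose c := NngNum iV0.
have nuD A : measurable A -> A `<=` D -> nu A = mscale c mu A.
  move=> mA AD; rewrite [LHS]uX//= /mscale/= muleC setIidl//.
  rewrite EFinM fineK// ge0_fin_numE//.
  apply: le_lt_trans (_ : mu D < +oo)%E; last by rewrite VE ltry.
  by apply: le_measure; rewrite ?inE.
have F2nu : (\int[nu]_y ((F \_ D) y ^+ 2)%:E <= S2%:E)%E.
  rewrite (_ : (fun y => _) = (fun y => (F y ^+ 2)%:E) \_ D); last first.
    by apply/funext => y; rewrite !patchE; case: ifPn => //; rewrite expr0n.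
  rewrite -integral_mkcond (eq_measure_integral (mscale c mu))//.
  rewrite ge0_integral_mscale//=; last 2 first.
  - by apply/measurable_EFinP; exact: measurable_funX.
  - by move=> y _; rewrite lee_fin sqr_ge0.
  rewrite lee_pdivrMl//.
have restr_le (f : 'rV[R]_d -> R) a y : (D y -> `|f y| <= a * F y) -> `|(f \_ D) y| <= a * (F \_ D) y.
  rewrite !patchE; case: ifPn => yD; last first.
    by rewrite normr0 mulr0.
  by apply; rewrite inE in yD.
have mr (f : _ -> R) : measurable_fun D f -> measurable_fun setT (f \_ D).
  by move=> mf; exact/(measurable_restrictT _ mD).
have [||||H [mH H0 Hh EH]] := @empirical_process nu (F \_ D) S2 J I rep (fun j => h j \_ D)
  kappa Lg r indX lawX N0 (mr _ mF) _ F2nu k0 r0 L1 NrL cI.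
- by move=> y; rewrite patchE; case: ifPn => //; rewrite inE; exact: F0.
- by move=> j; exact: mr.
- by move=> j y; apply: restr_le; exact: hF.
- move=> j; have [i ij] := net j; exists i => y.
  have := restr_le (fun y => h j y - h (rep i) y) (kappa * r) y (ij y).
  by rewrite !patchE; case: ifPn => //; rewrite subrr.
exists (fun w => V * H w); split.
- exact: measurable_funM.
- by move=> w; rewrite mulr_ge0// ltW.
- move=> w j Dw; have := Hh w j; rewrite -(ler_pM2l V0) -[X in X * `|_|](gtr0_norm V0) -normrM.
  rewrite mulrBr mulrA (eq_bigr (fun k => h j (X k w))); last first.
    by move=> k _; rewrite patchE mem_set.
  rewrite -Rintegral_mkcond.
  suff -> : V * \int[nu]_(x in D) h j x = \int[mu]_(x in D) h j x by [].
  have -> : \int[nu]_(x in D) h j x = \int[mscale c mu]_(x in D) h j x.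
    by congr fine; exact: eq_measure_integral.
  by rewrite Rintegral_mscale ?invr_gt0//= mulrA divff ?gt_eqF// mul1r.
- have := expectation_affine_le (ltW V0) (lexx 0) mH H0 EH.
  by under eq_integral do rewrite add0r; rewrite add0r.
Qed.

End empirical_process_infinite.

(** * Integration by parts on R^n *)

Lemma cons_rV0 (R : realType) n (p : R * 'rV[R]_n) : cons_rV p 0 ord0 = p.1.
Proof.
rewrite /cons_rV mxE; case: splitP => [j _|j /= ]; first by rewrite mxE !ord1 eqxx mulr1n.
by rewrite add1n.
Qed.

Lemma cons_rV_lift (R : realType) n (p : R * 'rV[R]_n) (j : 'I_n) :
  cons_rV p 0 (lift ord0 j) = p.2 0 j.
Proof.
rewrite /cons_rV mxE; case: splitP => [k|k] /=; rewrite /bump leq0n add1n.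
  by case: k => -[].
by rewrite add1n => -[/val_inj ->].
Qed.

Lemma cons_rVP (R : realType) n (x : 'rV[R]_n.+1) (p : R * 'rV[R]_n) :
  x 0 ord0 = p.1 -> (forall j, x 0 (lift ord0 j) = p.2 0 j) -> x = cons_rV p.
Proof.
move=> x0 xj; apply/rowP => i; have [j ->|->] := unliftP ord0 i.
  by rewrite xj cons_rV_lift.
by rewrite x0 cons_rV0.
Qed.

Lemma continuous_measurable_rV (R : realType) n (f : 'rV[R]_n -> R) :
  continuous f -> measurable_fun setT f.
Proof.
move=> cf; apply: (measurability _ (RGenInftyO.measurableE R)).
move=> _ [_ [a ->] <-]; rewrite setTI; apply: sub_sigma_algebra.
by apply: open_comp => [x _|]; [exact: cf|exact: interval_open].
Qed.

Lemma continuous_cons_rVr (R : realType) n (t : R) :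
  continuous (fun x : 'rV[R]_n => cons_rV (t, x)).
Proof.
move=> x A /nbhs_ballP[e /= e0 eA]; apply/nbhs_ballP.
exists e => // y [_ xy]; apply: eA; split=> // i j; rewrite ord1.
have [k ->|->] := unliftP ord0 j; first by rewrite !cons_rV_lift; apply: xy.
by rewrite !cons_rV0; exact: ballxx.
Qed.

Lemma continuous_cons_rVl (R : realType) n (x : 'rV[R]_n) :
  continuous (fun t : R => cons_rV (t, x)).
Proof.
move=> t A /nbhs_ballP[e /= e0 eA]; apply/nbhs_ballP.
exists e => // s ts; apply: eA; split=> // i j; rewrite ord1.
have [k ->|->] := unliftP ord0 j; last by rewrite !cons_rV0.
by rewrite !cons_rV_lift; exact: ballxx.
Qed.

Section integral_lebesgue_rV.
Context {R : realType}.

Definition cube n (M : R) : set 'rV[R]_n := [set x | forall j, `|x 0 j| <= M].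
Arguments cube : clear implicits.

Lemma measurable_cube n (M : R) : measurable (cube n M).
Proof.
have -> : cube n M = \bigcap_(j in [set: 'I_n]) [set x | `|x 0 j| <= M].
  by apply/seteqP; split => x /= Hx j; [move=> _; exact: Hx|exact: (Hx j)].
apply: fin_bigcap_measurable => // j _.
rewrite -[X in measurable X]setTI; apply: measurable_fun_le => //.
by apply: measurableT_comp => //; exact: measurable_coord.
Qed.

Lemma lebesgue_cube_lty n (M : R) : (lebesgue_rV n (cube n M) < +oo)%E.
Proof.
elim: n => [|n IH]; first by rewrite /= /dirac indicE ltry.
rewrite /= /lebesgue_rVS /pushforward.
have -> : @cons_rV R n @^-1` cube n.+1 M = `[- M, M]%classic `*` cube n M.
  apply/seteqP; split => [[t x] /= H|[t x] /= [tM xM]].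
    split; first by have := H ord0; rewrite cons_rV0 in_itv /= ler_norml.
    by move=> j; have := H (lift ord0 j); rewrite cons_rV_lift.
  move=> j; have [k ->|->] := unliftP ord0 j; first by rewrite cons_rV_lift; exact: xM.
  by rewrite cons_rV0 /= ler_norml; move: tM; rewrite in_itv.
rewrite product_measure1E//; last exact: measurable_cube.
rewrite [X in (X * _)%E]lebesgue_measure_itv; apply: lte_mul_pinfty => //.
- by case: ifP => // h; rewrite lee_fin; move: h; rewrite lte_fin; lra.
- by case: ifP.
Qed.

(* measurable_cons_rV for the display on R that lebesgue_measure carries. *)
Lemma measurable_cons_rVR n :
  measurable_fun (setT : set (measurableTypeR R * 'rV[R]_n)%type) (@cons_rV R n).
Proof. by move=> _ A mA; exact: (measurable_cons_rV measurableT mA). Qed.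

Lemma integrable_lebesgue_rVS n (f : 'rV[R]_n.+1 -> R) :
  measurable_fun setT f ->
  (lebesgue_measure \x lebesgue_rV n)%E.-integrable setT (EFin \o f \o @cons_rV R n) ->
  (\int[lebesgue_rV n.+1]_x (f x)%:E =
   \int[(lebesgue_measure \x lebesgue_rV n)%E]_p (f (cons_rV p))%:E)%E.
Proof.
move=> mf intf.
have mfE : measurable_fun setT (EFin \o f) by exact/measurable_EFinP.
exact: (integral_pushforward (@measurable_cons_rVR n) mfE intf measurableT).
Qed.

Lemma bounded_support_integrable n (f : 'rV[R]_n -> R) (M C : R) :
  measurable_fun setT f -> (forall x, `|f x| <= C) ->
  (forall x, ~ cube n M x -> f x = 0) ->
  (lebesgue_rV n).-integrable setT (EFin \o f).
Proof.
move=> mf fC fM.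
apply: (@le_integrable _ _ _ (lebesgue_rV n) _ measurableT _ (EFin \o (fun x => C * \1_(cube n M) x))).
- exact/measurable_EFinP.
- move=> x _ /=; rewrite lee_fin indicE; case: (asboolP (cube n M x)) => xM.
    by rewrite mem_set// mulr1 (le_trans (fC x))// ler_norm.
  by rewrite fM// normr0.
apply: (@integrableZl _ _ _ (lebesgue_rV n) setT measurableT C (EFin \o \1_(cube n M))).
have mb := @measurable_cube n M.
apply/integrableP; split; first exact/measurable_EFinP.
under eq_integral do rewrite /= ger0_norm ?indicE//.
by rewrite -[X in (X < _)%E]/(\int[lebesgue_rV n]_x (\1_(cube n M) x)%:E)%E integral_indic// setIT; exact: lebesgue_cube_lty.
Qed.

(** The difference quotients coincide as functions of h, so derivability and derivative transfer as
    equalities that can be rewritten with, here for a direction other than the first coordinate. *)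
Lemma partial_slice n (w : 'rV[R]_n.+1 -> R) (t : R) (x : 'rV[R]_n) (j : 'I_n) :
  (derivable (fun y => w (cons_rV (t, y))) x (delta_mx 0 j) =
     derivable w (cons_rV (t, x)) (delta_mx 0 (lift ord0 j))) *
  (partial j (fun y => w (cons_rV (t, y))) x =
     partial (lift ord0 j) w (cons_rV (t, x))).
Proof.
have E h : cons_rV (t, h *: delta_mx 0 j + x) =
    h *: delta_mx 0 (lift ord0 j) + cons_rV (t, x).
  apply/esym/cons_rVP.
    by rewrite mxE cons_rV0 !mxE/= mulr0 add0r.
  move=> k; rewrite mxE cons_rV_lift !mxE/=.
  by rewrite (inj_eq lift_inj).
pose f y := w (cons_rV (t, y)).
have Ef : (fun h : R => h^-1 *: ((f \o shift x) (h *: delta_mx 0 j) - f x)) =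
    (fun h : R => h^-1 *: ((w \o shift (cons_rV (t, x)))
      (h *: delta_mx 0 (lift ord0 j)) - w (cons_rV (t, x)))).
  by apply/funext => h; rewrite /f /= E.
by split; rewrite -/f /partial /derivable /derive Ef.
Qed.

Lemma partial_slice0 n (w : 'rV[R]_n.+1 -> R) (t : R) (x : 'rV[R]_n) :
  (derivable (fun s => w (cons_rV (s, x))) t 1 =
     derivable w (cons_rV (t, x)) (delta_mx 0 ord0)) *
  ('D_1 (fun s => w (cons_rV (s, x))) t =
     partial ord0 w (cons_rV (t, x))).
Proof.
have E h : cons_rV (h *: (1 : R) + t, x) =
    h *: delta_mx 0 ord0 + cons_rV (t, x).
  apply/esym/cons_rVP; first by rewrite mxE cons_rV0 !mxE/= .
  move=> k; rewrite mxE cons_rV_lift !mxE/=.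
  by rewrite mulr0 add0r.
pose f s := w (cons_rV (s, x)).
have Ef : (fun h : R => h^-1 *: ((f \o shift t) (h *: (1 : R)) - f t)) =
    (fun h : R => h^-1 *: ((w \o shift (cons_rV (t, x)))
      (h *: delta_mx 0 ord0) - w (cons_rV (t, x)))).
  by apply/funext => h; rewrite /f /= E.
by split; rewrite -/f /partial /derivable /derive Ef.
Qed.

(** Fundamental theorem of calculus on [-a, a], where a = |M| + 1 is positive and exceeds M whatever
    the sign of M: [f] vanishes outside, and [F] at the endpoints. *)
Lemma integral_derive1_eq0 (F f : R -> R) (M : R) :
  continuous f -> (forall t, derivable F t 1) -> (forall t, 'D_1 F t = f t) ->
  (forall t, M < `|t| -> F t = 0) -> (forall t, M < `|t| -> f t = 0) ->
  (\int[lebesgue_measure]_t (f t)%:E = 0)%E.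
Proof.
move=> cf dF DF F0 f0.
pose a : R := `|M| + 1.
have Ma (t : R) : a <= `|t| -> M < `|t|.
  by move=> at_; have := ler_norm M; rewrite /a in at_; lra.
have a0 : 0 < a by rewrite /a; have := normr_ge0 M; lra.
have Fa : F a = 0 by apply/F0/Ma; rewrite gtr0_norm.
have FNa : F (- a) = 0 by apply/F0/Ma; rewrite normrN gtr0_norm.
have -> : (\int[lebesgue_measure]_t (f t)%:E =
    \int[lebesgue_measure]_(t in `[(- a)%R, a]) (f t)%:E)%E.
  rewrite [RHS]integral_mkcond; apply: eq_integral => t _.
  rewrite patchE; case: ifPn => //; rewrite notin_setE /= in_itv /= => /negP.
  by rewrite -ler_norml -ltNge => /ltW/Ma/f0 ->.
have cF : continuous F.
  by move=> t; apply/differentiable_continuous/derivable1_diffP.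
rewrite (continuous_FTC2 (F := F)) ?Fa ?FNa ?subee//.
- by lra.
- exact: continuous_subspaceT.
- split => //.
  + by apply: cvg_at_right_filter; exact: cF.
  + by apply: cvg_at_left_filter; exact: cF.
- by move=> t _; rewrite derive1E DF.
Qed.

(** Induction on the dimension by Fubini. In the first coordinate direction, the inner integral is
    one-dimensional and vanishes by the fundamental theorem; in another direction, it is an integral
    over a slice, to which the induction hypothesis applies. The bound and the support in a cube
    provide the integrability for Fubini. *)
Lemma integral_partial_eq0 n (i : 'I_n) (w : 'rV[R]_n -> R) (M C : R) :
  (forall x, derivable w x (delta_mx 0 i)) -> continuous (partial i w) ->
  (forall x, `|partial i w x| <= C) ->
  (forall x, ~ cube n M x -> w x = 0) ->
  (forall x, ~ cube n M x -> partial i w x = 0) ->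
  (\int[lebesgue_rV n]_x (partial i w x)%:E = 0)%E.
Proof.
elim: n i w M C => [[]//|n IH] i w M C dw cw Cw w0 pw0.
have mG := continuous_measurable_rV cw.
have mGc : measurable_fun setT (partial i w \o @cons_rV R n).
  by apply: measurableT_comp => //; exact: measurable_cons_rV.
have intG : (lebesgue_measure \x lebesgue_rV n)%E.-integrable setT
    (EFin \o partial i w \o @cons_rV R n).
  apply/integrableP; split; first exact/measurable_EFinP.
  have /integrableP[_] := bounded_support_integrable mG Cw pw0.
  rewrite /= ge0_integral_pushforward//.
  - exact: measurable_cons_rV.
  - by apply/measurable_EFinP; exact: measurableT_comp.
rewrite integrable_lebesgue_rVS//.
have [j ij|i0] := unliftP ord0 i.
- rewrite -(integral12_prod_meas1 intG) /fubini_F.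
  apply: integral0_eq => t _ /=.
  rewrite (eq_integral (fun x => (partial j (fun y => w (cons_rV (t, y))) x)%:E)); last first.
    by move=> x _; rewrite (partial_slice w t x j).2 -ij.
  apply: (IH j _ M C).
  + by move=> x; rewrite partial_slice -ij.
  + rewrite (_ : partial _ _ = fun x => partial i w (cons_rV (t, x))).
      move=> x; apply: (@continuous_comp _ _ _ (fun x => cons_rV (t, x)) (partial i w)); last exact: cw.
      exact: continuous_cons_rVr.
    by apply/funext => x; rewrite partial_slice ij.
  + by move=> x; rewrite partial_slice -ij.
  + move=> x xM; apply: w0; apply: contra_not xM => H k.
    by have := H (lift ord0 k); rewrite cons_rV_lift.
  + move=> x xM; rewrite partial_slice -ij; apply: pw0; apply: contra_not xM => H k.
    by have := H (lift ord0 k); rewrite cons_rV_lift.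
- rewrite -(integral21_prod_meas1 intG) /fubini_G.
  apply: integral0_eq => x _ /=.
  apply: (@integral_derive1_eq0 (fun t => w (cons_rV (t, x))) _ M).
  + move=> t; apply: (@continuous_comp _ _ _ (fun t => cons_rV (t, x)) (partial i w)); last exact: cw.
    exact: continuous_cons_rVl.
  + by move=> t; rewrite partial_slice0 -i0.
  + by move=> t; rewrite partial_slice0 -i0.
  + move=> t tM; apply: w0 => /(_ ord0); rewrite cons_rV0/=.
    by rewrite leNgt tM.
  + move=> t tM; apply: pw0 => /(_ ord0); rewrite cons_rV0/=.
    by rewrite leNgt tM.
Qed.

End integral_lebesgue_rV.
Arguments cube {R} n M.
Arguments measurable_cube {R} n M.
Arguments lebesgue_cube_lty {R} n M.

(** * Smooth functions with compact support *)

Section flat_functions.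
Context {R : realType}.
Implicit Types (c t s : R) (p : {poly R}).

(** The polynomial in 1 / t makes the family stable under derivation: p becomes X^2 (c p - p'). *)
Definition flat c p t : R := if 0 < t then p.[t^-1] * expR (- (c / t)) else 0.

(** From x <= exp(x) at x = c s / (k + 1), raised to the power k. Using k + 1 rather than k avoids a
    zero denominator. *)
Lemma exprn_le_expR c s k : 0 < c -> 0 < s ->
  s ^+ k <= (k.+1%:R / c) ^+ k * expR (c * s).
Proof.
move=> c0 s0.
have cs0 : 0 < c * s by rewrite mulr_gt0.
have h : (c * s / k.+1%:R) ^+ k <= expR (c * s).
  apply: (@le_trans _ _ (expR (c * s / k.+1%:R) ^+ k)).
    apply: lerXn2r; rewrite ?nnegrE ?expR_ge0 ?divr_ge0 ?(ltW cs0)//.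
    by apply: le_trans (expR_ge1Dx _); rewrite lerDr.
  rewrite -expRM_natl ler_expR mulrCA ler_piMr ?(ltW cs0)//.
  by rewrite ler_pdivrMr ?ltr0n// mul1r ler_nat.
rewrite -ler_pdivrMl; last by rewrite exprn_gt0// divr_gt0.
rewrite -exprVn -exprMn invf_div (_ : c / k.+1%:R * s = c * s / k.+1%:R)//.
by rewrite mulrAC.
Qed.

(** Each monomial satisfies t^(-i) = t^(-i-2) t^2, and the exponential absorbs t^(-i-2). The
    quadratic bound forces the derivative at 0 to be 0. *)
Lemma flat_le_sqr c p : 0 < c -> exists2 K, 0 <= K & forall t, `|flat c p t| <= K * t ^+ 2.
Proof.
move=> c0.
exists (\sum_(i < size p) `|p`_i| * ((i.+2).+1%:R / c) ^+ i.+2).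
  by apply: sumr_ge0 => i _; rewrite mulr_ge0// exprn_ge0// divr_ge0// ltW.
move=> t; rewrite /flat; case: ltP => t0; last first.
  rewrite normr0 mulr_ge0 ?sqr_ge0//.
  by apply: sumr_ge0 => i _; rewrite mulr_ge0// exprn_ge0// divr_ge0// ltW.
have s0 : 0 < t^-1 by rewrite invr_gt0.
rewrite normrM (ger0_norm (expR_ge0 _)) expRN ler_pdivrMr ?expR_gt0//.
rewrite horner_coef (le_trans (ler_norm_sum _ _ _))// mulr_suml mulr_suml.
apply: ler_sum => i _; rewrite normrM -mulrA -mulrA ler_wpM2l//.
rewrite normrX (gtr0_norm s0) (mulrC (t ^+ 2)) mulrA -ler_pdivrMr ?exprn_gt0//.
rewrite -exprVn -exprD addn2.
exact: exprn_le_expR.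
Qed.

Lemma is_derive_flat c p t : 0 < c ->
  is_derive t 1 (flat c p) (flat c ('X^2 * (c *: p - p^`())) t).
Proof.
move=> c0; have [t0|t0|->] := ltgtP t 0.
- have -> : flat c ('X^2 * (c *: p - p^`())) t = 0 by rewrite /flat ltNge (ltW t0).
  have d0 : is_derive t 1 (cst (0 : R)) (0 : R) by exact: is_derive_cst.
  apply: near_eq_is_derive d0.
  near=> u; rewrite /flat ifF//; apply/negbTE; rewrite -leNgt.
  by near: u; apply: filterS (open_nbhs_nbhs (conj (@open_lt _ 0) t0)) => u /= /ltW.
- have tn0 : t != 0 by rewrite gt_eqF.
  have dinv : is_derive t 1 (fun u : R => u^-1) (- t ^- 2).
    apply: is_derive_eq; first exact: is_deriveV.
    by rewrite /GRing.scale/= mulr1.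
  have d1 : is_derive t 1 (fun u : R => p.[u^-1]) (p^`().[t^-1] * - t ^- 2).
    exact: (is_derive1_comp (is_derive_poly p t^-1) dinv).
  have d2 : is_derive t 1 (fun u : R => - (c / u)) (- (c * - t ^- 2)).
    by apply: is_deriveN; apply: (is_deriveZ c dinv).
  have d3 : is_derive t 1 (fun u : R => expR (- (c / u))) (expR (- (c / t)) * (- (c * - t ^- 2))).
    exact: (is_derive1_comp (is_derive_expR _) d2).
  have d4 := is_deriveM d1 d3.
  have -> : flat c ('X^2 * (c *: p - p^`())) t = p.[t^-1] *: (expR (- (c / t)) * (- (c * - t ^- 2))) + expR (- (c / t)) *: (p^`().[t^-1] * - t ^- 2).
    by rewrite /flat t0 !hornerE /GRing.scale/=; field.
  apply: near_eq_is_derive d4.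
  near=> u; rewrite /flat ifT//.
  by near: u; exact: (open_nbhs_nbhs (conj (@open_gt _ 0) t0)).
- have [K K0 BK] := flat_le_sqr p c0.
  have f0 : flat c p 0 = 0 by rewrite /flat ltxx.
  have -> : flat c ('X^2 * (c *: p - p^`())) 0 = 0 by rewrite /flat ltxx.
  have cv : (fun h : R => h^-1 *: ((flat c p \o shift 0) (h *: (1 : R)) - flat c p 0)) @ 0^' --> (0 : R).
    apply/cvgrPdist_le => e e0; near=> h.
    rewrite /= f0 subr0 addr0 sub0r normrN /GRing.scale/= mulr1 normrM.
    have h0 : h != 0 by near: h; exact: nbhs_dnbhs_neq.
    have hn0 : 0 < `|h| by rewrite normr_gt0.
    apply: (@le_trans _ _ (K * `|h|)).
      rewrite normfV mulrC ler_pdivrMr// -mulrA -expr2 real_normK ?num_real//.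
    (* K may be 0; K + 1 can be divided by. *)
    rewrite (@le_trans _ _ ((K + 1) * `|h|))// ?ler_wpM2r// ?lerDl//.
    rewrite mulrC -ler_pdivlMr; last by lra.
    near: h; apply: dnbhs0_le; rewrite divr_gt0//; lra.
  by apply: DeriveDef; [apply/cvg_ex; exists 0|exact: cvg_lim].
Unshelve. all: by end_near. Qed.

End flat_functions.

Section directional_derivatives.
Context {R : realType} {V : normedModType R}.

(** A directional derivative is the derivative at 0 along a line; this and its converse below
    transfer the one-variable chain rule to directional derivatives. *)
Lemma is_derive_line (f : V -> R) (x v : V) (df : R) :
  is_derive (0 : R) 1 (fun h : R => f (h *: v + x)) df -> is_derive x v f df.
Proof.
have E : (fun h : R => h^-1 *: ((f \o shift x) (h *: v) - f x)) =
  (fun h : R => h^-1 *: (((fun h : R => f (h *: v + x)) \o shift 0) (h *: (1 : R)) -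
     (fun h : R => f (h *: v + x)) 0)).
  by apply/funext => h /=; rewrite addr0 scale0r add0r [_%:A]mulr1.
move=> [d1 d2]; apply: DeriveDef; first exact: (derivable1P f x v).2.
by rewrite -d2 /derive E.
Qed.

Lemma line_is_derive (f : V -> R) (x v : V) (df : R) :
  is_derive x v f df -> is_derive (0 : R) 1 (fun h : R => f (h *: v + x)) df.
Proof.
have E : (fun h : R => h^-1 *: ((f \o shift x) (h *: v) - f x)) =
  (fun h : R => h^-1 *: (((fun h : R => f (h *: v + x)) \o shift 0) (h *: (1 : R)) -
     (fun h : R => f (h *: v + x)) 0)).
  by apply/funext => h /=; rewrite addr0 scale0r add0r [_%:A]mulr1.
move=> [d1 d2]; apply: DeriveDef; first exact: (derivable1P f x v).1.
by rewrite -d2 /derive E.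
Qed.

Lemma is_derive_comp1 (phi : R -> R) (f : V -> R) (x v : V) (dphi df : R) :
  is_derive (f x) 1 phi dphi -> is_derive x v f df ->
  is_derive x v (phi \o f) (dphi * df).
Proof.
move=> dp /line_is_derive fd; apply: is_derive_line.
apply: (@is_derive1_comp _ phi (fun h : R => f (h *: v + x))) => //.
by rewrite scale0r add0r.
Qed.

End directional_derivatives.

Lemma is_derive_coord (R : realType) n (i j : 'I_n) (x : 'rV[R]_n) :
  is_derive x (delta_mx 0 j : 'rV[R]_n) (fun y : 'rV[R]_n => y 0 i) ((i == j)%:R : R).
Proof.
apply: is_derive_line.
rewrite (_ : (fun h : R => _) = (fun h : R => (i == j)%:R * h + x 0 i)); last first.
  by apply/funext => h; rewrite !mxE eqxx /= mulrC.
rewrite -[X in is_derive _ _ _ X]addr0.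
apply: is_deriveD; rewrite -[X in is_derive _ _ _ X]mulr1.
exact: is_deriveZ.
Qed.

Section elementary.
Context {R : realType} {n : nat}.
Local Notation E := 'rV[R]_n.

(* A class of smooth functions that is visibly stable under partial derivation. *)
Inductive elementary : (E -> R) -> Prop :=
| elementary_cst k : elementary (fun=> k)
| elementary_flat c p (s a : R) i : 0 < c ->
    elementary (fun x => flat c p (s * x 0 i + a))
| elementary_add f g : elementary f -> elementary g ->
    elementary (fun x => f x + g x)
| elementary_mul f g : elementary f -> elementary g ->
    elementary (fun x => f x * g x).

Lemma elementary_differentiable f x : elementary f -> differentiable f x.
Proof.
elim=> [k|c p s a i c0|g h _ dg _ dh|g h _ dg _ dh].
- exact: differentiable_cst.
- apply: (@differentiable_comp _ _ _ _ (fun x : E => s * x 0 i + a) (flat c p)).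
    apply: (@differentiableD _ _ _ (fun x : E => s * x 0 i) (cst a)) => //.
    apply: (@differentiableZ _ _ _ (fun x : E => x 0 i) s).
    exact: differentiable_coord.
  apply/derivable1_diffP; apply: ex_derive; exact: is_derive_flat.
- exact: (@differentiableD _ _ _ g h).
- exact: (@differentiableM _ _ g h).
Qed.

Lemma elementary_partial j f : elementary f -> elementary (partial j f).
Proof.
move=> ef.
suff [g eg fg] : exists2 g, elementary g & forall x, is_derive x (delta_mx 0 j : E) f (g x).
  rewrite (_ : partial j f = g)//; apply/funext => x.
  by have [_ <-] := fg x.
elim: ef => [k|c p s a i c0|g h eg [dg edg gdg] eh [dh edh hdh]|g h eg [dg edg gdg] eh [dh edh hdh]].
- exists (fun=> 0); first exact: elementary_cst.
  by move=> x; exact: is_derive_cst.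
- exists (fun x => flat c ('X^2 * (c *: p - p^`())) (s * x 0 i + a) * (s * (i == j)%:R)).
    by apply: elementary_mul; [exact: elementary_flat|exact: elementary_cst].
  move=> x; apply: (@is_derive_comp1 _ _ (flat c p) (fun x : E => s * x 0 i + a)).
    exact: is_derive_flat.
  rewrite -[X in is_derive _ _ _ X]addr0; apply: is_deriveD.
  by apply: is_deriveZ; exact: is_derive_coord.
- exists (fun x => dg x + dh x); first exact: elementary_add.
  by move=> x; exact: is_deriveD.
- exists (fun x => g x * dh x + h x * dg x).
    by apply: elementary_add; exact: elementary_mul.
  by move=> x; exact: is_deriveM.
Qed.

Lemma elementary_smooth f : elementary f -> smooth f.
Proof.
move=> ef s x; apply: elementary_differentiable.
by elim: s => //= i s; exact: elementary_partial.
Qed.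

Lemma elementary_prod (I : Type) (r : seq I) (f : I -> E -> R) :
  (forall i, elementary (f i)) -> elementary (fun x => \prod_(i <- r) f i x).
Proof.
move=> ef; elim: r => [|i r IH].
  by rewrite (_ : (fun x => _) = fun=> 1); [exact: elementary_cst|apply/funext => x; rewrite big_nil].
rewrite (_ : (fun x => _) = fun x => f i x * \prod_(i <- r) f i x); first exact: elementary_mul.
by apply/funext => x; rewrite big_cons.
Qed.

Implicit Types (a b : E) (k : nat).

Definition obox a b : set E := [set x | forall i, a 0 i < x 0 i < b 0 i].
Definition cbox a b : set E := [set x | forall i, a 0 i <= x 0 i <= b 0 i].

(** As k grows, c = 1 / (k + 1) tends to 0 and every factor with positive argument tends to 1. The
    factors [1 *] and [-1 *] give the arguments the form required by [elementary_flat]. *)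
Definition bump a b k : E -> R := fun x =>
  \prod_(i < n) (flat k.+1%:R^-1 1 (1 * x 0 i - a 0 i) *
                 flat k.+1%:R^-1 1 (-1 * x 0 i + b 0 i)).

Lemma elementary_bump a b k : elementary (bump a b k).
Proof.
apply: elementary_prod => i; apply: elementary_mul; apply: elementary_flat; by rewrite invr_gt0.
Qed.

Lemma flat1_ge0_le1 (c t : R) : 0 < c -> 0 <= flat c 1 t <= 1.
Proof.
move=> c0; rewrite /flat; case: ltP => t0; last by rewrite lexx ler01.
by rewrite hornerC mul1r expR_ge0 expR_le1 oppr_le0 divr_ge0 ?ltW.
Qed.

Lemma bump_ge0_le1 a b k x : 0 <= bump a b k x <= 1.
Proof.
have c0 : 0 < k.+1%:R^-1 :> R by rewrite invr_gt0.
rewrite /bump prodr_ge0/=; last first.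
  move=> i _; have /andP[h1 _] := flat1_ge0_le1 (1 * x 0 i - a 0 i) c0.
  by have /andP[h2 _] := flat1_ge0_le1 (-1 * x 0 i + b 0 i) c0; exact: mulr_ge0.
apply: prodr_ile1 => i _.
have /andP[h1 h1'] := flat1_ge0_le1 (1 * x 0 i - a 0 i) c0.
have /andP[h2 h2'] := flat1_ge0_le1 (-1 * x 0 i + b 0 i) c0.
by rewrite mulr_ge0//= mulr_ile1.
Qed.

Lemma bump_eq0 a b k x : ~ obox a b x -> bump a b k x = 0.
Proof.
move=> /existsNP[i /negP]; rewrite negb_and -!leNgt => abx.
rewrite /bump (bigD1 i)//= /flat.
move: abx => /orP[ax|bx]; first by rewrite ifF ?mul0r//; apply/negbTE; rewrite -leNgt mul1r subr_le0.
rewrite [X in _ * X * _]ifF ?mulr0 ?mul0r//; apply/negbTE.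
by rewrite -leNgt mulN1r addrC subr_le0.
Qed.

Lemma cvg_bump a b x : bump a b k x @[k --> \oo] --> (\1_(obox a b) x : R).
Proof.
have [abx|abx] := pselect (obox a b x); last first.
  rewrite indicE memNset// (_ : (fun k => _) = fun=> 0); first exact: cvg_cst.
  by apply/funext => k; exact: bump_eq0.
rewrite indicE mem_set//= (_ : 1 = \prod_(i < n) ((1 : R) * 1)); last first.
  by rewrite big1// => i _; rewrite mulr1.
have fl (t : R) : 0 < t -> flat k.+1%:R^-1 1 t @[k --> \oo] --> (1 : R).
  move=> t0; rewrite /flat t0.
  rewrite (_ : (fun k => _) = fun k : nat => expR (- (k.+1%:R^-1 / t))); last first.
    by apply/funext => k; rewrite hornerC mul1r.
  rewrite -[X in _ --> X]expR0; apply: continuous_cvg; first exact: continuous_expR.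
  rewrite -[X in _ --> X]oppr0; apply: cvgN.
  rewrite -[X in _ --> X](mul0r t^-1); apply: cvgM; last exact: cvg_cst.
  exact: cvg_harmonic.
apply: (@cvg_big R 'I_n *%R 1 xpredT mul_continuous) => i _.
have /andP[h1 h2] := abx i.
apply: cvgM; apply: fl; rewrite ?mul1r ?mulN1r ?subr_gt0// addrC subr_gt0//.
Qed.

Lemma compact_cbox a b : compact (cbox a b).
Proof.
have -> : cbox a b = [set v : 'rV[R]_n | forall i, `[a 0 i, b 0 i]%classic (v ord0 i)].
  by apply/seteqP; split => x /= H i; have := H i; rewrite in_itv.
exact: (@rV_compact R n (fun i => `[a 0 i, b 0 i]%classic) (fun i => @segment_compact _ _ _)).
Qed.

Lemma test_function_bump (Om : set E) a b k : cbox a b `<=` Om -> test_function Om (bump a b k).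
Proof.
move=> abO; split; first exact/elementary_smooth/elementary_bump.
exists (cbox a b); split => //; first exact: compact_cbox.
move=> x abx; apply: bump_eq0; apply: contra_not abx => H i.
by have /andP[/ltW-> /ltW->] := H i.
Qed.

End elementary.

(** * Uniqueness of weak derivatives *)

Section rational_boxes.
Context {R : realType} {n : nat}.

Definition rat_lo (q : {ffun 'I_n -> rat * rat}) : 'rV[R]_n := \row_i ratr (q i).1.
Definition rat_hi (q : {ffun 'I_n -> rat * rat}) : 'rV[R]_n := \row_i ratr (q i).2.

Lemma measurable_obox (a b : 'rV[R]_n) : measurable (obox a b).
Proof.
have -> : obox a b = \bigcap_(j in [set: 'I_n]) [set x | a 0 j < x 0 j < b 0 j].
  by apply/seteqP; split => x /= Hx j; [move=> _; exact: Hx|exact: (Hx j)].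
apply: fin_bigcap_measurable => // j _.
have := measurable_coord j measurableT (measurable_itv `]a 0 j, b 0 j[).
by rewrite setTI; congr measurable; apply/seteqP; split => x /=; rewrite in_itv.
Qed.

Lemma obox_in_open (U : set 'rV[R]_n) x : open U -> U x ->
  exists2 q, obox (rat_lo q) (rat_hi q) x & cbox (rat_lo q) (rat_hi q) `<=` U.
Proof.
move=> oU Ux.
have /nbhs_ballP[e /= e0 Be] : nbhs x U by exact: open_nbhs_nbhs.
have lo (i : 'I_n) : {q : rat * rat | [/\ x 0 i - e / 2 < ratr q.1 < x 0 i &
   x 0 i < ratr q.2 < x 0 i + e / 2]}.
  have h1 : x 0 i - e / 2 < x 0 i by rewrite ltrBlDr ltrDl divr_gt0.
  have h2 : x 0 i < x 0 i + e / 2 by rewrite ltrDl divr_gt0.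
  have [q1] := cid (rat_in_itvoo h1); rewrite in_itv /= => hq1.
  have [q2] := cid (rat_in_itvoo h2); rewrite in_itv /= => hq2.
  by exists (q1, q2).
exists [ffun i => sval (lo i)].
  move=> i; rewrite !mxE !ffunE; case: (lo i) => -[a b] /=.
  by move=> [/andP[_ ->] /andP[-> _]].
move=> y Hy; apply: Be; split => // j i; rewrite ord1.
have := Hy i; rewrite !mxE !ffunE; case: (lo i) => -[a b] /=.
move=> [/andP[h1 h2] /andP[h3 h4]] /andP[h5 h6].
by rewrite /ball /= ltr_norml; apply/andP; split; lra.
Qed.

(** Boxes not inside [U] are replaced by the empty set, so that the index type remains the countable
    type of all rational boxes. *)
Definition inner_box (U : set 'rV[R]_n) q : set 'rV[R]_n :=
  if `[< cbox (rat_lo q) (rat_hi q) `<=` U >] then obox (rat_lo q) (rat_hi q) else set0.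

Lemma open_rational_boxes (U : set 'rV[R]_n) : open U -> U = \bigcup_q inner_box U q.
Proof.
move=> oU; apply/seteqP; split => [x /(obox_in_open oU)[q xq qU]|x [q _]].
  by exists q => //; rewrite /inner_box asboolT.
rewrite /inner_box; case: asboolP => // qU xq.
by apply: qU => i; have /andP[/ltW-> /ltW->] := xq i.
Qed.

Definition oboxes : set (set 'rV[R]_n) := [set obox a b | a in setT & b in setT].

(** An open set is a countable union of rational open boxes. With stability under intersection, this
    makes the open boxes a pi-system fit for a Dynkin argument. *)
Lemma measurable_oboxes : (@measurable _ 'rV[R]_n) = <<s oboxes >>.
Proof.
apply/seteqP; split; apply: smallest_sub => //.
- move=> U oU; rewrite (open_rational_boxes oU).
  apply: (@countable_bigcupT_measurable _ (g_sigma_algebraType oboxes)).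
    exact: countableP.
  move=> q; rewrite /inner_box; case: asboolP => // _; apply: sub_sigma_algebra.
  by exists (rat_lo q) => //; exists (rat_hi q).
- exact: smallest_sigma_algebra.
- move=> _ [a _ [b _ <-]]; exact: measurable_obox.
Qed.

Lemma oboxI (a b a' b' : 'rV[R]_n) : obox a b `&` obox a' b' =
  obox (\row_i Num.max (a 0 i) (a' 0 i)) (\row_i Num.min (b 0 i) (b' 0 i)).
Proof.
apply/seteqP; split => [x [h1 h2] i|x h].
  have /andP[p1 p2] := h1 i; have /andP[p3 p4] := h2 i.
  by rewrite !mxE gt_max lt_min p1 p2 p3 p4.
by split => i; have := h i; rewrite !mxE gt_max lt_min => /andP[/andP[p1 p2] /andP[p3 p4]];
  apply/andP.
Qed.

Lemma oboxes_setI_closed : setI_closed oboxes.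
Proof.
by move=> _ _ [a _ [b _ <-]] [a' _ [b' _ <-]]; rewrite oboxI; eexists => //; eexists.
Qed.

End rational_boxes.

Section du_bois_reymond.
Context {R : realType} {n : nat}.
Local Notation E := 'rV[R]_n.
Variables (Om : set E) (g : E -> R).
Hypothesis oOm : open Om.
Hypothesis ig : (lebesgue_rV n).-integrable Om (EFin \o g).
Hypothesis g0 : forall phi, test_function Om phi -> inner Om g phi = 0.

Let mOm : measurable Om.
Proof. exact: sub_sigma_algebra. Qed.

Let obox_cbox (a b : E) : obox a b `<=` cbox a b.
Proof. by move=> x xab i; have /andP[/ltW-> /ltW->] := xab i. Qed.

(** The bumps of the box are test functions with values in [0, 1] that converge to its indicator, so
    dominated convergence with dominating function |g| passes to the limit in [g0]. *)
Lemma integral_obox_eq0 (a b : E) : cbox a b `<=` Om ->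
  (\int[lebesgue_rV n]_(x in obox a b) (g x)%:E = 0)%E.
Proof.
move=> abO; have mg := measurable_int _ ig.
have mgR : measurable_fun Om g by exact/measurable_EFinP.
have mb k : measurable_fun Om (bump a b k).
  apply: measurable_funTS; apply: continuous_measurable_rV => x.
  by apply: differentiable_continuous; apply: elementary_differentiable; exact: elementary_bump.
have mo := measurable_obox a b.
have i1 k : (lebesgue_rV n).-integrable Om (fun x => (g x * bump a b k x)%:E).
  apply: (@le_integrable _ _ _ (lebesgue_rV n) _ mOm _ (EFin \o g)) => //.
  - by apply/measurable_EFinP; exact: measurable_funM.
  - move=> x _ /=; rewrite lee_fin normrM; have /andP[h1 h2] := bump_ge0_le1 a b k x.
    by rewrite (ger0_norm h1) ler_piMr.
have mlim : measurable_fun Om (fun x => (g x * \1_(obox a b) x)%:E).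
  by apply/measurable_EFinP; apply: measurable_funM => //; exact: measurable_funTS.
have cvp : {ae lebesgue_rV n, forall x, Om x ->
    (fun k => (g x * bump a b k x)%:E) @ \oo --> (g x * \1_(obox a b) x)%:E}.
  apply: aeW => x _; apply: cvg_EFin; first exact: nearW.
  by apply: cvgM; [exact: cvg_cst|exact: cvg_bump].
have dom : {ae lebesgue_rV n, forall x k, Om x ->
    (`|(g x * bump a b k x)%:E| <= `|(g x)%:E|)%E}.
  apply: aeW => x k _; rewrite lee_fin normrM.
  by have /andP[h1 h2] := bump_ge0_le1 a b k x; rewrite (ger0_norm h1) ler_piMr.
have [_ _ cv] := dominated_convergence mOm (fun k => measurable_int _ (i1 k))
  mlim cvp (integrable_abse ig) dom.
have cv0 : (fun k => \int[lebesgue_rV n]_(x in Om) (g x * bump a b k x)%:E)%E @ \oo --> 0%E.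
  rewrite (_ : (fun k => _) = fun=> 0%E); first exact: cvg_cst.
  apply/funext => k; have := g0 (test_function_bump k abO).
  rewrite /inner /Rintegral => h; rewrite -[LHS]fineK ?h//.
  exact: integrable_fin_num.
have := cvg_unique _ cv cv0 => /(_ (@ereal_hausdorff R)) h0.
rewrite -[RHS]h0 [RHS](eq_integral ((fun x => (g x)%:E) \_ (obox a b))); last first.
  by move=> x _; rewrite patchE indicE; case: ifP; rewrite ?mulr1 ?mulr0.
rewrite -integral_mkcondr setIidr//.
exact: subset_trans (@obox_cbox a b) abO.
Qed.

(** The sets A with zero integral of g over A and the box form a Dynkin system; it contains the open
    boxes, since the intersection of two boxes is a box, hence all Borel sets. A function with zero
    integral over every Borel subset vanishes almost everywhere. *)
Lemma ae_eq0_obox (a b : E) : cbox a b `<=` Om ->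
  {ae lebesgue_rV n, forall x, obox a b x -> g x = 0}.
Proof.
move=> abO; have mo := measurable_obox a b.
have oO : obox a b `<=` Om := subset_trans (@obox_cbox a b) abO.
have igo : (lebesgue_rV n).-integrable (obox a b) (EFin \o g).
  exact: (integrableS mOm).
have igS A : measurable A -> (lebesgue_rV n).-integrable (A `&` obox a b) (EFin \o g).
  move=> mA; apply: (integrableS mo) => //; exact: measurableI.
pose P A := (\int[lebesgue_rV n]_(x in A `&` obox a b) (g x)%:E = 0)%E.
have PT : P setT by rewrite /P setTI integral_obox_eq0.
have PA : forall A, <<s oboxes >> A -> P A.
  apply: (@dynkin_induction _ E oboxes P measurable_oboxes oboxes_setI_closed PT).
  - move=> _ [a' _ [b' _ <-]]; rewrite /P oboxI; apply: integral_obox_eq0.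
    apply: subset_trans abO => x xab i; have := xab i; rewrite !mxE ge_max le_min.
    by move=> /andP[/andP[_ p1] /andP[_ p2]]; apply/andP.
  - move=> S mS PS; have := PT.
    rewrite /P -{1}(setUv S) setIUl integral_setU//; last 4 first.
    + exact: measurableI.
    + by apply: measurableI => //; exact: measurableC.
    + by rewrite -setIUl setUv setTI; exact: measurable_int igo.
    + by apply/disj_setPS; rewrite setIACA setICr set0I.
    by rewrite PS add0e.
  - move=> F mF tF PF; rewrite /P setI_bigcupl integral_bigcup.
    + by apply: eseries0 => k _ _; exact: PF.
    + exact: trivIset_setIr.
    + by move=> k; apply: measurableI.
    + by rewrite -setI_bigcupl; apply: igS; exact: bigcupT_measurable.
have [N [mN N0 subN]] : ae_eq (lebesgue_rV n) (obox a b) (EFin \o g) (cst 0%E).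
  apply: integral_ae_eq => // A Ao mA.
  rewrite integral0; have := PA A; rewrite -measurable_oboxes => /(_ mA).
  by rewrite /P setIidl.
exists N; split => // x /= nx; apply: subN => /= h; apply: nx => xo.
by have [] := h xo.
Qed.

Lemma test_functions_ae_eq0 : {ae lebesgue_rV n, forall x, Om x -> g x = 0}.
Proof.
pose J : countType := {ffun 'I_n -> rat * rat}.
(* Enumerating the boxes by naturals presents the conclusion as a countable family of almost sure
   statements; numbers coding no box give the empty set. *)
pose B k : set E := if (unpickle k : option J) is Some q then inner_box Om q else set0.
have H k : {ae lebesgue_rV n, forall x, B k x -> g x = 0}.
  rewrite /B; case: (unpickle k) => [q|]; last exact: aeW.
  by rewrite /inner_box; case: asboolP => [qO|_]; [exact: ae_eq0_obox|exact: aeW].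
have : {ae lebesgue_rV n, forall x k, B k x -> g x = 0}.
  exact: ae_foralln.
apply: filterS => x Hx Ox; have [q xq qO] := obox_in_open oOm Ox.
by apply: (Hx (pickle (q : J))); rewrite /B pickleK /inner_box asboolT.
Qed.

End du_bois_reymond.

(** * Square-integrable functions and weak derivatives of C^1 functions *)

Section square_integrable.
Context d (T : measurableType d) (R : realType).
Variables (mu : {measure set T -> \bar R}) (D : set T).
Hypothesis mD : measurable D.

Lemma Lnorm2_restrict (u : T -> R) :
  ('N[mu]_(2%:E)[EFin \o (u \_ D)] = (\int[mu]_(x in D) (u x ^+ 2)%:E) `^ 2^-1)%E.
Proof.
rewrite unlock /= [in RHS]integral_mkcond; congr (_ `^ _)%E.
apply: eq_integral => x _; rewrite /= !patchE; case: ifP => _.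
  by rewrite powR_mulrn// real_normK ?num_real.
by rewrite normr0 powR0.
Qed.

Lemma integral_sqr_Lnorm2 (u : T -> R) :
  ('N[mu]_(2%:E)[EFin \o (u \_ D)] < +oo)%E ->
  (\int[mu]_(x in D) (u x ^+ 2)%:E = ((fine 'N[mu]_(2%:E)[EFin \o (u \_ D)]) ^+ 2)%:E)%E.
Proof.
rewrite Lnorm2_restrict.
have : (0 <= \int[mu]_(x in D) (u x ^+ 2)%:E)%E.
  by apply: integral_ge0 => x _; rewrite lee_fin sqr_ge0.
case: (\int[mu]_(x in D) _)%E => [r| |]//; rewrite ?lee_fin => r0.
  move=> _; rewrite poweR_EFin /= -powR_mulrn ?powR_ge0// -powRrM mulVf// powRr1//.
by rewrite poweRyr// invr_neq0.
Qed.

Lemma Lnorm2_lty (u : T -> R) : (\int[mu]_(x in D) (u x ^+ 2)%:E < +oo)%E ->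
  ('N[mu]_(2%:E)[EFin \o (u \_ D)] < +oo)%E.
Proof. by move=> h; rewrite Lnorm2_restrict; exact: poweR_lty. Qed.

Lemma square_integrable_integrable (u : T -> R) :
  (mu D < +oo)%E -> measurable_fun D u ->
  (\int[mu]_(x in D) (u x ^+ 2)%:E < +oo)%E -> mu.-integrable D (EFin \o u).
Proof.
move=> muD mu_ u2.
have i1 : mu.-integrable D (EFin \o cst 1).
  apply/integrableP; split; first exact/measurable_EFinP.
  under eq_integral do rewrite /= normr1.
  by rewrite integral_cst// mul1e.
have i2 : mu.-integrable D (EFin \o (fun x => u x ^+ 2)).
  apply/integrableP; split; first by apply/measurable_EFinP; exact: measurable_funX.
  by under eq_integral do rewrite /= ger0_norm ?sqr_ge0//.
apply: (@le_integrable _ _ _ mu _ mD _ (fun x => (1 + u x ^+ 2)%:E)) => //.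
- exact/measurable_EFinP.
- move=> x _ /=; rewrite lee_fin [leRHS]ger0_norm ?addr_ge0 ?sqr_ge0//.
  rewrite -[u x ^+ 2]real_normK ?num_real//.
  have := sqr_ge0 (`|u x| - 1); have := normr_ge0 (u x); nra.
- exact: (@integrableD _ _ _ mu D mD (EFin \o cst 1) (EFin \o (fun x => u x ^+ 2))).
Qed.

End square_integrable.

Section weak_derivative.
Context {R : realType} {d : nat}.
Local Notation E := 'rV[R]_d.
Variable Om : set E.
Hypothesis oOm : open Om.
Hypothesis Om_cube : Om `<=` cube d 1.

Let mOm : measurable Om.
Proof. exact: sub_sigma_algebra. Qed.

Lemma lebesgue_open_lty : (lebesgue_rV d Om < +oo)%E.
Proof.
apply: le_lt_trans (lebesgue_cube_lty d 1).
by apply: le_measure; rewrite ?inE//; exact: measurable_cube.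
Qed.

Lemma L2_integrable (g : E -> R) : L2 Om g -> (lebesgue_rV d).-integrable Om (EFin \o g).
Proof.
move=> [mg g2]; apply: square_integrable_integrable => //; first exact: lebesgue_open_lty.
by rewrite integral_sqr_Lnorm2// ltry.
Qed.

Lemma bounded_L2 (g : E -> R) (C : R) : measurable_fun Om g -> (forall x, Om x -> `|g x| <= C) -> L2 Om g.
Proof.
move=> mg gC; split => //; apply: Lnorm2_lty.
apply: (@le_lt_trans _ _ (\int[lebesgue_rV d]_(x in Om) (C ^+ 2)%:E)%E).
  apply: ge0_le_integral => //.
  - by move=> x _; rewrite lee_fin sqr_ge0.
  - by apply/measurable_EFinP; exact: measurable_funX.
  - move=> x Ox; rewrite lee_fin -[g x ^+ 2]real_normK ?num_real//.
    by rewrite lerXn2r ?nnegrE// ?gC// (le_trans _ (gC _ Ox)).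
by rewrite integral_cst// lte_mul_pinfty ?lee_fin ?sqr_ge0//; exact: lebesgue_open_lty.
Qed.

Section test.
Variables (phi : E -> R) (i : 'I_d).
Hypothesis tphi : test_function Om phi.

Lemma test_function_continuous : continuous phi.
Proof. by move=> x; apply: differentiable_continuous; exact: (tphi.1 [::]). Qed.

Lemma test_function_partial_continuous : continuous (partial i phi).
Proof. by move=> x; apply: differentiable_continuous; exact: (tphi.1 [:: i]). Qed.

Lemma test_function_derivable x : derivable phi x (delta_mx 0 i).
Proof. by apply: diff_derivable; exact: (tphi.1 [::]). Qed.

Lemma test_function_eq0 x : ~ Om x -> phi x = 0.
Proof. by have [_ [K [_ KO K0]]] := tphi; move=> xO; apply: K0 => /KO. Qed.

Lemma partial_eq0_outside (K : set E) x : compact K -> (forall y, ~ K y -> phi y = 0) ->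
  ~ K x -> partial i phi x = 0.
Proof.
move=> cK K0 xK.
have oK : open (~` K) by apply: closed_openC; apply: compact_closed => //; exact: norm_hausdorff.
have /nbhs_ballP[e /= e0 eK] : nbhs x (~` K) by apply: open_nbhs_nbhs.
have near0 : \near x, phi x = cst (0 : R) x.
  by apply/nbhs_ballP; exists e => // y /eK /K0.
by rewrite /partial (near_eq_derive _ near0) derive_cst.
Qed.

Lemma test_function_partial_eq0 x : ~ Om x -> partial i phi x = 0.
Proof.
have [_ [K [cK KO K0]]] := tphi; move=> xO.
by apply: (partial_eq0_outside cK K0) => /KO.
Qed.

(** Meant for products of a continuous, possibly unbounded function with [phi] or its partial
    derivative: they vanish off the compact support and are bounded on it. *)
Lemma compact_support_bounded (f : E -> R) : continuous f ->
  (forall x, phi x = 0 -> partial i phi x = 0 -> f x = 0) ->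
  exists C, forall x, `|f x| <= C.
Proof.
move=> cf f0; have [_ [K [cK KO K0]]] := tphi.
have K1 : forall x, ~ K x -> f x = 0.
  by move=> x xK; apply: f0; [exact: K0|exact: partial_eq0_outside xK].
have cfK : compact (f @` K) by apply: continuous_compact => //; exact: continuous_subspaceT.
have [M [_ HM]] := compact_bounded cfK.
exists (`|M| + 1) => x; have [xK|xK] := pselect (K x).
  by apply: (HM (`|M| + 1)); [rewrite (le_lt_trans (ler_norm M))// ltrDl|exists x].
by rewrite K1// normr0 addr_ge0.
Qed.

End test.

(** The product of u and phi is C^1 on the whole space and vanishes outside the cube, so the
    integral of its partial derivative is 0. Both terms of the product rule vanish off [Om], hence
    the integrals over [Om] are integrals over the whole space. *)
Lemma is_weak_partial_classical (u : E -> R) (i : 'I_d) :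
  (forall x, derivable u x (delta_mx 0 i)) -> continuous u -> continuous (partial i u) ->
  L2 Om (partial i u) -> is_weak_partial Om i u (partial i u).
Proof.
move=> du cu cpu L2u; split => // phi tphi.
have cphi := test_function_continuous tphi.
have cpphi : continuous (partial i phi) := test_function_partial_continuous tphi.
have dphi x : derivable phi x (delta_mx 0 i) by exact: test_function_derivable.
pose w x := u x * phi x.
have dw x : derivable w x (delta_mx 0 i).
  exact: (derivableM (du x) (dphi x)).
have pw x : partial i w x = u x * partial i phi x + partial i u x * phi x.
  rewrite /partial (deriveM (du x) (dphi x)).
  by rewrite [phi x *: _]mulrC.
have c1 : continuous (fun x => u x * partial i phi x).
  by move=> x; apply: continuousM; [exact: cu|exact: cpphi].
have c2 : continuous (fun x => partial i u x * phi x).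
  by move=> x; apply: continuousM; [exact: cpu|exact: cphi].
have cw : continuous (partial i w).
  by rewrite (funext pw) => x; exact: (cvgD (c1 x) (c2 x)).
have [C1 HC1] := compact_support_bounded (i := i) tphi c1 (fun x _ h => etrans (congr1 _ h) (mulr0 _)).
have [C2 HC2] := compact_support_bounded (i := i) tphi c2 (fun x h _ => etrans (congr1 _ h) (mulr0 _)).
have out x : ~ cube d 1 x -> ~ Om x by move=> xc /Om_cube.
have z1 x : ~ Om x -> u x * partial i phi x = 0.
  by move=> xO; rewrite (@test_function_partial_eq0 phi i tphi x xO) mulr0.
have z2 x : ~ Om x -> partial i u x * phi x = 0.
  by move=> xO; rewrite (test_function_eq0 tphi xO) mulr0.
have Cw x : `|partial i w x| <= C1 + C2.
  by rewrite pw (le_trans (ler_normD _ _))// lerD.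
have int0 : (\int[lebesgue_rV d]_x (partial i w x)%:E = 0)%E.
  apply: (integral_partial_eq0 (M := 1) dw cw Cw).
  - by move=> x /out xO; rewrite /w (test_function_eq0 tphi xO) mulr0.
  - by move=> x /out xO; rewrite pw z1// z2// addr0.
have i1 : (lebesgue_rV d).-integrable setT (EFin \o (fun x => u x * partial i phi x)).
  by apply: bounded_support_integrable HC1 (fun x xc => z1 x (out x xc)); exact: continuous_measurable_rV.
have i2 : (lebesgue_rV d).-integrable setT (EFin \o (fun x => partial i u x * phi x)).
  by apply: bounded_support_integrable HC2 (fun x xc => z2 x (out x xc)); exact: continuous_measurable_rV.
have restr (f : E -> R) : (forall x, ~ Om x -> f x = 0) ->
    \int[lebesgue_rV d]_(x in Om) f x = \int[lebesgue_rV d]_x f x.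
  move=> f0; rewrite Rintegral_mkcond; congr Rintegral; apply/funext => x.
  by rewrite patchE; case: ifPn => //; rewrite notin_setE => /f0.
apply/eqP; rewrite -addr_eq0 /inner !restr//.
rewrite -RintegralD//.
by under eq_Rintegral do rewrite -pw; rewrite /Rintegral int0.
Qed.

(** The classical derivative is a weak one, so [xget] does return a weak derivative. Its difference
    with the classical one has zero integral against every test function, hence vanishes almost
    everywhere. *)
Lemma weak_partial_classical (u : E -> R) (i : 'I_d) :
  (forall x, derivable u x (delta_mx 0 i)) -> continuous u -> continuous (partial i u) ->
  L2 Om (partial i u) ->
  L2 Om (weak_partial Om i u) /\
  {ae lebesgue_rV d, forall x, Om x -> weak_partial Om i u x = partial i u x}.
Proof.
move=> du cu cpu L2u.
have [wL2 wp] : is_weak_partial Om i u (weak_partial Om i u).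
  by apply: xgetPex; exists (partial i u); exact: is_weak_partial_classical.
have [_ pp] := is_weak_partial_classical du cu cpu L2u.
split => //.
have iw := L2_integrable wL2; have ip := L2_integrable L2u.
pose g x := weak_partial Om i u x - partial i u x.
have ig : (lebesgue_rV d).-integrable Om (EFin \o g).
  exact: (@integrableB _ _ _ _ Om mOm (EFin \o weak_partial Om i u) (EFin \o partial i u)).
have g0 phi : test_function Om phi -> inner Om g phi = 0.
  move=> tphi.
  have [C HC] := compact_support_bounded (i := i) tphi (test_function_continuous tphi) (fun x h _ => h).
  have mphi : measurable_fun Om phi.
    by apply: measurable_funTS; apply: continuous_measurable_rV; exact: test_function_continuous.
  have im (f : E -> R) : (lebesgue_rV d).-integrable Om (EFin \o f) ->
      (lebesgue_rV d).-integrable Om (EFin \o (fun x => f x * phi x)).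
    move=> jf; have mf : measurable_fun Om f by apply/measurable_EFinP; exact: measurable_int jf.
    apply: (@le_integrable _ _ _ _ _ mOm _ (fun x => (C%:E * (EFin \o f) x)%E)).
    - by apply/measurable_EFinP; exact: measurable_funM.
    - move=> x _ /=; rewrite lee_fin !normrM mulrC ler_wpM2r//.
      by rewrite (le_trans (HC x))// ler_norm.
    - exact: integrableZl.
  rewrite /inner /g; under eq_Rintegral do rewrite mulrBl.
  rewrite RintegralB//; [|exact: im..].
  by have := wp phi tphi; have := pp phi tphi; rewrite /inner; lra.
have := test_functions_ae_eq0 oOm ig g0.
apply: filterS => x gx Ox; apply/eqP; rewrite -subr_eq0; apply/eqP; exact: gx.
Qed.

End weak_derivative.

(** * Neural networks *)

Section networks.
Context {R : realType} (d : nat) (n : nat -> nat) (m : nat).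
Variables (pos : 'I_m -> weight_slot d n) (rho : R -> R).
Local Notation E := 'rV[R]_d.
Local Notation W := (width d n).
Implicit Types (theta : 'rV[R]_m) (x : E).

Definition slot l (i : 'I_(W l.+1)) (o : option 'I_(W l)) : weight_slot d n :=
  existT _ l (i, o).

Lemma slot_inj l (i : 'I_(W l.+1)) : injective (slot i).
Proof.
move=> o o' /eqP; rewrite /slot.
by rewrite eq_Tagged /= xpair_eqE eqxx => /eqP.
Qed.

(** Each parameter sits in one slot and so counts at most once in the row: the bound involves the
    number m of parameters and not the width of the layer. *)
Lemma sum_row_weights theta l (i : 'I_(W l.+1)) (t : R) :
  (forall k, `|theta 0 k| <= t) ->
  \sum_j `|weight pos theta (slot i (Some j))| + `|weight pos theta (slot i None)|
    <= m%:R * t.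
Proof.
move=> thetat.
pose f o := \sum_(k < m | pos k == slot i o) `|theta 0 k|.
have wf o : `|weight pos theta (slot i o)| <= f o by exact: ler_norm_sum.
apply: (@le_trans _ _ (\sum_j f (Some j) + f None)).
  by apply: lerD => //; exact: ler_sum.
have -> : \sum_j f (Some j) + f None =
    \sum_(k < m) `|theta 0 k| * ((\sum_j (pos k == slot i (Some j))) + (pos k == slot i None))%:R.
  have fE o : f o = \sum_(k < m) `|theta 0 k| * (pos k == slot i o)%:R.
    rewrite /f big_mkcond; apply: eq_bigr => k _.
    by case: ifP; rewrite ?mulr1 ?mulr0.
  rewrite fE (eq_bigr _ (fun j _ => fE (Some j))) exchange_big /= -big_split /=.
  by apply: eq_bigr => k _; rewrite -mulr_sumr -mulrDr natrD natr_sum.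
apply: (@le_trans _ _ (\sum_(k < m) t)); last by rewrite sumr_const card_ord mulr_natl.
apply: ler_sum => k _; apply: le_trans (thetat k).
rewrite ler_piMr// -[X in _ <= X]/(1%:R) ler_nat.
have [kN|kN] := eqVneq (pos k) (slot i None).
  rewrite big1// => j _; rewrite kN; apply/eqP; rewrite eqb0.
  by apply/eqP => /slot_inj.
rewrite addn0; have [j0 /eqP kj|nj] := pickP (fun j => pos k == slot i (Some j)).
  rewrite (bigD1 j0)//= kj eqxx big1// => j jj0.
  by apply/eqP; rewrite eqb0; apply: contra_neq jj0 => /slot_inj[].
by rewrite big1// => j _; rewrite nj.
Qed.

Lemma weightB theta theta' s :
  weight pos theta s - weight pos theta' s = weight pos (theta - theta') s.
Proof. by rewrite /weight -sumrB; apply: eq_bigr => k _; rewrite !mxE. Qed.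

(** The factor [y0] of the bias is 1 for the network, 0 for its derivative, and the difference of
    two such values in Lipschitz estimates, so that one bound on affine maps serves all three. *)
Definition affine theta l (i : 'I_(W l.+1)) (y : 'I_(W l) -> R) (y0 : R) : R :=
  \sum_j weight pos theta (slot i (Some j)) * y j + weight pos theta (slot i None) * y0.

Lemma affine_bound theta l (i : 'I_(W l.+1)) y y0 (t c : R) :
  (forall k, `|theta 0 k| <= t) -> (forall j, `|y j| <= c) -> `|y0| <= c ->
  `|affine theta i y y0| <= m%:R * t * c.
Proof.
move=> tt yc y0c; have c0 : 0 <= c by rewrite (le_trans _ y0c).
apply: (@le_trans _ _ ((\sum_j `|weight pos theta (slot i (Some j))| +
    `|weight pos theta (slot i None)|) * c)); last first.
  by apply: ler_wpM2r => //; exact: sum_row_weights.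
rewrite mulrDl mulr_suml (le_trans (ler_normD _ _))// normrM lerD ?ler_wpM2l//.
rewrite (le_trans (ler_norm_sum _ _ _))// ler_sum// => j _.
by rewrite normrM ler_wpM2l.
Qed.

(** Change of weights at fixed input, plus change of input at fixed weights. *)
Lemma affineB theta theta' l (i : 'I_(W l.+1)) y y' y0 y0' :
  affine theta i y y0 - affine theta' i y' y0' =
  affine (theta - theta') i y y0 + affine theta' i (fun j => y j - y' j) (y0 - y0').
Proof.
rewrite /affine.
under [X in _ = X + _ + _]eq_bigr do rewrite -weightB mulrBl.
under [X in _ = _ + (X + _)]eq_bigr do rewrite mulrBr.
by rewrite -weightB !sumrB; ring.
Qed.

Definition preactivation theta x l (i : 'I_(W l.+1)) : R :=
  affine theta i (fun j => layer pos theta rho x l j 0) 1.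

Lemma preactivationE theta x l (i : 'I_(W l.+1)) :
  (weight_mx pos theta l *m layer pos theta rho x l + bias pos theta l) i 0 =
  preactivation theta x i.
Proof.
rewrite !mxE /preactivation /affine mulr1; congr (_ + _).
by apply: eq_bigr => j _; rewrite !mxE.
Qed.

Lemma layerS theta x l (i : 'I_(W l.+1)) :
  layer pos theta rho x l.+1 i 0 = rho (preactivation theta x i).
Proof. by rewrite /= mxE preactivationE. Qed.

(** The partial derivative of [layer] in the coordinate [e], computed forward by the chain rule; the
    bias is constant, hence the last argument 0 of [affine]. *)
Fixpoint dlayer theta x (e : 'I_d) (l : nat) : 'I_(W l) -> R :=
  match l return 'I_(W l) -> R with
  | 0 => fun j => (j == e)%:R
  | k.+1 => fun i => derive1 rho (preactivation theta x i) *
                     affine theta i (dlayer theta x e (l := k)) 0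
  end.

Definition dpreactivation theta x e l (i : 'I_(W l.+1)) : R :=
  affine theta i (@dlayer theta x e l) 0.

Hypothesis drho : forall t, derivable rho t 1.

Lemma is_derive_affine theta l (i : 'I_(W l.+1)) (y : 'I_(W l) -> E -> R)
    (dy : 'I_(W l) -> R) y0 x v :
  (forall j, is_derive x v (y j) (dy j)) ->
  is_derive x v (fun x => affine theta i (y ^~ x) y0) (affine theta i dy 0).
Proof.
move=> dyj; rewrite /affine mulr0; apply: is_deriveD.
rewrite (_ : (fun x => _) = \sum_j (weight pos theta (slot i (Some j)) *: y j)).
  by apply: is_derive_sum => j; exact: is_deriveZ.
by apply/funext => z; rewrite fct_sumE.
Qed.

Lemma is_derive_layer theta x e l (j : 'I_(W l)) :
  is_derive x (delta_mx 0 e : E) (fun x => layer pos theta rho x l j 0) (dlayer theta x e j).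
Proof.
elim: l j => [j|l IH i] /=.
  under eq_fun do rewrite mxE.
  exact: is_derive_coord.
under eq_fun do rewrite mxE preactivationE.
apply: (@is_derive_comp1 _ _ rho (fun x => preactivation theta x i)).
  by rewrite derive1E; apply: derivableP; exact: drho.
by apply: is_derive_affine.
Qed.

Lemma continuous_affine theta l (i : 'I_(W l.+1)) (y : 'I_(W l) -> E -> R) y0 :
  (forall j, continuous (y j)) -> continuous (fun x => affine theta i (y ^~ x) y0).
Proof.
move=> cy x; have cs : {for x, continuous (fun x =>
    \sum_j weight pos theta (slot i (Some j)) * y j x)}.
  apply: (@continuous_big R 'I_(W l) +%R 0 xpredT add_continuous) => j _ z.
  exact: (continuousM (cvg_cst _) (cy j z)).
exact: (cvgD cs (cvg_cst _)).
Qed.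

Lemma continuous_layer theta l (j : 'I_(W l)) :
  continuous (fun x => layer pos theta rho x l j 0).
Proof.
elim: l j => [j|l IH i] /=.
  under eq_fun do rewrite mxE.
  exact: coord_continuous.
under eq_fun do rewrite mxE preactivationE.
move=> x; apply: (@continuous_comp _ _ _ (fun x => preactivation theta x i) rho).
  exact: continuous_affine.
by apply: differentiable_continuous; exact/derivable1_diffP.
Qed.

Lemma continuous_preactivation theta l (i : 'I_(W l.+1)) :
  continuous (fun x => preactivation theta x i).
Proof. by apply: continuous_affine => j; exact: continuous_layer. Qed.

Hypothesis crho' : continuous (derive1 rho).

Lemma continuous_dlayer theta e l (j : 'I_(W l)) :
  continuous (fun x => dlayer theta x e j).
Proof.
elim: l j => [j|l IH i] /=; first exact: cst_continuous.
move=> x; apply: (@continuousM _ _ (fun x => derive1 rho (preactivation theta x i))).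
  apply: (@continuous_comp _ _ _ (fun x => preactivation theta x i)).
    exact: continuous_preactivation.
  exact: crho'.
by apply: continuous_affine => j; exact: IH.
Qed.

Hypothesis rho1 : forall t, `|rho t| <= 1.
Hypothesis rho'1 : forall t, `|derive1 rho t| <= 1.
Hypothesis Lrho : forall s t, `|rho s - rho t| <= `|s - t|.
Hypothesis Lrho' : forall s t, `|derive1 rho s - derive1 rho t| <= `|s - t|.

Variable B : R.
Hypothesis B1 : 1 <= B.
Hypothesis m0 : (0 < m)%N.
Local Notation K := (m%:R * B).

Let mR1 : 1 <= m%:R :> R. Proof. by rewrite ler1n. Qed.
Let mK : m%:R <= K. Proof. by rewrite ler_peMr. Qed.
Let K1 : 1 <= K. Proof. exact: le_trans mR1 mK. Qed.

Lemma layer_bound theta x l (j : 'I_(W l)) : (forall k, `|x 0 k| <= 1) ->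
  `|layer pos theta rho x l j 0| <= 1.
Proof. by case: l j => [|l] j x1; rewrite /= mxE. Qed.

Lemma preactivation_bound theta x l (i : 'I_(W l.+1)) : (forall k, `|x 0 k| <= 1) ->
  (forall k, `|theta 0 k| <= B) -> `|preactivation theta x i| <= K.
Proof.
move=> x1 tB; rewrite -[leRHS]mulr1; apply: affine_bound => //.
  by move=> j; exact: layer_bound.
by rewrite normr1.
Qed.

Lemma dlayer_bound theta x e l (j : 'I_(W l)) :
  (forall k, `|theta 0 k| <= B) -> `|dlayer theta x e j| <= K ^+ l.
Proof.
move=> tB; have K0 : 0 <= K := le_trans ler01 K1.
elim: l j => [j|l IH i] /=; first by rewrite expr0 ger0_norm ?lern1 ?leq_b1.
rewrite normrM -[leRHS]mul1r ler_pM// exprS; apply: affine_bound => //.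
by rewrite normr0 exprn_ge0.
Qed.

Lemma dpreactivation_bound theta x e l (i : 'I_(W l.+1)) :
  (forall k, `|theta 0 k| <= B) -> `|dpreactivation theta x e i| <= K ^+ l.+1.
Proof.
move=> tB; rewrite exprS; apply: affine_bound => //.
  by move=> j; exact: dlayer_bound.
by rewrite normr0 exprn_ge0// (le_trans ler01 K1).
Qed.

Section lipschitz.
Variables (theta theta' : 'rV[R]_m) (x : E) (eps : R).
Hypothesis x1 : forall k, `|x 0 k| <= 1.
Hypothesis tB : forall k, `|theta 0 k| <= B.
Hypothesis tB' : forall k, `|theta' 0 k| <= B.
Hypothesis tt : forall k, `|theta 0 k - theta' 0 k| <= eps.

Let eps0 : 0 <= eps. Proof. by rewrite (le_trans _ (tt (Ordinal m0))). Qed.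
Let K0 : 0 <= K. Proof. exact: le_trans ler01 K1. Qed.
Let ttB k : `|(theta - theta') 0 k| <= eps. Proof. by rewrite !mxE. Qed.
Let Ke1 k : 1 <= K ^+ k. Proof. exact: exprn_ege1. Qed.

Lemma preactivation_lip l (i : 'I_(W l.+1)) c :
  0 <= c ->
  (forall j, `|layer pos theta rho x l j 0 - layer pos theta' rho x l j 0| <= c) ->
  `|preactivation theta x i - preactivation theta' x i| <= K * (eps + c).
Proof.
move=> c0 Hc; rewrite /preactivation affineB (le_trans (ler_normD _ _))// mulrDr lerD//.
  apply: (@le_trans _ _ (m%:R * eps * 1)).
    by apply: affine_bound => //; [move=> j; exact: layer_bound|rewrite normr1].
  by rewrite mulr1 ler_wpM2r.
by apply: affine_bound => //; rewrite subrr normr0.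
Qed.

Let arith1 l : K * (eps + l%:R * K ^+ l * eps) <= l.+1%:R * K ^+ l.+1 * eps.
Proof.
rewrite (_ : K * _ = K * eps + l%:R * (K * K ^+ l) * eps); last by ring.
rewrite -exprS -natr1 (_ : (l%:R + 1) * K ^+ l.+1 * eps = K ^+ l.+1 * eps + l%:R * K ^+ l.+1 * eps); last by ring.
by rewrite lerD2r ler_wpM2r// exprS ler_peMr.
Qed.

(** If c bounds the difference at layer l, then K (eps + c) bounds it at layer l + 1, with eps from
    the weights and c from the input. As K >= 1, the recursion stays below l K^l eps. *)
Lemma layer_lip l (j : 'I_(W l)) :
  `|layer pos theta rho x l j 0 - layer pos theta' rho x l j 0| <= l%:R * K ^+ l * eps.
Proof.
elim: l j => [j|l IH i]; first by rewrite /= mxE subrr normr0 !mul0r.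
rewrite !layerS (le_trans (Lrho _ _))//.
have c0 : 0 <= l%:R * K ^+ l * eps by rewrite !mulr_ge0// exprn_ge0.
apply: (le_trans (preactivation_lip _ c0 IH)).
exact: arith1.
Qed.

Lemma preactivation_lipschitz l (i : 'I_(W l.+1)) :
  `|preactivation theta x i - preactivation theta' x i| <= l.+1%:R * K ^+ l.+1 * eps.
Proof.
have c0 : 0 <= l%:R * K ^+ l * eps by rewrite !mulr_ge0// exprn_ge0.
apply: (le_trans (preactivation_lip _ c0 (@layer_lip l))).
exact: arith1.
Qed.

Lemma dpreactivation_lip e l (i : 'I_(W l.+1)) c :
  0 <= c -> (forall j : 'I_(W l), `|dlayer theta x e j - dlayer theta' x e j| <= c) ->
  `|dpreactivation theta x e i - dpreactivation theta' x e i| <= K ^+ l.+1 * eps + K * c.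
Proof.
move=> c0 Hc; rewrite /dpreactivation affineB (le_trans (ler_normD _ _))// lerD//.
  apply: (@le_trans _ _ (m%:R * eps * K ^+ l)).
    apply: affine_bound => //; first by move=> j; exact: dlayer_bound.
    by rewrite normr0 exprn_ge0.
  by rewrite exprS mulrAC ler_wpM2r// ler_wpM2r// exprn_ge0.
by apply: affine_bound => //; rewrite subrr normr0.
Qed.

(** After bounding lower powers of K by K^(2 l + 2), this is 1 + 2 l^2 + (l + 1) <= 2 (l + 1)^2. *)
Let arith l : K ^+ l.+1 * eps + K * (2 * l%:R ^+ 2 * K ^+ (2 * l) * eps) +
    l.+1%:R * K ^+ l.+1 * eps * K ^+ l.+1 <= 2 * l.+1%:R ^+ 2 * K ^+ (2 * l.+1) * eps.
Proof.
have kk : K ^+ (2 * l.+1) = K ^+ l.+1 * K ^+ l.+1 by rewrite -exprD addnn mul2n.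
have kl : K ^+ (2 * l) = K ^+ l * K ^+ l by rewrite -exprD addnn mul2n.
rewrite kk kl; set a := K ^+ l.+1; have aE : a = K * K ^+ l by rewrite /a exprS.
have a1 : 1 <= a by exact: Ke1.
have l0 : 0 <= l%:R :> R by [].
have h1 : a * eps <= a * a * eps.
  by rewrite ler_wpM2r// ler_peMr// (le_trans ler01).
have h2 : K * (2 * l%:R ^+ 2 * (K ^+ l * K ^+ l) * eps) <= 2 * l%:R ^+ 2 * (a * a * eps).
  rewrite (_ : K * _ = 2 * l%:R ^+ 2 * (a * K ^+ l * eps)); last by rewrite aE; ring.
  rewrite ler_wpM2l ?mulr_ge0 ?sqr_ge0// ler_wpM2r// ler_wpM2l ?(le_trans ler01)//.
  by rewrite aE ler_peMl ?exprn_ge0.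
have ae : 0 <= a * a * eps by rewrite !mulr_ge0// (le_trans ler01).
rewrite -natr1; nra.
Qed.

(** In the product rule, the change of rho', of order l K^l eps, multiplies a derivative of size
    K^l: this is the source of K^(2 l), and the sum over the layers makes l^2. *)
Lemma dlayer_lip e l (j : 'I_(W l)) :
  `|dlayer theta x e j - dlayer theta' x e j| <= 2 * l%:R ^+ 2 * K ^+ (2 * l) * eps.
Proof.
elim: l j => [j|l IH i]; first by rewrite /= subrr normr0 !mulr_ge0.
rewrite /= -/(dpreactivation theta x e i) -/(dpreactivation theta' x e i).
have c0 : 0 <= 2 * l%:R ^+ 2 * K ^+ (2 * l) * eps.
  by rewrite !mulr_ge0 ?sqr_ge0 ?exprn_ge0.
have h1 := dpreactivation_lip i c0 IH.
have h2 := le_trans (Lrho' _ _) (preactivation_lipschitz i).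
have h3 := dpreactivation_bound x e i tB.
set s := derive1 rho _ in h2 *; set s' := derive1 rho _ in h2 *.
set a := dpreactivation _ _ _ _ in h1 h3 *; set a' := dpreactivation _ _ _ _ in h1 *.
rewrite (_ : s * a - s' * a' = s' * (a - a') + (s - s') * a); last by ring.
apply: le_trans (arith l); rewrite (le_trans (ler_normD _ _))// !normrM lerD//.
  by rewrite -[leRHS]mul1r; apply: ler_pM => //; exact: rho'1.
by apply: ler_pM.
Qed.

Lemma dpreactivation_lipschitz e l (i : 'I_(W l.+1)) :
  `|dpreactivation theta x e i - dpreactivation theta' x e i| <=
    2 * l.+1%:R ^+ 2 * K ^+ (2 * l.+1) * eps.
Proof.
have c0 : 0 <= 2 * l%:R ^+ 2 * K ^+ (2 * l) * eps.
  by rewrite !mulr_ge0 ?sqr_ge0 ?exprn_ge0.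
apply: le_trans (arith l); rewrite (le_trans (dpreactivation_lip i c0 (@dlayer_lip e l)))//.
by rewrite lerDl !mulr_ge0 ?exprn_ge0.
Qed.

End lipschitz.

Variable D : nat.
Hypotheses (D0 : (0 < D)%N) (nD : n D = 1%N).

Definition dnetwork theta e x : R := \sum_i dpreactivation theta x e (l := D.-1) i.

Lemma networkE theta x : network pos theta rho D x = \sum_i preactivation theta x (l := D.-1) i.
Proof. by apply: eq_bigr => i _; rewrite preactivationE. Qed.

Let width_last : W D.-1.+1 = 1%N.
Proof. by rewrite /= prednK. Qed.

(** The output has width 1, so summing over its components costs no factor. *)
Let norm_sum_last (f : 'I_(W D.-1.+1) -> R) (c : R) :
  (forall i, `|f i| <= c) -> `|\sum_i f i| <= c.
Proof.
move=> fc; apply: (le_trans (ler_norm_sum _ _ _)).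
apply: (@le_trans _ _ (\sum_(i < W D.-1.+1) c)); first exact: ler_sum.
by rewrite sumr_const card_ord width_last.
Qed.

Lemma is_derive_network theta x e :
  is_derive x (delta_mx 0 e : E) (network pos theta rho D) (dnetwork theta e x).
Proof.
rewrite (_ : network pos theta rho D = \sum_i (fun x => preactivation theta x (l := D.-1) i)).
  apply: is_derive_sum => i; apply: is_derive_affine => j.
  exact: is_derive_layer.
by apply/funext => z; rewrite fct_sumE networkE.
Qed.

Lemma continuous_network theta : continuous (network pos theta rho D).
Proof.
rewrite (funext (networkE theta)) => x.
apply: (@continuous_big R _ +%R 0 xpredT add_continuous) => i _.
exact: continuous_preactivation.
Qed.

Lemma partial_network theta e : partial e (network pos theta rho D) = dnetwork theta e.
Proof. by apply/funext => x; have [_ <-] := is_derive_network theta x e. Qed.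

Lemma continuous_partial_network theta e : continuous (partial e (network pos theta rho D)).
Proof.
rewrite partial_network => x.
apply: (@continuous_big R _ +%R 0 xpredT add_continuous) => i _.
by apply: continuous_affine => j; exact: continuous_dlayer.
Qed.

Lemma derivable_network theta e x : derivable (network pos theta rho D) x (delta_mx 0 e).
Proof. by have [] := is_derive_network theta x e. Qed.

Let D1 : D.-1.+1 = D. Proof. exact: prednK. Qed.

Lemma network_bound theta x : (forall k, `|x 0 k| <= 1) ->
  (forall k, `|theta 0 k| <= B) -> `|network pos theta rho D x| <= K ^+ D.
Proof.
move=> x1 tB; rewrite networkE; apply: norm_sum_last => i.
by rewrite (le_trans (preactivation_bound i x1 tB))// ler_eXnr.
Qed.

Lemma partial_network_bound theta e x :
  (forall k, `|theta 0 k| <= B) -> `|partial e (network pos theta rho D) x| <= K ^+ D.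
Proof.
move=> tB; rewrite partial_network; apply: norm_sum_last => i.
by rewrite -[in leRHS]D1 dpreactivation_bound.
Qed.

Lemma network_lipschitz theta theta' x (eps : R) : (forall k, `|x 0 k| <= 1) ->
  (forall k, `|theta 0 k| <= B) -> (forall k, `|theta' 0 k| <= B) ->
  (forall k, `|theta 0 k - theta' 0 k| <= eps) ->
  `|network pos theta rho D x - network pos theta' rho D x| <= D%:R * K ^+ D * eps.
Proof.
move=> x1 tB tB' tt; rewrite !networkE -sumrB; apply: norm_sum_last => i.
by have := preactivation_lipschitz x1 tB' tt i; rewrite D1.
Qed.

Lemma partial_network_lipschitz theta theta' e x (eps : R) : (forall k, `|x 0 k| <= 1) ->
  (forall k, `|theta 0 k| <= B) -> (forall k, `|theta' 0 k| <= B) ->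
  (forall k, `|theta 0 k - theta' 0 k| <= eps) ->
  `|partial e (network pos theta rho D) x - partial e (network pos theta' rho D) x|
    <= 2 * D%:R ^+ 2 * K ^+ (2 * D) * eps.
Proof.
move=> x1 tB tB' tt; rewrite !partial_network -sumrB; apply: norm_sum_last => i.
by have := dpreactivation_lipschitz x1 tB tB' tt e i; rewrite D1.
Qed.

End networks.

(** * The losses of C^1 functions *)

Lemma ae_eq_Rintegral dT (T : measurableType dT) (R : realType)
    (mu : {measure set T -> \bar R}) (D : set T) (f g : T -> R) :
  measurable D -> measurable_fun D f -> measurable_fun D g ->
  {ae mu, forall x, D x -> f x = g x} ->
  \int[mu]_(x in D) f x = \int[mu]_(x in D) g x.
Proof.
move=> mD mf mg fg; congr fine; apply: ae_eq_integral => //.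
- exact/measurable_EFinP.
- exact/measurable_EFinP.
- by apply: filterS fg => x h /h ->.
Qed.

Lemma integrable_bounded_mul dT (T : measurableType dT) (R : realType)
    (mu : {measure set T -> \bar R}) (D : set T) (f g : T -> R) (C : R) :
  measurable D -> mu.-integrable D (EFin \o f) -> measurable_fun D g ->
  (forall x, D x -> `|g x| <= C) -> mu.-integrable D (EFin \o (fun x => f x * g x)).
Proof.
move=> mD jf mg gC.
have mf : measurable_fun D f by apply/measurable_EFinP; exact: measurable_int jf.
apply: (@le_integrable _ _ _ _ _ mD _ (fun x => (C%:E * (EFin \o f) x)%E)).
- by apply/measurable_EFinP; exact: measurable_funM.
- move=> x Dx /=; rewrite lee_fin !normrM mulrC ler_wpM2r//.
  by rewrite (le_trans (gC x Dx))// ler_norm.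
- exact: integrableZl.
Qed.

Lemma norm_Rintegral_le_envelope dT (T : measurableType dT) (R : realType)
    (mu : {measure set T -> \bar R}) (D : set T) (F h : T -> R) (k : R) :
  measurable D -> mu.-integrable D (EFin \o F) -> measurable_fun D h ->
  (forall x, D x -> `|h x| <= k * F x) ->
  `|\int[mu]_(x in D) h x| <= k * \int[mu]_(x in D) F x.
Proof.
move=> mD iF mh hk.
have ikF : mu.-integrable D (EFin \o (fun x => k * F x)) by exact: (integrableZl mD k iF).
have ih : mu.-integrable D (EFin \o h).
  apply: (@le_integrable _ _ _ _ _ mD _ (EFin \o (fun x => k * F x))) => //.
  - exact/measurable_EFinP.
  - by move=> x Dx; rewrite /= lee_fin (le_trans (hk x Dx))// ler_norm.
apply: (le_trans (le_normr_Rintegral mD ih)); rewrite -RintegralZl//.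
by apply: le_Rintegral => //; exact: (integrable_norm ih).
Qed.

Lemma Rintegral_sum dT (T : measurableType dT) (R : realType)
    (mu : {measure set T -> \bar R}) (D : set T) (I : Type) (r : seq I) (f : I -> T -> R) :
  measurable D -> (forall i, mu.-integrable D (EFin \o f i)) ->
  mu.-integrable D (EFin \o (fun x => \sum_(i <- r) f i x)) /\
  \int[mu]_(x in D) (\sum_(i <- r) f i x) = \sum_(i <- r) \int[mu]_(x in D) f i x.
Proof.
move=> mD jf; elim: r => [|i r [IH1 IH2]].
  rewrite big_nil (_ : (fun x => _) = cst 0); last by apply/funext => x; rewrite big_nil.
  by split; [exact: integrable0|rewrite Rintegral_cst// mul0r].
rewrite big_cons -IH2 -RintegralD//.
have E : (fun x => \sum_(i <- i :: r) f i x) = (fun x => f i x + \sum_(i <- r) f i x).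
  by apply/funext => x; rewrite big_cons.
rewrite E; split => //.
exact: (@integrableD _ _ _ mu D mD (EFin \o f i) (EFin \o (fun x => \sum_(i <- r) f i x))).
Qed.

Section C1_functions.
Context {R : realType} {d : nat}.
Local Notation E := 'rV[R]_d.

(** Regularity is required on the whole space, where integration by parts takes place. The bounds
    are required only on the cube, which contains the domain and its boundary: a network of depth 1
    is affine, hence possibly unbounded. *)
Record C1_bounded (M : R) (u : E -> R) : Prop := C1Bounded {
  C1_continuous : continuous u;
  C1_derivable : forall i x, derivable u x (delta_mx 0 i);
  C1_partial_continuous : forall i, continuous (partial i u);
  C1_bound : forall x, cube d 1 x -> `|u x| <= M;
  C1_partial_bound : forall i x, cube d 1 x -> `|partial i u x| <= M }.

Variables (Om : set E) (q : equation R d) (T0 : (E -> R) -> E -> R).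
Hypothesis oOm : open Om.
Hypothesis Om_cube : Om `<=` cube d 1.
Hypothesis tT0 : trace_operator Om T0.
Local Notation a := (coef_a q).
Local Notation b := (coef_b q).
Local Notation c := (coef_c q).
Local Notation f := (rhs_f q).
Local Notation g := (rhs_g q).
Local Notation mu := (lebesgue_rV d).
Local Notation sigma := (surface_measure d).
Local Notation bd := (boundary Om).
Hypothesis hA1 : A1 Om q.
Hypothesis sigma_fin : (sigma bd < +oo)%E.

Let mOm : measurable Om. Proof. exact: sub_sigma_algebra. Qed.

Lemma measurable_closed (A : set E) : closed A -> measurable A.
Proof.
by move=> cA; rewrite -[A]setCK; apply: measurableC; apply: sub_sigma_algebra; exact: closed_openC.
Qed.

Lemma measurable_boundary : measurable bd.
Proof.
apply: measurableD; first by apply: measurable_closed; exact: closed_closure.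
by apply: sub_sigma_algebra; exact: open_interior.
Qed.
Let mbd := measurable_boundary.

Lemma compact_cube : compact (cube d (1 : R)).
Proof.
have -> : cube d (1 : R) = cbox (const_mx (- 1)) (const_mx 1).
  by apply/seteqP; split => x /= H i; have := H i; rewrite !mxE ler_norml.
exact: compact_cbox.
Qed.

Lemma closure_cube : closure Om `<=` cube d 1.
Proof.
have cc : closed (cube d (1 : R)).
  by apply: compact_closed; [exact: norm_hausdorff|exact: compact_cube].
by rewrite closureE => x; apply; split.
Qed.

Lemma compact_closure : compact (closure Om).
Proof.
by apply: (subclosed_compact _ compact_cube closure_cube); exact: closed_closure.
Qed.

Lemma boundary_cube : bd `<=` cube d 1.
Proof. by move=> x [/closure_cube]. Qed.

Lemma coef_a_bound i j x : closure Om x -> `|a i j x| <= sup_norm Om (a i j).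
Proof.
move=> xO; have [_ _ ca _ _] := hA1.
have : compact (a i j @` closure Om) by apply: continuous_compact => //; exact: compact_closure.
move=> /compact_bounded[M [_ HM]].
apply: sup_upper_bound; last by exists x.
split; first by exists `|a i j x|; exists x.
exists (`|M| + 1) => _ [y yO <-].
by apply: (HM (`|M| + 1)); [rewrite (le_lt_trans (ler_norm M))// ltrDl|exists y].
Qed.

Lemma measurable_coef_a i j : measurable_fun Om (a i j).
Proof.
have [_ _ ca _ _] := hA1.
have : {within Om, continuous (a i j)}.
  exact: (continuous_subspaceW (@subset_closure _ Om)).
rewrite continuous_open_subspace// => cO.
apply: (measurability _ (RGenInftyO.measurableE R)).
move=> _ [_ [r ->] <-]; apply: sub_sigma_algebra.
suff : open (Om `&` a i j @^-1` `]-oo, r[) by [].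
rewrite openE => x [Ox ax]; apply: (@filterI _ _ (nbhs_filter x)).
  exact: open_nbhs_nbhs.
apply: (cO x); first by rewrite inE.
by apply: open_nbhs_nbhs; split => //; exact: interval_open.
Qed.

Lemma Loo_ae_bound (h : E -> R) : Loo Om h ->
  {ae mu, forall x, Om x -> `|h x| <= Loo_norm Om h}.
Proof.
move=> [mh]; rewrite /Loo_norm /Lp_norm unlock /Lnorm.
case: ifPn => [mu0 hlt|mu0 _].
  have h0 : (0 <= ess_sup mu (abse \o (EFin \o h \_ Om)))%E.
    by apply: ess_sup_gee => //; apply: aeW => x /=.
  have := ess_sup_ge mu (abse \o (EFin \o h \_ Om)).
  apply: filterS => x + Ox; rewrite /= patchE mem_set//.
  by rewrite -[X in (_ <= X)%E]fineK ?lee_fin// ge0_fin_numE.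
(* The L^oo norm is 0 by convention when the whole space has measure 0, and then the whole space
   serves as the exceptional null set. *)
exists setT; split => //; apply/eqP; rewrite eq_le measure_ge0 andbT.
by rewrite leNgt.
Qed.

Lemma Loo_integrable (h : E -> R) : Loo Om h -> mu.-integrable Om (EFin \o h).
Proof.
move=> hoo; have mh := hoo.1; have hb := Loo_ae_bound hoo.
apply/integrableP; split; first exact/measurable_EFinP.
apply: (@le_lt_trans _ _ (\int[mu]_(x in Om) (`|Loo_norm Om h|)%:E)%E).
  apply: ae_ge0_le_integral => //.
  - by apply/measurable_EFinP; exact: measurableT_comp.
  - by apply: filterS hb => x hx Ox; rewrite /= lee_fin (le_trans (hx Ox))// ler_norm.
by rewrite integral_cst// lte_mul_pinfty//; exact: lebesgue_open_lty.
Qed.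

Lemma coef_a_integrable i j : mu.-integrable Om (EFin \o a i j).
Proof.
apply: L2_integrable => //; apply: (bounded_L2 oOm Om_cube (C := sup_norm Om (a i j))).
  exact: measurable_coef_a.
by move=> x Ox; apply: coef_a_bound; exact: subset_closure.
Qed.

Section one_function.
Variables (M : R) (u : E -> R).
Hypothesis hu : C1_bounded M u.

Lemma C1_measurable (D : set E) : measurable_fun D u.
Proof. by apply: measurable_funTS; apply: continuous_measurable_rV; case: hu. Qed.

Lemma C1_partial_measurable i (D : set E) : measurable_fun D (partial i u).
Proof. by apply: measurable_funTS; apply: continuous_measurable_rV; case: hu. Qed.

Lemma C1_weak_partial i : L2 Om (weak_partial Om i u) /\
  {ae mu, forall x, Om x -> weak_partial Om i u x = partial i u x}.
Proof.
apply: weak_partial_classical => //; [exact: C1_derivable hu i|exact: C1_continuous hu|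
  exact: C1_partial_continuous hu i|].
apply: (bounded_L2 oOm Om_cube (C := M)); first exact: C1_partial_measurable.
by move=> x /Om_cube; exact: C1_partial_bound hu i x.
Qed.

Lemma C1_H1 : H1 Om u.
Proof.
split.
  apply: (bounded_L2 oOm Om_cube (C := M)); first exact: C1_measurable.
  by move=> x /Om_cube; exact: C1_bound hu x.
move=> i; exists (partial i u); apply: is_weak_partial_classical => //;
  [exact: C1_derivable hu i|exact: C1_continuous hu|exact: C1_partial_continuous hu i|].
apply: (bounded_L2 oOm Om_cube (C := M)); first exact: C1_partial_measurable.
by move=> x /Om_cube; exact: C1_partial_bound hu i x.
Qed.

Lemma C1_trace : measurable_fun bd (T0 u) /\ {ae sigma, forall x, bd x -> T0 u x = u x}.
Proof.
have [t1 _ _ t4] := tT0; split; first by have [] := t1 u C1_H1.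
apply: t4; first exact: C1_H1.
by apply: continuous_subspaceT; exact: C1_continuous hu.
Qed.

End one_function.

Definition volume_integrand (u v : E -> R) (x : E) : R :=
  \sum_i \sum_j a i j x * partial i u x * partial j v x
  + \sum_i b i x * partial i u x * v x + c x * u x * v x - f x * v x.

Definition boundary_integrand (alpha : R) (u v : E -> R) (x : E) : R :=
  alpha * (u x * v x) - g x * v x.

Lemma measurable_volume_integrand (M : R) (u v : E -> R) :
  C1_bounded M u -> C1_bounded M v -> measurable_fun Om (volume_integrand u v).
Proof.
move=> hu hv; have [[mf _] _ _ bLoo [[mc _] _]] := hA1.
have mu_ : measurable_fun Om u by exact: C1_measurable hu _.
have mv : measurable_fun Om v by exact: C1_measurable hv _.
apply: measurable_funB; last exact: measurable_funM.
apply: measurable_funD; last by do 2?[apply: measurable_funM => //].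
apply: measurable_funD.
  apply: measurable_sum => i; apply: measurable_sum => j.
  apply: measurable_funM; last exact: (C1_partial_measurable hv).
  by apply: measurable_funM; [exact: measurable_coef_a|exact: (C1_partial_measurable hu)].
apply: measurable_sum => i; apply: measurable_funM => //.
by apply: measurable_funM; [have [] := bLoo i|exact: (C1_partial_measurable hu)].
Qed.

Lemma measurable_boundary_integrand (M alpha : R) (u v : E -> R) :
  C1_bounded M u -> C1_bounded M v -> measurable_fun bd (boundary_integrand alpha u v).
Proof.
move=> hu hv; have [_ [mg _] _ _ _] := hA1.
have mu_ : measurable_fun bd u by exact: C1_measurable hu _.
have mv : measurable_fun bd v by exact: C1_measurable hv _.
apply: measurable_funB; last exact: measurable_funM.
by apply: measurable_funM => //; exact: measurable_funM.
Qed.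

(** Weak derivatives and traces are replaced almost everywhere by classical derivatives and values.
    Splitting the integral of the integrand needs every term integrable: each is an integrable
    coefficient times functions bounded on the domain or its boundary. *)
Lemma loss_C1 (M : R) (u v : E -> R) (alpha beta : R) :
  C1_bounded M u -> C1_bounded M v ->
  loss Om q T0 alpha beta u v =
    \int[mu]_(x in Om) volume_integrand u v x
    + beta^-1 * \int[sigma]_(x in bd) boundary_integrand alpha u v x.
Proof.
move=> hu hv.
have [fL2 gL2 _ bLoo [cLoo _]] := hA1.
have mu_ := C1_measurable hu; have mv := C1_measurable hv.
have mpu := C1_partial_measurable hu; have mpv := C1_partial_measurable hv.
have uM x : Om x -> `|u x| <= M by move=> /Om_cube; exact: C1_bound hu x.
have vM x : Om x -> `|v x| <= M by move=> /Om_cube; exact: C1_bound hv x.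
have puM i x : Om x -> `|partial i u x| <= M by move=> /Om_cube; exact: C1_partial_bound hu i x.
have pvM i x : Om x -> `|partial i v x| <= M by move=> /Om_cube; exact: C1_partial_bound hv i x.
have uMb x : bd x -> `|u x| <= M by move=> /boundary_cube; exact: C1_bound hu x.
have vMb x : bd x -> `|v x| <= M by move=> /boundary_cube; exact: C1_bound hv x.
have ia i j : mu.-integrable Om (EFin \o (fun x => a i j x * partial i u x * partial j v x)).
  apply: (integrable_bounded_mul mOm _ (mpv j Om) (pvM j)).
  exact: (integrable_bounded_mul mOm (coef_a_integrable i j) (mpu i Om) (puM i)).
have ib i : mu.-integrable Om (EFin \o (fun x => b i x * partial i u x * v x)).
  apply: (integrable_bounded_mul mOm _ (mv Om) vM).
  exact: (integrable_bounded_mul mOm (Loo_integrable (bLoo i)) (mpu i Om) (puM i)).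
have ic : mu.-integrable Om (EFin \o (fun x => c x * u x * v x)).
  apply: (integrable_bounded_mul mOm _ (mv Om) vM).
  exact: (integrable_bounded_mul mOm (Loo_integrable cLoo) (mu_ Om) uM).
have if_ : mu.-integrable Om (EFin \o (fun x => f x * v x)).
  exact: (integrable_bounded_mul mOm (L2_integrable oOm Om_cube fL2) (mv Om) vM).
have mwu i : measurable_fun Om (weak_partial Om i u) by have [[]] := C1_weak_partial hu i.
have mwv i : measurable_fun Om (weak_partial Om i v) by have [[]] := C1_weak_partial hv i.
have mb i : measurable_fun Om (b i) by have [] := bLoo i.
have Ea i j : inner Om (fun x => a i j x * weak_partial Om i u x) (weak_partial Om j v)
    = \int[mu]_(x in Om) (a i j x * partial i u x * partial j v x).
  apply: ae_eq_Rintegral => //.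
  - by do 2?[apply: measurable_funM => //]; exact: measurable_coef_a.
  - by do 2?[apply: measurable_funM => //]; exact: measurable_coef_a.
  - have [_ wu] := C1_weak_partial hu i; have [_ wv] := C1_weak_partial hv j.
    by apply: filterS2 wu wv => x h1 h2 Ox; rewrite h1// h2.
have Eb i : inner Om (fun x => b i x * weak_partial Om i u x) v
    = \int[mu]_(x in Om) (b i x * partial i u x * v x).
  apply: ae_eq_Rintegral => //.
  - by do 2?[apply: measurable_funM => //].
  - by do 2?[apply: measurable_funM => //].
  - have [_ wu] := C1_weak_partial hu i.
    by apply: filterS wu => x h1 Ox; rewrite h1.
have ig : sigma.-integrable bd (EFin \o g).
  have [mg g2] := gL2.
  by apply: square_integrable_integrable => //; rewrite integral_sqr_Lnorm2// ltry.
have i1 : sigma.-integrable bd (EFin \o cst 1).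
  apply/integrableP; split; first exact/measurable_EFinP.
  under eq_integral do rewrite /= normr1.
  by rewrite integral_cst// mul1e.
have igv : sigma.-integrable bd (EFin \o (fun x => g x * v x)).
  exact: (integrable_bounded_mul mbd ig (mv bd) vMb).
(* The leading 1 is the integrable function, finite area being known, from which two multiplications
   by bounded functions start. *)
have iuv : sigma.-integrable bd (EFin \o (fun x => 1 * u x * v x)).
  apply: (integrable_bounded_mul mbd _ (mv bd) vMb).
  exact: (integrable_bounded_mul mbd i1 (mu_ bd) uMb).
have [mTu Tu] := C1_trace hu; have [mTv Tv] := C1_trace hv.
have Euv : inner_bd Om (T0 u) (T0 v) = \int[sigma]_(x in bd) (1 * u x * v x).
  apply: ae_eq_Rintegral => //.
  - exact: measurable_funM.
  - by do 2?[apply: measurable_funM => //].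
  - by apply: filterS2 Tu Tv => x h1 h2 Ox; rewrite h1// h2// mul1r.
have Eg : inner_bd Om g (T0 v) = \int[sigma]_(x in bd) (g x * v x).
  apply: ae_eq_Rintegral => //.
  - by apply: measurable_funM => //; have [] := gL2.
  - by apply: measurable_funM => //; have [] := gL2.
  - by apply: filterS Tv => x h1 Ox; rewrite h1.
rewrite /loss Euv Eg.
have S1 i := Rintegral_sum (index_enum 'I_d) mOm (ia i).
have S2 := Rintegral_sum (index_enum 'I_d) mOm (fun i => (S1 i).1).
have S3 := Rintegral_sum (index_enum 'I_d) mOm ib.
have iS12 := integrableD mOm S2.1 S3.1.
have iS123 := integrableD mOm iS12 ic.
have -> : \int[mu]_(x in Om) volume_integrand u v x =
    \sum_i \sum_j \int[mu]_(x in Om) (a i j x * partial i u x * partial j v x)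
    + \sum_i \int[mu]_(x in Om) (b i x * partial i u x * v x)
    + \int[mu]_(x in Om) (c x * u x * v x) - \int[mu]_(x in Om) (f x * v x).
  rewrite /volume_integrand RintegralB//.
  rewrite RintegralD//.
  rewrite RintegralD//; [|exact: S2.1|exact: S3.1].
  rewrite S3.2 S2.2; congr (_ + _ + _ - _).
  by apply: eq_bigr => i _; rewrite (S1 i).2.
have -> : \int[sigma]_(x in bd) boundary_integrand alpha u v x =
    alpha * \int[sigma]_(x in bd) (1 * u x * v x) - \int[sigma]_(x in bd) (g x * v x).
  rewrite -RintegralZl// -RintegralB//; last first.
    exact: (integrableZl mbd alpha iuv).
  by apply: eq_Rintegral => x _; rewrite mul1r.
rewrite (eq_bigr _ (fun i _ => eq_bigr _ (fun j _ => Ea i j))) (eq_bigr _ (fun i _ => Eb i)).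
by rewrite /inner; ring.
Qed.

End C1_functions.

(** * Pointwise envelopes and their second moments *)

Section envelopes.
Context {R : realType} {d : nat}.
Local Notation E := 'rV[R]_d.
Variables (Om : set E) (q : equation R d).
Local Notation a := (coef_a q).
Local Notation b := (coef_b q).
Local Notation c := (coef_c q).
Local Notation f := (rhs_f q).
Local Notation g := (rhs_g q).

Definition volume_envelope (x : E) : R :=
  \sum_i \sum_j `|a i j x| + \sum_i `|b i x| + `|c x| + `|f x|.

Definition boundary_envelope (alpha : R) (x : E) : R := `|alpha| + `|g x|.

Lemma volume_envelope_ge0 x : 0 <= volume_envelope x.
Proof. by rewrite !addr_ge0// sumr_ge0// => i _; rewrite sumr_ge0. Qed.

Lemma boundary_envelope_ge0 alpha x : 0 <= boundary_envelope alpha x.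
Proof. exact: addr_ge0. Qed.

(** The integrand is linear in the products of values of u, v and their derivatives. Applied to
    these products it gives the size bound, applied to their differences the Lipschitz bound. *)
Let form_bound x (p : 'I_d -> 'I_d -> R) (r : 'I_d -> R) (s t k : R) :
  (forall i j, `|p i j| <= k) -> (forall i, `|r i| <= k) -> `|s| <= k -> `|t| <= k ->
  `|\sum_i \sum_j a i j x * p i j + \sum_i b i x * r i + c x * s - f x * t|
    <= k * volume_envelope x.
Proof.
move=> pk rk sk tk; rewrite /volume_envelope mulrDr.
have nm y z : `|z| <= k -> `|y * z| <= k * `|y|.
  by move=> zk; rewrite normrM mulrC ler_wpM2r.
apply: (le_trans (ler_normB _ _)); apply: lerD; last exact: nm.
rewrite mulrDr; apply: (le_trans (ler_normD _ _)); apply: lerD; last exact: nm.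
rewrite mulrDr; apply: (le_trans (ler_normD _ _)); apply: lerD.
  rewrite mulr_sumr; apply: (le_trans (ler_norm_sum _ _ _)); apply: ler_sum => i _.
  rewrite mulr_sumr; apply: (le_trans (ler_norm_sum _ _ _)); apply: ler_sum => j _.
  exact: nm.
rewrite mulr_sumr; apply: (le_trans (ler_norm_sum _ _ _)); apply: ler_sum => i _.
exact: nm.
Qed.

Let integrandE u v x : volume_integrand q u v x =
  \sum_i \sum_j a i j x * (partial i u x * partial j v x)
  + \sum_i b i x * (partial i u x * v x) + c x * (u x * v x) - f x * v x.
Proof.
rewrite /volume_integrand mulrA; congr (_ + _ + _ - _).
  by apply: eq_bigr => i _; apply: eq_bigr => j _; rewrite mulrA.
by apply: eq_bigr => i _; rewrite mulrA.
Qed.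

Variable M : R.
Hypothesis M1 : 1 <= M.
Let M0 : 0 <= M. Proof. exact: le_trans ler01 M1. Qed.

Let bound2 (s t : R) : `|s| <= M -> `|t| <= M -> `|s * t| <= M ^+ 2.
Proof. by move=> sM tM; rewrite normrM expr2 ler_pM. Qed.

Let lip2 (s t s' t' e : R) : `|s'| <= M -> `|t| <= M -> `|s - s'| <= e -> `|t - t'| <= e ->
  `|s * t - s' * t'| <= 2 * M * e.
Proof.
move=> sM tM se te; rewrite (_ : s * t - s' * t' = (s - s') * t + s' * (t - t')); last by ring.
rewrite (_ : 2 * M * e = e * M + M * e); last by ring.
by rewrite (le_trans (ler_normD _ _))// !normrM lerD// ler_pM.
Qed.

Let lip1 (t t' e : R) : `|t - t'| <= e -> `|t - t'| <= 2 * M * e.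
Proof.
move=> te; have e0 : 0 <= e := le_trans (normr_ge0 _) te.
by rewrite (le_trans te)//; have := M1; nra.
Qed.

Section pointwise.
Variables (u v : E -> R) (x : E).
Hypotheses (uM : `|u x| <= M) (vM : `|v x| <= M).
Hypotheses (puM : forall i, `|partial i u x| <= M) (pvM : forall i, `|partial i v x| <= M).

Lemma volume_integrand_bound : `|volume_integrand q u v x| <= M ^+ 2 * volume_envelope x.
Proof.
rewrite integrandE; apply: form_bound => [i j|i||].
- exact: bound2.
- exact: bound2.
- exact: bound2.
- by rewrite (le_trans vM)// ler_eXnr.
Qed.

Lemma boundary_integrand_bound alpha :
  `|boundary_integrand q alpha u v x| <= M ^+ 2 * boundary_envelope alpha x.
Proof.
rewrite /boundary_integrand /boundary_envelope mulrDr (le_trans (ler_normB _ _))//.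
rewrite ![`|_ * _|]normrM -normrM lerD//.
  by rewrite mulrC ler_wpM2r// bound2.
by rewrite mulrC ler_wpM2r// (le_trans vM)// ler_eXnr.
Qed.

Variables (u' v' : E -> R) (e : R).
Hypotheses (uM' : `|u' x| <= M) (puM' : forall i, `|partial i u' x| <= M).
Hypotheses (ue : `|u x - u' x| <= e) (ve : `|v x - v' x| <= e).
Hypotheses (pue : forall i, `|partial i u x - partial i u' x| <= e).
Hypotheses (pve : forall i, `|partial i v x - partial i v' x| <= e).

Lemma volume_integrand_lipschitz :
  `|volume_integrand q u v x - volume_integrand q u' v' x| <= 2 * M * e * volume_envelope x.
Proof.
have -> : volume_integrand q u v x - volume_integrand q u' v' x =
  \sum_i \sum_j a i j x * (partial i u x * partial j v x - partial i u' x * partial j v' x)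
  + \sum_i b i x * (partial i u x * v x - partial i u' x * v' x)
  + c x * (u x * v x - u' x * v' x) - f x * (v x - v' x).
  have sub (I : Type) (r : seq I) (k y z : I -> R) :
      \sum_(i <- r) k i * (y i - z i) = \sum_(i <- r) k i * y i - \sum_(i <- r) k i * z i.
    by rewrite -sumrB; apply: eq_bigr => i _; rewrite mulrBr.
  rewrite !integrandE sub.
  rewrite (eq_bigr _ (fun i _ => sub _ _ (a i ^~ x) _ _)) sumrB.
  ring.
apply: form_bound => [i j|i||].
- exact: lip2.
- exact: lip2.
- exact: lip2.
- exact: lip1.
Qed.

Lemma boundary_integrand_lipschitz alpha :
  `|boundary_integrand q alpha u v x - boundary_integrand q alpha u' v' x|
    <= 2 * M * e * boundary_envelope alpha x.
Proof.
have -> : boundary_integrand q alpha u v x - boundary_integrand q alpha u' v' x =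
  alpha * (u x * v x - u' x * v' x) - g x * (v x - v' x).
  by rewrite /boundary_integrand; ring.
rewrite /boundary_envelope (mulrDr (2 * M * e)); apply: (le_trans (ler_normB _ _)).
by apply: lerD; rewrite normrM mulrC ler_wpM2r//; [exact: lip2|exact: lip1].
Qed.

End pointwise.
End envelopes.

Section envelope_norms.
Context {R : realType} {d : nat}.
Local Notation E := 'rV[R]_d.
Variables (Om : set E) (q : equation R d).
Hypothesis oOm : open Om.
Hypothesis Om_cube : Om `<=` cube d 1.
Hypothesis hA1 : A1 Om q.
Local Notation mu := (lebesgue_rV d).
Local Notation sigma := (surface_measure d).
Local Notation bd := (boundary Om).

Let mOm : measurable Om. Proof. exact: sub_sigma_algebra. Qed.

Lemma measurable_volume_envelope : measurable_fun Om (volume_envelope q).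
Proof.
have [[mf _] _ _ bLoo [[mc _] _]] := hA1.
have mn (h : E -> R) : measurable_fun Om h -> measurable_fun Om (fun x => `|h x|).
  by move=> mh; exact: measurableT_comp.
apply: measurable_funD; last exact: mn.
apply: measurable_funD; last exact: mn.
apply: measurable_funD.
  apply: measurable_sum => i; apply: measurable_sum => j; apply: mn.
  exact: measurable_coef_a.
by apply: measurable_sum => i; apply: mn; have [] := bLoo i.
Qed.

Lemma measurable_boundary_envelope alpha : measurable_fun bd (boundary_envelope q alpha).
Proof.
have [_ [mg _] _ _ _] := hA1.
by apply: measurable_funD => //; exact: measurableT_comp.
Qed.

Definition coef_norm_sum (A : 'I_d -> 'I_d -> R) (Bn : 'I_d -> R) (Cn : R) : R :=
  \sum_i \sum_j A i j + \sum_i Bn i + Cn.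

(** From (k + |h|)^2 <= 2 k^2 + 2 h^2. The measure of [D] is factored out because the deviation
    bound takes the second moment under the normalized measure. *)
Lemma integral_sqr_add_le dT (T : measurableType dT) (nu : {measure set T -> \bar R})
    (D : set T) (F h : T -> R) (k : R) :
  measurable D -> measurable_fun D F -> measurable_fun D h ->
  ('N[nu]_(2%:E)[EFin \o (h \_ D)] < +oo)%E -> nu D = (fine (nu D))%:E -> 0 < fine (nu D) ->
  {ae nu, forall x, D x -> 0 <= F x <= k + `|h x|} ->
  (\int[nu]_(x in D) (F x ^+ 2)%:E <= (fine (nu D) *
     (2 * k ^+ 2 + 2 * (fine 'N[nu]_(2%:E)[EFin \o (h \_ D)]) ^+ 2 / fine (nu D)))%:E)%E.
Proof.
move=> mD mF mh hlt nuE nu0 Fk.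
have mh2 : measurable_fun D (fun x => (h x ^+ 2)%:E).
  by apply/measurable_EFinP; exact: measurable_funX.
apply: (@le_trans _ _ (\int[nu]_(x in D) ((2 * k ^+ 2)%:E + 2%:E * (h x ^+ 2)%:E))%E).
  apply: ae_ge0_le_integral => //.
  - by move=> x _; rewrite lee_fin sqr_ge0.
  - by apply/measurable_EFinP; exact: measurable_funX.
  - by move=> x _; rewrite -EFinM -EFinD lee_fin addr_ge0// mulr_ge0// sqr_ge0.
  - by apply: emeasurable_funD => //; apply/measurable_EFinP; apply: measurable_funM => //; exact: measurable_funX.
  apply: filterS Fk => x Fx Dx; have /andP[F0 F1] := Fx Dx.
  rewrite -EFinM -EFinD lee_fin -[h x ^+ 2]real_normK ?num_real//.
  have := sqr_ge0 (k - `|h x|); nra.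
rewrite ge0_integralD//; last 3 first.
- by move=> x _; rewrite lee_fin mulr_ge0// sqr_ge0.
- by move=> x _; rewrite -EFinM lee_fin mulr_ge0// sqr_ge0.
- by apply/measurable_EFinP; apply: measurable_funM => //; exact: measurable_funX.
rewrite integral_cst// ge0_integralZl//; last by move=> x _; rewrite lee_fin sqr_ge0.
rewrite integral_sqr_Lnorm2// nuE -!EFinM -EFinD lee_fin/=.
rewrite le_eqVlt; apply/orP; left; apply/eqP; field; by rewrite gt_eqF.
Qed.

Lemma volume_envelope_norm :
  mu Om = (fine (mu Om))%:E -> 0 < fine (mu Om) ->
  (\int[mu]_(x in Om) (volume_envelope q x ^+ 2)%:E <= (fine (mu Om) *
   (2 * coef_norm_sum (fun i j => sup_norm Om (coef_a q i j)) (fun i => Loo_norm Om (coef_b q i))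
          (Loo_norm Om (coef_c q)) ^+ 2
    + 2 * L2_norm Om (rhs_f q) ^+ 2 / fine (mu Om)))%:E)%E.
Proof.
move=> muE mu0; have [[mf f2] _ _ bLoo [cLoo _]] := hA1.
apply: integral_sqr_add_le => //; first exact: measurable_volume_envelope.
have hb : {ae mu, forall x i, Om x -> `|coef_b q i x| <= Loo_norm Om (coef_b q i)}.
  (* Indices below d are embedded in the naturals, so that a countable intersection of almost sure
     statements applies. *)
  have : {ae mu, forall x (n : nat), forall i : 'I_d, i = n :> nat -> Om x ->
      `|coef_b q i x| <= Loo_norm Om (coef_b q i)}.
    apply: ae_foralln => n; have [nd|dn] := ltnP n d.
      apply: filterS (Loo_ae_bound (bLoo (Ordinal nd))) => x h i iE.
      by rewrite (_ : i = Ordinal nd)//; apply/val_inj.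
    by apply: aeW => x i iE; have := ltn_ord i; rewrite iE ltnNge dn.
  by apply: filterS => x hx i; exact: (hx i i).
have hc := Loo_ae_bound cLoo.
apply: filterS2 hb hc => x hbx hcx Ox.
rewrite volume_envelope_ge0/= lerD2r lerD ?hcx// lerD//.
  by apply: ler_sum => i _; apply: ler_sum => j _; apply: coef_a_bound => //; exact: subset_closure.
by apply: ler_sum => i _; exact: hbx.
Qed.

Lemma boundary_envelope_norm alpha :
  sigma bd = (fine (sigma bd))%:E -> 0 < fine (sigma bd) ->
  (\int[sigma]_(x in bd) (boundary_envelope q alpha x ^+ 2)%:E <= (fine (sigma bd) *
   (2 * alpha ^+ 2 + 2 * L2_bd_norm Om (rhs_g q) ^+ 2 / fine (sigma bd)))%:E)%E.
Proof.
move=> sE s0; have [_ [mg g2] _ _ _] := hA1.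
rewrite -[alpha ^+ 2]real_normK ?num_real//.
apply: integral_sqr_add_le => //; first exact: measurable_boundary.
  exact: measurable_boundary_envelope.
by apply: aeW => x _; rewrite boundary_envelope_ge0 lexx.
Qed.

End envelope_norms.

(** * From pointwise deviations to suprema *)

Section sup_deviation.
Context {R : realType}.

(** The bound [C] and a point of [S] make the supremum of F finite, hence that of G as well; two
    infinite suprema would have a difference of infinite absolute value. *)
Lemma abs_ereal_sup_sub_le (I : Type) (S : set I) (F G : I -> R) (C e : R) :
  S !=set0 -> (forall v, S v -> `|F v| <= C) -> (forall v, S v -> `|F v - G v| <= e) ->
  (`|ereal_sup [set (F v)%:E | v in S] - ereal_sup [set (G v)%:E | v in S]| <= e%:E)%E.
Proof.
move=> [v0 Sv0] FC FGe.
set sF := ereal_sup _; set sG := ereal_sup _.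
have FsF v : S v -> ((F v)%:E <= sF)%E by move=> Sv; apply: ereal_sup_ubound; exists v.
have GsG v : S v -> ((G v)%:E <= sG)%E by move=> Sv; apply: ereal_sup_ubound; exists v.
have sFC : (sF <= C%:E)%E.
  apply: ge_ereal_sup => _ [v Sv <-]; rewrite lee_fin.
  exact: le_trans (ler_norm _) (FC v Sv).
have sFG : (sF <= sG + e%:E)%E.
  apply: ge_ereal_sup => _ [v Sv <-]; apply: (@le_trans _ _ ((G v)%:E + e%:E)%E).
    by rewrite -EFinD lee_fin -lerBlDl (le_trans (ler_norm _))// FGe.
  by rewrite leeD2r// GsG.
have sGF : (sG <= sF + e%:E)%E.
  apply: ge_ereal_sup => _ [v Sv <-]; apply: (@le_trans _ _ ((F v)%:E + e%:E)%E).
    by rewrite -EFinD lee_fin -lerBlDl (le_trans (ler_norm _))// distrC FGe.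
  by rewrite leeD2r// FsF.
have Fv0 := FsF v0 Sv0; have Gv0 := GsG v0 Sv0.
move: sF sG sFC sFG sGF Fv0 Gv0 {FsF GsG} => [x| |] [y| |] //=.
by rewrite !lee_fin => _ h1 h2 _ _; rewrite ler_norml; apply/andP; split; lra.
Qed.

Lemma sta_error_le (d : nat) (Om : set 'rV[R]_d) (q : equation R d)
    (T0 : ('rV[R]_d -> R) -> 'rV[R]_d -> R) (P : set ('rV[R]_d -> R)) (alpha beta : R)
    (N M : nat) (X : 'I_N -> 'rV[R]_d) (Y : 'I_M -> 'rV[R]_d) (C e : R) :
  (forall u v, P u -> P v -> `|loss Om q T0 alpha beta u v| <= C) ->
  (forall u v, P u -> P v ->
    `|loss Om q T0 alpha beta u v - empirical_loss Om q alpha beta X Y u v| <= e) ->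
  (sta_error Om q T0 P alpha beta X Y <= (2 * e)%:E)%E.
Proof.
move=> lC le; rewrite /sta_error EFinM lee_pmul2l// ?lte_fin//.
apply: ge_ereal_sup => _ [u Pu <-].
by apply: (abs_ereal_sup_sub_le (C := C)); [exists u|move=> v Pv; exact: lC|move=> v Pv; exact: le].
Qed.

End sup_deviation.

(** * A net in the box of weights *)

Section grid.
Context {R : realType} (m q : nat) (B : R).

Definition grid (j : {ffun 'I_m -> 'I_q}) : 'rV[R]_m :=
  \row_k (- B + 2 * B / q%:R * (j k)%:R).

Lemma grid_bound j k : 0 <= B -> `|grid j 0 k| <= B.
Proof.
move=> B0; have q0 : (0 < q)%N := leq_ltn_trans (leq0n _) (ltn_ord (j k)).
rewrite mxE; set t := (j k)%:R; have tq : t / q%:R <= 1.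
  by rewrite ler_pdivrMr ?ltr0n// mul1r ler_nat ltnW.
have t0 : 0 <= t / q%:R by rewrite divr_ge0.
rewrite (_ : 2 * B / q%:R * t = 2 * B * (t / q%:R)); last by ring.
rewrite ler_norml; apply/andP; split; nra.
Qed.

Lemma grid_net (theta : 'rV[R]_m) : (0 < q)%N -> 0 < B -> (forall k, `|theta 0 k| <= B) ->
  exists j, forall k, `|theta 0 k - grid j 0 k| <= 2 * B / q%:R.
Proof.
move=> q0 B0 tB; have qR : 0 < q%:R :> R by rewrite ltr0n.
suff H (k : 'I_m) : {j : 'I_q | `|theta 0 k - (- B + 2 * B / q%:R * j%:R)| <= 2 * B / q%:R}.
  by exists [ffun k => sval (H k)] => k; rewrite mxE ffunE; case: (H k).
apply: cid; set t := theta 0 k; have := tB k; rewrite ler_norml -/t => /andP[t1 t2].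
pose s := (t + B) * q%:R / (2 * B).
have B2 : 0 < 2 * B by rewrite mulr_gt0.
have s0 : 0 <= s.
  by apply: divr_ge0; [apply: mulr_ge0; [lra|exact: ltW]|exact: ltW].
have tE : t = - B + 2 * B / q%:R * s by rewrite /s; field; rewrite !gt_eqF.
have [sq|sq] := ltP s q%:R.
  have jq : (Num.truncn s < q)%N by rewrite -(ltr_nat R) (le_lt_trans _ sq)// truncn_le.
  exists (Ordinal jq); rewrite /= {1}tE.
  have /andP[h1 h2] := truncn_itv s0.
  rewrite (_ : _ - _ = 2 * B / q%:R * (s - (Num.truncn s)%:R)); last by ring.
  rewrite normrM (gtr0_norm (divr_gt0 B2 qR)) ler_piMr ?divr_ge0 ?ltW//.
  by rewrite -natr1 in h2; rewrite ger0_norm ?subr_ge0//; lra.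
(* Only the endpoint t = B remains, where s = q: it goes to the last grid point, exactly one step
   away. *)
have jq : (q.-1 < q)%N by rewrite prednK.
have sq' : s = q%:R.
  apply/eqP; rewrite eq_le sq andbT /s ler_pdivrMr// mulrC ler_pM2l//; lra.
exists (Ordinal jq); rewrite /= tE sq'.
rewrite (_ : _ - _ = 2 * B / q%:R * (q%:R - q.-1%:R)); last by ring.
have qE : q%:R = q.-1%:R + 1 :> R by rewrite natr1 prednK.
rewrite (_ : q%:R - q.-1%:R = 1); last by rewrite qE; ring.
by rewrite mulr1 ger0_norm// divr_ge0// ltW.
Qed.

End grid.

(** * The statistical error *)

(** The square root is sqrt(19) m D^(1/2) B^(1/2) N^(-1/4), so the left side has the powers m^(2D+1)
    and B^(2D+1/2). The comparison 2D + 1 <= 7D/2 - 3/2 holds from D = 2 on; for D = 1 one factor m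
    is traded for d + 1. *)
Lemma rate_bound (R : realType) (d D m N : nat) (B : R) :
  (0 < d)%N -> (0 < D)%N -> (0 < m)%N -> (0 < N)%N -> 1 <= B -> (D = 1%N -> (m <= d.+1)%N) ->
  (m%:R * B) ^+ (2 * D) *
    Num.sqrt (19 * m%:R * D%:R * (m%:R * B) * Num.sqrt N%:R / N%:R) <=
  d.+1%:R * Num.sqrt 19 *
    (d%:R ^+ 3 * D%:R `^ (1 / 2) * m%:R `^ (7 / 2 * D%:R - 3 / 2)
          * B `^ (7 / 2 * D%:R + 1 / 2) / N%:R `^ (1 / 4)).
Proof.
move=> d0 D0 m0 N0 B1 mD.
have NR : 0 < N%:R :> R by rewrite ltr0n.
have mR : 1 <= m%:R :> R by rewrite ler1n.
have B0 : 0 < B := lt_le_trans ltr01 B1.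
set t := N%:R `^ (1 / 4); set de := D%:R `^ (1 / 2); pose be := B `^ (1 / 2).
have t0 : 0 < t by rewrite powR_gt0.
have de0 : 0 <= de by exact: powR_ge0.
have be0 : 0 <= be by exact: powR_ge0.
have half (x : R) : 0 <= x -> (x `^ (1 / 2)) ^+ 2 = x.
  by move=> x0; rewrite -powR_mulrn ?powR_ge0// -powRrM div1r mulVf// powRr1.
have t4 : t ^+ 4 = N%:R.
  by rewrite -powR_mulrn ?powR_ge0// -powRrM div1r mulVf// powRr1// ltW.
have st : Num.sqrt N%:R = t ^+ 2.
  by rewrite -t4 (_ : t ^+ 4 = (t ^+ 2) ^+ 2) ?sqrtr_sqr ?ger0_norm ?sqr_ge0// -exprM.
have s19 : (Num.sqrt 19 : R) ^+ 2 = 19 by rewrite sqr_sqrtr.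
have -> : 19 * m%:R * D%:R * (m%:R * B) * Num.sqrt N%:R / N%:R =
    (Num.sqrt 19 * m%:R * de * be / t) ^+ 2.
  rewrite expr_div_n !exprMn s19 /be /de !half// ?(ltW B0)// st -t4.
  by field; rewrite gt_eqF.
rewrite sqrtr_sqr ger0_norm; last first.
  by rewrite divr_ge0 ?(ltW t0)// !mulr_ge0// sqrtr_ge0.
rewrite exprMn.
have mE : m%:R ^+ (2 * D) * m%:R <= d.+1%:R * m%:R `^ (7 / 2 * D%:R - 3 / 2) :> R.
  rewrite -exprSr; have [D1|D1] := eqVneq D 1%N.
    rewrite D1 (_ : 7 / 2 * 1%:R - 3 / 2 = 2%:R :> R); last by field.
    by rewrite powR_mulrn// muln1 exprS ler_wpM2r ?sqr_ge0// ler_nat mD.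
  have D2 : (2 <= D)%N by rewrite ltn_neqAle eq_sym D1.
  rewrite -powR_mulrn//; apply: (@le_trans _ _ (m%:R `^ (7 / 2 * D%:R - 3 / 2))).
    apply: ler_powR => //; rewrite -natr1 natrM.
    have : (2 : R) <= D%:R by rewrite ler_nat.
    by lra.
  by rewrite ler_peMl ?powR_ge0// ler1n.
have BE : B ^+ (2 * D) * be <= B `^ (7 / 2 * D%:R + 1 / 2).
  rewrite -powR_mulrn ?(ltW B0)// /be -powRD; last by rewrite gt_eqF// implybT.
  apply: ler_powR => //; rewrite natrM lerD2r.
  have : (0 : R) <= D%:R by [].
  by lra.
have d1 : 1 <= d%:R ^+ 3 :> R by rewrite exprn_ege1// ler1n.
set p := m%:R `^ _ in mE *; set b := B `^ _ in BE *.
have p0 : 0 <= p by exact: powR_ge0.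
have b0 : 0 <= b by exact: powR_ge0.
rewrite (_ : _ * (_ / t) = Num.sqrt 19 * de / t * ((m%:R ^+ (2 * D) * m%:R) * (B ^+ (2 * D) * be))); last by ring.
rewrite (_ : _ * (_ / t) = Num.sqrt 19 * de / t * (d%:R ^+ 3 * ((d.+1%:R * p) * b))); last by ring.
apply: ler_wpM2l; first by rewrite divr_ge0 ?(ltW t0)// mulr_ge0// sqrtr_ge0.
apply: (@le_trans _ _ ((d.+1%:R * p) * b)).
  by apply: ler_pM => //; rewrite mulr_ge0// exprn_ge0// ltW.
by rewrite ler_peMl// !mulr_ge0.
Qed.

(** With z = D K sqrt(N), applying x <= exp(x) to each factor gives log q <= 4 + K + 2 D + D K +
    sqrt(N) <= 9 z. Then q^(2m) accounts for 18 m z, and the leading 2, at most e, for one more m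
    z. *)
Lemma grid_size_bound (R : realType) (D m N q : nat) (B : R) :
  (0 < D)%N -> (0 < m)%N -> (0 < N)%N -> 1 <= B ->
  q%:R <= 16 * B * D%:R ^+ 2 * (m%:R * B) ^+ D * Num.sqrt N%:R ->
  (2 * (q ^ m * q ^ m))%:R <= expR (19 * m%:R * D%:R * (m%:R * B) * Num.sqrt N%:R) :> R.
Proof.
move=> D0 m0 N0 B1 qb.
have mR : 1 <= m%:R :> R by rewrite ler1n.
have DR : 1 <= D%:R :> R by rewrite ler1n.
have NR : 1 <= Num.sqrt N%:R :> R by rewrite -[X in X <= _]sqrtr1 ler_wsqrtr// ler1n.
set K := m%:R * B in qb *; set s := Num.sqrt N%:R in qb NR *.
have BK : B <= K by rewrite ler_peMl// (le_trans ler01).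
have K1 : 1 <= K := le_trans B1 BK.
have B0 : 0 <= B by rewrite (le_trans ler01).
have xe (x : R) : x <= expR x by apply: le_trans (expR_ge1Dx x); rewrite lerDr.
have e2 : 2 <= expR 1 :> R by apply: le_trans (expR_ge1Dx 1); lra.
have e16 : 16 <= expR 4 :> R.
  rewrite -[X in expR X]mulr1 expRM_natl (_ : 16 = 2 ^+ 4); last by ring.
  by apply: lerXn2r => //; rewrite nnegrE// expR_ge0.
have qe : q%:R <= expR (9 * (D%:R * K * s)).
  apply: (le_trans qb).
  apply: (@le_trans _ _ (expR 4 * expR K * expR D%:R ^+ 2 * expR K ^+ D * expR s)).
    have K0 : 0 <= K by exact: le_trans K1.
    have s0 : 0 <= s by exact: le_trans NR.
    have le4 : B <= expR K := le_trans BK (xe K).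
    have le5 : D%:R ^+ 2 <= expR D%:R ^+ 2 :> R by apply: lerXn2r; rewrite ?nnegrE ?expR_ge0.
    have le6 : K ^+ D <= expR K ^+ D by apply: lerXn2r; rewrite ?nnegrE ?expR_ge0.
    have D20 : 0 <= D%:R ^+ 2 :> R by exact: sqr_ge0.
    have KD0 : 0 <= K ^+ D by rewrite exprn_ge0.
    by do ?[apply: ler_pM => //]; rewrite ?mulr_ge0.
  rewrite -!expRM_natl -!expRD ler_expR.
  have DK : D%:R <= D%:R * K by rewrite ler_peMr.
  have KD : K <= D%:R * K by rewrite ler_peMl// (le_trans ler01).
  have DK1 : 1 <= D%:R * K by exact: le_trans DK.
  have P1 : D%:R * K <= D%:R * K * s by rewrite ler_peMr// (le_trans ler01).
  have P2 : s <= D%:R * K * s by rewrite ler_peMl// (le_trans ler01).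
  by lra.
have z1 : 1 <= D%:R * K * s.
  by rewrite -[X in X <= _]mulr1 ler_pM// -[X in X <= _]mulr1 ler_pM.
rewrite -expnD natrM natrX.
apply: (@le_trans _ _ (expR 1 * expR (9 * (D%:R * K * s)) ^+ (m + m))).
  apply: ler_pM => //.
  by apply: lerXn2r; rewrite ?nnegrE ?expR_ge0.
rewrite -expRM_natl -expRD ler_expR natrD.
set z := D%:R * K * s in z1 *.
rewrite (_ : 19 * m%:R * D%:R * K * s = 19 * (m%:R * z)); last by rewrite /z; ring.
rewrite (_ : (m%:R + m%:R) * (9 * z) = 18 * (m%:R * z)); last by ring.
have : 1 <= m%:R * z by rewrite -[X in X <= _]mulr1 ler_pM.
by lra.
Qed.

(** A single layer of width 1 offers d matrix entries and one bias. *)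
Lemma one_layer_weights (d m : nat) (n : nat -> nat) (pos : 'I_m -> weight_slot d n) :
  injective pos -> (forall k, (projT1 (pos k) < 1)%N) -> n 1%N = 1%N -> (m <= d.+1)%N.
Proof.
move=> ipos p1 n1.
pose phi (s : weight_slot d n) : option 'I_d :=
  match s with existT 0 io => io.2 | existT _ _ => None end.
have iphi : injective (phi \o pos).
  move=> k k' /=; have := p1 k; have := p1 k' => h' h hphi; apply: ipos.
  move: h h' hphi; case: (pos k) => -[|//] [i o]; case: (pos k') => -[|//] [i' o'] _ _ /= ->.
  suff -> : i = i' by [].
  apply/val_inj => /=.
  move: (nat_of_ord i) (nat_of_ord i') (ltn_ord i) (ltn_ord i') => u u'.
  by rewrite [width d n 1]n1; case: u u' => [|//] [].
by have := leq_card _ iphi; rewrite card_ord card_option card_ord.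
Qed.

Lemma measure_bigcup_ord0 dT (T : measurableType dT) (R : realType)
    (mu : {measure set T -> \bar R}) N (F : 'I_N -> set T) :
  (forall k, measurable (F k)) -> (forall k, mu (F k) = 0%E) -> mu (\bigcup_k F k) = 0%E.
Proof.
move=> mF F0; pose F' n := if insub n is Some k then F k else set0.
have -> : \bigcup_k F k = \bigcup_n F' n.
  apply/seteqP; split => [w [k _ Fw]|w [n _]].
    by exists k => //; rewrite /F' valK.
  by rewrite /F'; case: insubP => [k _ _ Fw|//]; exists k.
apply: measure_negligible.
  by apply: bigcupT_measurable => n; rewrite /F'; case: insubP => [k _ _|//]; exact: mF.
apply: negligible_bigcup => n; rewrite /F'; case: insubP => [k _ _|_].
  by apply/negligibleP; [exact: mF|exact: F0].
exact: negligible_set0.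
Qed.

(** Turns an almost sure bound into one valid at every point, with the same expectation, which
    matters when the bounded function may fail to be measurable. *)
Lemma integral_add_infinite_null dT (T : measurableType dT) (R : realType)
    (P : {measure set T -> \bar R}) (G : T -> \bar R) (Bad : set T) :
  measurable Bad -> P Bad = 0%E -> measurable_fun setT G -> (forall w, 0 <= G w)%E ->
  (\int[P]_w (G w + (cst +oo \_ Bad) w) = \int[P]_w G w)%E.
Proof.
move=> mB B0 mG G0.
have mi : measurable_fun setT (cst (+oo : \bar R)%E \_ Bad).
  by apply/(measurable_restrictT _ mB); exact: measurable_cst.
rewrite ge0_integralD//; last by move=> w _; rewrite patchE; case: ifP => _; rewrite /= ?leey.
by rewrite -[X in (_ + X)%E]integral_mkcond integral_cst// B0 mule0 adde0.
Qed.

Lemma uniform_on_outside dT (T : measurableType dT) (R : realType) (P : probability T R) d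
    (mu : {measure set 'rV[R]_d -> \bar R}) (D : set 'rV[R]_d) (X : {RV P >-> 'rV[R]_d}) :
  measurable D -> uniform_on mu D X -> P (X @^-1` (~` D)) = 0%E.
Proof.
move=> mD uX; rewrite uX; last exact: measurableC.
by rewrite setICl measure0 /= mul0r.
Qed.

Theorem theorem4p1 (R : realType) (d : nat) (Omega : set 'rV[R]_d)
    (T0 : ('rV[R]_d -> R) -> 'rV[R]_d -> R) (beta0 : R) :
  (0 < d)%N ->
  open Omega -> connected Omega -> Omega !=set0 ->
  (forall x i, Omega x -> 0 <= x 0 i <= 1) ->
  trace_operator Omega T0 ->
  exists C : R -> R -> ('I_d -> 'I_d -> R) -> ('I_d -> R) -> R -> R -> R -> R,
  forall (q : equation R d) (lambda Lambda alpha beta : R),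
  A1 Omega q -> A2 Omega q lambda Lambda -> A3 Omega q lambda ->
  0 < beta -> beta <= beta0 ->
  forall (D m : nat) (n : nat -> nat) (Btheta : R)
    (rho : R -> R) (Brho Brho' Lrho Lrho' : R)
    (pos : 'I_m -> weight_slot d n) (P : set ('rV[R]_d -> R)),
  (0 < D)%N -> (0 < m)%N ->
  (forall l, (0 < l <= D)%N -> (0 < n l)%N) -> n D = 1%N ->
  1 <= Btheta ->
  (forall t, derivable rho t 1) ->
  (forall t, `|rho t| <= Brho) -> Brho <= 1 ->
  (forall t, `|derive1 rho t| <= Brho') -> Brho' <= 1 ->
  (forall s t, `|rho s - rho t| <= Lrho * `|s - t|) -> Lrho <= 1 ->
  (forall s t, `|derive1 rho s - derive1 rho t| <= Lrho' * `|s - t|) -> Lrho' <= 1 ->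
  injective pos -> (forall k, (projT1 (pos k) < D)%N) ->
  P `<=` network_class pos rho D Btheta ->
  forall (dT : measure_display) (T : measurableType dT) (Pr : probability T R)
    (N M : nat) (X : 'I_N -> {RV Pr >-> 'rV[R]_d})
    (Y : 'I_M -> {RV Pr >-> 'rV[R]_d}),
  (0 < N)%N -> N = M ->
  iid_uniform (lebesgue_rV d) Omega X ->
  iid_uniform (surface_measure d) (boundary Omega) Y ->
  (\int[Pr]_w sta_error Omega q T0 P alpha beta
                (fun k => X k w) (fun k => Y k w)
   <= (C (L2_norm Omega (rhs_f q)) (L2_bd_norm Omega (rhs_g q))
         (fun i j => sup_norm Omega (coef_a q i j))
         (fun i => Loo_norm Omega (coef_b q i))
         (Loo_norm Omega (coef_c q)) lambda alpha / beta
       * (d%:R ^+ 3 * D%:R `^ (1 / 2) * m%:R `^ (7 / 2 * D%:R - 3 / 2)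
          * Btheta `^ (7 / 2 * D%:R + 1 / 2) / N%:R `^ (1 / 4)))%:E)%E.
Proof.
move=> d0 oOm _ _ Om01 tT0.
pose mu := @lebesgue_rV R d; pose bd := boundary Omega.
pose sigma : {measure set 'rV[R]_d -> \bar R} := surface_measure d.
have mOm : measurable Omega by exact: sub_sigma_algebra.
have Om_cube : Omega `<=` cube d 1.
  by move=> x Ox j; have /andP[h0 h1] := Om01 x j Ox; rewrite ger0_norm.
have bd_cube := boundary_cube Om_cube.
pose V := fine (mu Omega); pose A := fine (sigma bd).
pose S2 (fn : R) (an : 'I_d -> 'I_d -> R) (bn : 'I_d -> R) (cn : R) := 2 * coef_norm_sum an bn cn ^+ 2 + 2 * fn ^+ 2 / V : R.
pose S2b (gn al : R) := 2 * al ^+ 2 + 2 * gn ^+ 2 / A : R.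
(* The 2 is the one in the definition of the error, (d + 1) sqrt(19) comes from [rate_bound], and 4
   + 8 S2 from [empirical_process] with the normalized second moments of the envelopes. The factor
   [beta0] majorizes beta, in the rewriting of the volume term as (1 / beta) times beta times
   itself. *)
exists (fun fn gn an bn cn _ al => 2 * (d.+1%:R * Num.sqrt 19) *
  (beta0 * (V * (4 + 8 * S2 fn an bn cn)) + A * (4 + 8 * S2b gn al))).
move=> q lambda Lambda alpha beta hA1 _ _ beta_gt0 beta_le D m n Btheta rho Brho Brho' Lrho Lrho'
  pos P D0 m0 _ nD B1 drho rhoB B_le1 rho'B B'_le1 rhoL L_le1 rho'L L'_le1 ipos posD Psub
  dT T Pr N M0 X Y N0 NM iX iY.
subst M0.
have rho1 t : `|rho t| <= 1 := le_trans (rhoB t) B_le1.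
have rho'1 t : `|derive1 rho t| <= 1 := le_trans (rho'B t) B'_le1.
have lipr s t : `|rho s - rho t| <= `|s - t|.
  by apply: (le_trans (rhoL s t)); rewrite ler_piMl.
have lipr' s t : `|derive1 rho s - derive1 rho t| <= `|s - t|.
  by apply: (le_trans (rho'L s t)); rewrite ler_piMl.
have crho' : continuous (derive1 rho).
  move=> t; apply/cvgrPdist_le => e e0; near=> s.
  apply: (le_trans (lipr' t s)); near: s.
  by apply: cvgr_dist_le => //; exact: cvg_id.
have [V0 VE] := iid_uniform_measure N0 iX.
have [A0 AE] := iid_uniform_measure N0 iY.
have mbd : measurable bd by exact: measurable_boundary.
have sfin : (sigma bd < +oo)%E by rewrite AE ltry.
have B0 : 0 < Btheta := lt_le_trans ltr01 B1.
pose K := m%:R * Btheta.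
have mR : 1 <= m%:R :> R by rewrite ler1n.
have K1 : 1 <= K by rewrite -[X in X <= _]mulr1 ler_pM.
have K0 : 0 < K := lt_le_trans ltr01 K1.
pose M := K ^+ D.
have M1 : 1 <= M by exact: exprn_ege1.
have M0 : 0 < M := lt_le_trans ltr01 M1.
pose box := [set theta : 'rV[R]_m | forall k, `|theta 0 k| <= Btheta].
have netC1 theta : box theta -> C1_bounded M (network pos theta rho D).
  move=> tB; split.
  - exact: continuous_network.
  - by move=> i x; exact: derivable_network.
  - by move=> i; exact: continuous_partial_network.
  - by move=> x xc; exact: network_bound.
  - by move=> i x xc; exact: partial_network_bound.
pose s := Num.sqrt (N%:R : R).
have s1 : 1 <= s by rewrite -[X in X <= _]sqrtr1 ler_wsqrtr// ler1n.
have NR : 0 < N%:R :> R by rewrite ltr0n.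
pose Lg := 19 * m%:R * D%:R * K * s.
have DR : 1 <= D%:R :> R by rewrite ler1n.
have Lg1 : 1 <= Lg.
  by rewrite /Lg; do 4!(rewrite -[X in X <= _]mulr1; apply: ler_pM => //); lra.
pose r := Num.sqrt (Lg / N%:R).
have LgN : 0 < Lg / N%:R by rewrite divr_gt0// (lt_le_trans ltr01).
have r0 : 0 < r by rewrite sqrtr_gt0.
have NrL : N%:R * r ^+ 2 = Lg by rewrite sqr_sqrtr ?ltW// mulrCA divff ?mulr1// gt_eqF.
have rs1 : 1 <= r * s.
  by rewrite /r /s -sqrtrM ?(ltW LgN)// divfK ?gt_eqF// -[X in X <= _]sqrtr1 ler_wsqrtr.
(* The product 2 M e equals kappa times 8 B D^2 M over the number of grid points per weight. It must
   be at most kappa r, and 1 / r <= s, which leads to [Q]. Since Q >= 1, the integer [gq] lies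
   between Q and 2 Q. *)
pose Q := 8 * Btheta * D%:R ^+ 2 * M * s.
have Q1 : 1 <= Q.
  have D21 : 1 <= D%:R ^+ 2 :> R by rewrite exprn_ege1.
  by rewrite /Q; do 4!(rewrite -[X in X <= _]mulr1; apply: ler_pM => //); lra.
pose gq := (Num.truncn Q).+1.
have /andP[gq1 gq2] := truncn_itv (le_trans ler01 Q1).
have gqQ : Q <= gq%:R by exact: ltW.
have gq2Q : gq%:R <= 16 * Btheta * D%:R ^+ 2 * M * s.
  by rewrite /gq -natr1 (_ : 16 * _ * _ * _ * _ = Q + Q); [lra|rewrite /Q; ring].
have gqR : 0 < gq%:R :> R by rewrite ltr0n.
pose I : finType := ({ffun 'I_m -> 'I_gq} * {ffun 'I_m -> 'I_gq})%type.
have cI : (2 * #|I|)%:R <= expR Lg.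
  rewrite card_prod card_ffun !card_ord.
  exact: grid_size_bound.
(* Pairs of weight vectors, one for u and one for v, over the whole box: the deviation is bounded
   uniformly over the full class, into which P is embedded. *)
pose J := {p : 'rV[R]_m * 'rV[R]_m | box p.1 /\ box p.2}.
pose rep (i : I) : J := exist _ (grid Btheta i.1, grid Btheta i.2)
  (conj (fun k => grid_bound i.1 k (ltW B0)) (fun k => grid_bound i.2 k (ltW B0))).
pose U (j : J) := network pos (sval j).1 rho D.
pose W (j : J) := network pos (sval j).2 rho D.
have UC1 j : C1_bounded M (U j) by apply: netC1; case: (svalP j).
have WC1 j : C1_bounded M (W j) by apply: netC1; case: (svalP j).
pose e := 2 * D%:R ^+ 2 * K ^+ (2 * D) * (2 * Btheta / gq%:R).
pose kappa := M ^+ 2.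
have kappa0 : 0 < kappa by exact: exprn_gt0.
have ekr : 2 * M * e <= kappa * r.
  have -> : 2 * M * e = kappa * (8 * Btheta * D%:R ^+ 2 * M / gq%:R).
    by rewrite /e /kappa mulnC exprM -/M; field; rewrite gt_eqF.
  rewrite ler_pM2l// ler_pdivrMr//.
  have b0 : 0 <= 8 * Btheta * D%:R ^+ 2 * M by rewrite !mulr_ge0// ?sqr_ge0// ltW.
  apply: (@le_trans _ _ (r * Q)); last by rewrite ler_pM2l.
  rewrite (_ : r * Q = r * s * (8 * Btheta * D%:R ^+ 2 * M)); last by rewrite /Q; ring.
  by rewrite ler_peMl.
have lip j : exists i, forall x, cube d 1 x ->
   [/\ `|U j x - U (rep i) x| <= e, `|W j x - W (rep i) x| <= e,
      forall k, `|partial k (U j) x - partial k (U (rep i)) x| <= e &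
      forall k, `|partial k (W j) x - partial k (W (rep i)) x| <= e].
  case: j => -[t1 t2] [/= b1 b2].
  have [i1 Hi1] := grid_net (ltn0Sn _ : (0 < gq)%N) B0 b1.
  have [i2 Hi2] := grid_net (ltn0Sn _ : (0 < gq)%N) B0 b2.
  have g1 k := grid_bound i1 k (ltW B0).
  have g2 k := grid_bound i2 k (ltW B0).
  have eps0 : 0 <= 2 * Btheta / gq%:R by rewrite divr_ge0 ?mulr_ge0 ?ltW.
  (* The Lipschitz constant of the values is below that of the derivatives, so e serves for both. *)
  have weak : D%:R * K ^+ D * (2 * Btheta / gq%:R) <= e.
    rewrite /e ler_wpM2r// ler_pM ?exprn_ge0 ?(ltW K0)//.
      by rewrite expr2; nra.
    by rewrite ler_weXn2l// leq_pmull.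
  exists (i1, i2) => x xc; rewrite /U /W /=; split.
  - by apply: le_trans weak; exact: network_lipschitz.
  - by apply: le_trans weak; exact: network_lipschitz.
  - by move=> k; exact: partial_network_lipschitz.
  - by move=> k; exact: partial_network_lipschitz.
have hvol j y : Omega y -> `|volume_integrand q (U j) (W j) y| <= kappa * volume_envelope q y.
  move=> /Om_cube yc; apply: volume_integrand_bound => //.
  - exact: C1_bound (UC1 j) y yc.
  - exact: C1_bound (WC1 j) y yc.
  - by move=> k; exact: C1_partial_bound (UC1 j) k y yc.
  - by move=> k; exact: C1_partial_bound (WC1 j) k y yc.
have hbd j y : bd y ->
    `|boundary_integrand q alpha (U j) (W j) y| <= kappa * boundary_envelope q alpha y.
  move=> /bd_cube yc; apply: boundary_integrand_bound => //.
  - exact: C1_bound (UC1 j) y yc.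
  - exact: C1_bound (WC1 j) y yc.
set S2v := S2 _ _ _ _; set S2w := S2b _ _.
have [H1 [mH1 H10 HH1 EH1]] : exists H : T -> R, [/\ measurable_fun setT H, forall w, 0 <= H w,
    forall w j, (forall k, Omega (X k w)) ->
      `|V / N%:R * \sum_k volume_integrand q (U j) (W j) (X k w)
        - \int[mu]_(y in Omega) volume_integrand q (U j) (W j) y| <= H w &
    (\int[Pr]_w (H w)%:E <= (V * (kappa * r * (4 + 8 * S2v)))%:E)%E].
  apply: (@uniform_deviation _ _ _ Pr d N X mu Omega (volume_envelope q) S2v J I rep
    (fun j => volume_integrand q (U j) (W j)) kappa Lg r) => //.
  - exact: measurable_volume_envelope.
  - by move=> y _; exact: volume_envelope_ge0.
  - exact: volume_envelope_norm.
  - by move=> j; exact: measurable_volume_integrand (UC1 j) (WC1 j).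
  - move=> j; have [i Hi] := lip j; exists i => y /Om_cube yc.
    have [h1 h2 h3 h4] := Hi y yc.
    apply: le_trans (ler_wpM2r (volume_envelope_ge0 q y) ekr).
    apply: volume_integrand_lipschitz => //.
    + exact: C1_bound (WC1 j) y yc.
    + by move=> k; exact: C1_partial_bound (WC1 j) k y yc.
    + exact: C1_bound (UC1 (rep i)) y yc.
    + by move=> k; exact: C1_partial_bound (UC1 (rep i)) k y yc.
have [H2 [mH2 H20 HH2 EH2]] : exists H : T -> R, [/\ measurable_fun setT H, forall w, 0 <= H w,
    forall w j, (forall k, bd (Y k w)) ->
      `|A / N%:R * \sum_k boundary_integrand q alpha (U j) (W j) (Y k w)
        - \int[sigma]_(y in bd) boundary_integrand q alpha (U j) (W j) y| <= H w &
    (\int[Pr]_w (H w)%:E <= (A * (kappa * r * (4 + 8 * S2w)))%:E)%E].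
  apply: (@uniform_deviation _ _ _ Pr d N Y sigma bd (boundary_envelope q alpha) S2w J I rep
    (fun j => boundary_integrand q alpha (U j) (W j)) kappa Lg r) => //.
  - exact: measurable_boundary_envelope.
  - by move=> y _; exact: boundary_envelope_ge0.
  - exact: boundary_envelope_norm.
  - by move=> j; exact: measurable_boundary_integrand (UC1 j) (WC1 j).
  - move=> j; have [i Hi] := lip j; exists i => y /bd_cube yc.
    have [h1 h2 h3 h4] := Hi y yc.
    apply: le_trans (ler_wpM2r (boundary_envelope_ge0 q alpha y) ekr).
    apply: boundary_integrand_lipschitz => //.
    + exact: C1_bound (WC1 j) y yc.
    + exact: C1_bound (UC1 (rep i)) y yc.
have PJ u v : P u -> P v -> exists j, u = U j /\ v = W j.
  move=> /Psub[t1 b1 <-] /Psub[t2 b2 <-].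
  by exists (exist _ (t1, t2) (conj b1 b2)).
have lossE j : loss Omega q T0 alpha beta (U j) (W j) =
    \int[mu]_(x in Omega) volume_integrand q (U j) (W j) x
    + beta^-1 * \int[sigma]_(x in bd) boundary_integrand q alpha (U j) (W j) x.
  exact: (loss_C1 oOm Om_cube tT0 hA1 sfin alpha beta (UC1 j) (WC1 j)).
have empE j w : empirical_loss Omega q alpha beta (fun k => X k w) (fun k => Y k w) (U j) (W j) =
    V / N%:R * \sum_k volume_integrand q (U j) (W j) (X k w)
    + beta^-1 * (A / N%:R * \sum_k boundary_integrand q alpha (U j) (W j) (Y k w)).
  by rewrite /empirical_loss invfM /volume_integrand /boundary_integrand /V /A /volume /area; ring.
have bi0 : 0 <= beta^-1 by rewrite invr_ge0 ltW.
(* Only finiteness matters here: the value does not enter the rate but keeps the inner suprema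
   finite. *)
have lossB : exists C, forall u v, P u -> P v -> `|loss Omega q T0 alpha beta u v| <= C.
  have iF : mu.-integrable Omega (EFin \o volume_envelope q).
    apply: square_integrable_integrable => //; first by rewrite VE ltry.
      exact: measurable_volume_envelope.
    exact: le_lt_trans (volume_envelope_norm oOm Om_cube hA1 VE V0) (ltry _).
  have iG : sigma.-integrable bd (EFin \o boundary_envelope q alpha).
    apply: square_integrable_integrable => //; first exact: measurable_boundary_envelope.
    exact: le_lt_trans (boundary_envelope_norm hA1 alpha AE A0) (ltry _).
  exists (kappa * \int[mu]_(x in Omega) volume_envelope q x +
    beta^-1 * (kappa * \int[sigma]_(x in bd) boundary_envelope q alpha x)).
  move=> u v Pu Pv; have [j [-> ->]] := PJ u v Pu Pv; rewrite lossE.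
  apply: (le_trans (ler_normD _ _)); apply: lerD.
    apply: norm_Rintegral_le_envelope => //.
      exact: measurable_volume_integrand (UC1 j) (WC1 j).
    by move=> x; exact: hvol.
  rewrite normrM (ger0_norm bi0) ler_wpM2l//.
  apply: norm_Rintegral_le_envelope => //.
    exact: measurable_boundary_integrand (UC1 j) (WC1 j).
  by move=> x; exact: hbd.
have [CL HCL] := lossB.
(* The event that some sample misses its domain; off it, the bounds by [H1] and [H2] apply. *)
pose Bad := \bigcup_k (X k @^-1` (~` Omega)) `|` \bigcup_k (Y k @^-1` (~` bd)).
have mBad : measurable Bad.
  by apply: measurableU; apply: fin_bigcup_measurable => // k _;
    rewrite -[X in measurable X]setTI; apply: measurable_funP => //; exact: measurableC.
have PBad : Pr Bad = 0%E.
  have mX k : measurable (X k @^-1` (~` Omega)).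
    by rewrite -[X in measurable X]setTI; apply: measurable_funP => //; exact: measurableC.
  have mY k : measurable (Y k @^-1` (~` bd)).
    by rewrite -[X in measurable X]setTI; apply: measurable_funP => //; exact: measurableC.
  rewrite null_set_setU//.
  - by apply: fin_bigcup_measurable => // k _; exact: mX.
  - by apply: fin_bigcup_measurable => // k _; exact: mY.
  - by apply: measure_bigcup_ord0 => // k; apply: uniform_on_outside => //; exact: iX.2.
  - by apply: measure_bigcup_ord0 => // k; apply: uniform_on_outside => //; exact: iY.2.
pose G w := 2 * (H1 w + beta^-1 * H2 w).
have G0 w : 0 <= G w by rewrite mulr_ge0// addr_ge0// mulr_ge0.
have mG : measurable_fun setT G.
  by apply: measurable_funM => //; apply: measurable_funD => //; exact: measurable_funM.
have staG w : (sta_error Omega q T0 P alpha beta (fun k => X k w) (fun k => Y k w) <=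
    (G w)%:E + (cst +oo \_ Bad) w)%E.
  rewrite patchE; case: ifPn => [_|]; first by rewrite addey// leey.
  rewrite notin_setE => nBad; rewrite -[point]/(0%E : \bar R) adde0.
  apply: (sta_error_le HCL) => u v Pu Pv; have [j [-> ->]] := PJ u v Pu Pv.
  rewrite lossE empE.
  have XO k : Omega (X k w) by apply: contrapT => h; apply: nBad; left; exists k.
  have YO k : bd (Y k w) by apply: contrapT => h; apply: nBad; right; exists k.
  have h1 := HH1 w j XO; have h2 := HH2 w j YO.
  rewrite opprD addrACA -mulrBr (le_trans (ler_normD _ _))//.
  apply: lerD; first by rewrite distrC.
  by rewrite normrM (ger0_norm bi0) ler_wpM2l// distrC.
apply: (@le_trans _ _ (\int[Pr]_w ((G w)%:E + (cst +oo \_ Bad) w))%E).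
  apply: le_integral_ge0_bound => // w.
  apply: adde_ge0; first by rewrite lee_fin.
  by rewrite patchE; case: ifP => _; rewrite /= ?leey.
rewrite integral_add_infinite_null//; last exact/measurable_EFinP.
have EG : (\int[Pr]_w (G w)%:E <= (2 * (V * (kappa * r * (4 + 8 * S2v))
    + beta^-1 * (A * (kappa * r * (4 + 8 * S2w)))))%:E)%E.
  have m2 : measurable_fun setT (fun w => beta^-1 * H2 w) by exact: measurable_funM.
  have E2 := expectation_affine_le bi0 (lexx 0) mH2 H20 EH2.
  have E12 : (\int[Pr]_w (H1 w + beta^-1 * H2 w)%:E <= (V * (kappa * r * (4 + 8 * S2v))
      + beta^-1 * (A * (kappa * r * (4 + 8 * S2w))))%:E)%E.
    under eq_integral do rewrite EFinD.
    rewrite ge0_integralD//; last 4 first.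
    - by move=> w _; rewrite lee_fin.
    - exact/measurable_EFinP.
    - by move=> w _; rewrite lee_fin mulr_ge0.
    - exact/measurable_EFinP.
    rewrite EFinD; apply: leeD => //; rewrite add0r in E2.
    by apply: le_trans E2; under [leRHS]eq_integral do rewrite add0r.
  have m12 : measurable_fun setT (fun w => H1 w + beta^-1 * H2 w) by exact: measurable_funD.
  have H120 w : 0 <= H1 w + beta^-1 * H2 w by rewrite addr_ge0// mulr_ge0.
  have := expectation_affine_le (ler0n _ 2) (lexx 0) m12 H120 E12.
  by under eq_integral do rewrite add0r; rewrite add0r.
apply: (le_trans EG); rewrite lee_fin.
have mD : D = 1%N -> (m <= d.+1)%N.
  move=> D1; apply: (one_layer_weights ipos); first by move=> k; rewrite -D1.
  by rewrite -[in LHS]D1.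
have := rate_bound d0 D0 m0 N0 B1 mD.
set rate := (_ / N%:R `^ (1 / 4)).
rewrite -/K exprM exprAC -/M -/kappa -/s -/Lg -/r => kr.
have c0 (x y z : R) : 0 < z -> 0 <= 4 + 8 * (2 * x ^+ 2 + 2 * y ^+ 2 / z).
  move=> z0; have x0 := sqr_ge0 x.
  have : 0 <= 2 * y ^+ 2 / z by rewrite divr_ge0 ?(ltW z0)// mulr_ge0// sqr_ge0.
  by lra.
have S2v0 : 0 <= 4 + 8 * S2v by exact: c0.
have S2w0 : 0 <= 4 + 8 * S2w by exact: c0.
(* Factoring out kappa r isolates the quantity bounded by [rate_bound]; writing V as beta V / beta
   leaves beta <= [beta0] as the remaining comparison. *)
rewrite (_ : 2 * _ = kappa * r * (2 / beta * (beta * (V * (4 + 8 * S2v)) + A * (4 + 8 * S2w)))); last first.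
  by field; rewrite gt_eqF.
rewrite (_ : _ / beta * rate = d.+1%:R * Num.sqrt 19 * rate *
  (2 / beta * (beta0 * (V * (4 + 8 * S2v)) + A * (4 + 8 * S2w)))); last by ring.
have kr0 : 0 <= kappa * r by rewrite mulr_ge0// ltW.
have b20 : 0 <= 2 / beta by rewrite mulr_ge0.
have VS : 0 <= V * (4 + 8 * S2v) by rewrite mulr_ge0// ltW.
have AS : 0 <= A * (4 + 8 * S2w) by rewrite mulr_ge0// ltW.
apply: ler_pM => //.
  by rewrite mulr_ge0// addr_ge0// mulr_ge0// ltW.
by rewrite ler_wpM2l// lerD2r ler_wpM2r.
Unshelve. all: by end_near. Qed.
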